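(* The following problem, Shunt, can be solved in $O(n^2(n+m))$ time, where $n$ and $m$ are the numbers of vertices and arcs of $D$: given a digraph $D$ and four distinct vertices $s_1,s_2,t_1,t_2$ of $D$, decide whether $D$ contains an $(\{s_1,s_2\},\{t_1,t_2\})$-shunt.
   Context: All digraphs are strict; a dipath is a directed path; $s(R)$ and $t(R)$ denote the initial and terminal vertices of a dipath $R$, and $R^{\circ}$ denotes $R$ with both end vertices removed. A shunt is a digraph composed of three dipaths $P,Q,R$ such that $R$ has length at least $2$, $s(R)\in V(P)$, $t(R)\in V(Q)$, and $P$, $Q$, $R^{\circ}$ are pairwise vertex-disjoint. It is an $(S,T)$-shunt if $\{s(P),s(Q)\}=S$ and $\{t(P),t(Q)\}=T$. *)

(* Defs.v *)
From mathcomp Require Import all_boot.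

Set Implicit Arguments.
Unset Strict Implicit.
Unset Printing Implicit Defensive.

(* Strict digraphs: a relation has no parallel arcs; opposite arcs are
   allowed. *)
Record digraph := Digraph {
  vertex :> finType;
  arc : rel vertex;
  arc_irrefl : irreflexive arc
}.

Definition arcs (D : digraph) : {set D * D} := [set a | arc a.1 a.2].

Record dipath (D : digraph) := Dipath {
  src : D;
  steps : seq D;
  dipathP : path (@arc D) src steps /\ uniq (src :: steps)
}.

Section Dipath.
Variables (D : digraph) (R : dipath D).
Definition tgt : D := last (src R) (steps R).
Definition verts : seq D := src R :: steps R.
Definition dilength : nat := size (steps R).
Definition interior : seq D := behead (belast (src R) (steps R)).
End Dipath.

Record is_shunt (D : digraph) (P Q R : dipath D) : Prop := IsShunt {
  shunt_length : 2 <= dilength R;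
  shunt_src : src R \in verts P;
  shunt_tgt : tgt R \in verts Q;
  shunt_disjPQ : [disjoint verts P & verts Q];
  shunt_disjPR : [disjoint verts P & interior R];
  shunt_disjQR : [disjoint verts Q & interior R]
}.

Definition contains_shunt (D : digraph) (S T : {set D}) : Prop :=
  exists P Q R : dipath D,
    [/\ is_shunt P Q R, [set src P; src Q] = S & [set tgt P; tgt Q] = T].

(* Time is measured on a random access machine, presented as a structured
   language over registers and arrays of natural numbers; every expression
   node, test node and instruction executed costs one unit.  A program names
   finitely many registers and arrays, but arrays are indexed by computed
   values.  The only arithmetic is successor and predecessor: after t steps
   no stored number exceeds t plus the largest number in the program and the
   input, so polynomial-time runs only handle words of logarithmic length. *)
Inductive expr :=
| Num of nat
| Reg of nat
| Get of nat & expr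
| Succ of expr
| Pred of expr.

Inductive test :=
| TEq of expr & expr
| TLt of expr & expr
| TNot of test
| TAnd of test & test.

Inductive prog :=
| Skip
| Assign of nat & expr
| Put of nat & expr & expr
| Comp of prog & prog
| If of test & prog & prog
| While of test & prog.

Record store := Store {
  reg : nat -> nat;
  arr : nat -> nat -> nat
}.

Definition upd (T : Type) (f : nat -> T) (x : nat) (v : T) : nat -> T :=
  fun y => if y == x then v else f y.

Definition set_reg (st : store) (x v : nat) : store :=
  Store (upd (reg st) x v) (arr st).

Definition set_arr (st : store) (a i v : nat) : store :=
  Store (reg st) (upd (arr st) a (upd (arr st a) i v)).

Fixpoint eval (st : store) (e : expr) : nat :=
  match e with
  | Num k => k
  | Reg x => reg st x
  | Get a i => arr st a (eval st i)
  | Succ e => (eval st e).+1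
  | Pred e => (eval st e).-1
  end.

Fixpoint ecost (e : expr) : nat :=
  match e with
  | Num _ | Reg _ => 1
  | Get _ e | Succ e | Pred e => (ecost e).+1
  end.

Fixpoint holds (st : store) (b : test) : bool :=
  match b with
  | TEq e f => eval st e == eval st f
  | TLt e f => eval st e < eval st f
  | TNot b => ~~ holds st b
  | TAnd b c => holds st b && holds st c
  end.

Fixpoint tcost (b : test) : nat :=
  match b with
  | TEq e f | TLt e f => (ecost e + ecost f).+1
  | TNot b => (tcost b).+1
  | TAnd b c => (tcost b + tcost c).+1
  end.

(* [exec p st st' t]: started in [st], [p] halts in [st'] after [t] steps. *)
Inductive exec : prog -> store -> store -> nat -> Prop :=
| ExecSkip st : exec Skip st st 1
| ExecAssign st x e :
    exec (Assign x e) st (set_reg st x (eval st e)) (ecost e).+1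
| ExecPut st a i e :
    exec (Put a i e) st (set_arr st a (eval st i) (eval st e))
         (ecost i + ecost e).+1
| ExecComp st st1 st2 p q t1 t2 :
    exec p st st1 t1 -> exec q st1 st2 t2 ->
    exec (Comp p q) st st2 (t1 + t2).+1
| ExecIfTrue st st1 b p q t :
    holds st b -> exec p st st1 t ->
    exec (If b p q) st st1 (tcost b + t).+1
| ExecIfFalse st st1 b p q t :
    ~~ holds st b -> exec q st st1 t ->
    exec (If b p q) st st1 (tcost b + t).+1
| ExecWhileTrue st st1 st2 b p t1 t2 :
    holds st b -> exec p st st1 t1 -> exec (While b p) st1 st2 t2 ->
    exec (While b p) st st2 (tcost b + t1 + t2).+1
| ExecWhileFalse st b p :
    ~~ holds st b -> exec (While b p) st st (tcost b).+1.

Lemma exec_det p st st1 st2 t1 t2 :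
  exec p st st1 t1 -> exec p st st2 t2 -> st1 = st2 /\ t1 = t2.
Proof.
move=> E; elim: E st2 t2 => {p st st1 t1} *;
  match goal with E : exec _ _ _ _ |- _ = _ /\ _ => inversion E; subst end;
  repeat match goal with
  | IH : forall _ _, exec ?p ?st _ _ -> _, E : exec ?p ?st _ _ |- _ =>
      case: (IH _ _ E) => ? ?; subst; clear IH
  | h : is_true (holds ?st ?b), h' : is_true (~~ holds ?st ?b) |- _ =>
      by rewrite h in h'
  end; by [].
Qed.

(* The answer is read in register 0, nonzero meaning yes; by [exec_det] the
   run is unique. *)
Definition decides_within (p : prog) (input : store) (yes : Prop) (T : nat) :=
  exists (st : store) (t : nat),
    [/\ exec p input st t, t <= T & (reg st 0 != 0) <-> yes].

Definition adjacency_lists (D : digraph) (adj : D -> seq D) : Prop :=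
  forall v : D, uniq (adj v) /\ adj v =i arc v.

Section Input.
Variables (D : digraph) (adj : D -> seq D).

Definition code (v : D) : nat := enum_rank v.

Definition outdegrees : seq nat := [seq size (adj v) | v <- enum D].

Definition offsets : seq nat :=
  [seq sumn (take i outdegrees) | i <- iota 0 #|D|.+1].

Definition targets : seq nat := map code (flatten (map adj (enum D))).

(* The vertices are numbered from 0 to n - 1.  The out-neighbours of the
   vertex v occupy the cells offsets[v], ..., offsets[v+1] - 1 of array 1,
   in any order; all other registers and cells are 0. *)
Definition shunt_input (s1 s2 t1 t2 : D) : store :=
  Store (nth 0 [:: #|D|; code s1; code s2; code t1; code t2])
        (fun a => nth 0 (nth [::] [:: offsets; targets] a)).
End Input.

(* Main.v *)
From mathcomp Require Import all_boot zify.
Require Import Defs.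

Set Implicit Arguments.
Unset Strict Implicit.
Unset Printing Implicit Defensive.

(* Call two disjoint dipaths [P], [Q] from S to T tight if no shunt joins them
   and no vertex incident with an arc between [P] and [Q] can be bypassed by
   rerouting its own path.  Around a tight pair the relevant vertices split into
   the zone of [P] (on walks leaving and re-entering [P] off both paths) and
   that of [Q], and the only arcs between the zones join [P] to [Q].  Hence any
   other pair [X], [Y] of disjoint S-T dipaths changes zones only along pairs of
   arcs [c -> d], [d' -> c'] with [c] before [c'] on [P] and [d'] before [d] on
   [Q] (crossings).  If swapping any crossing gives a tight pair again, then all
   crossings are unit squares, and no [X], [Y] carries a shunt either: a shunt
   would have to run from one side of a used square to the other.

   So it is enough to find one pair by augmentation and, for every vertex [c],
   to swap a crossing at [c] and then, for every vertex [v], to try to reroute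
   around [v] and search for a shunt: n^2 graph searches. *)

(** * Directed paths *)

(** Three facts support this plan. If the pair rerouted around [v] carries no shunt, then [v] has no
    arc to or from the other path, since [v] would lie inside a connection of length at least two;
    so testing every [v] certifies tightness. After a swap whose result is tight, the piece of [P]
    strictly between [c] and [c'] is off both new paths and leads from one to the other, so it is
    empty: this is where unit squares come from. The sides of that square now join the two new
    paths, so its corners are unavoidable, and a different crossing at [c] would reroute around one
    of them. Hence one crossing per [c] suffices, although a digraph may have far more crossings
    than vertices; without this the number of swaps alone would exceed the time bound.

    Every pair that is tested is itself a linkage, so a shunt that is found answers the question.
    The difficulty is that a negative outcome has to speak about all linkages. *)

Section Follows.
Variable T : eqType.
Implicit Types (l : seq T) (a b x y z : T) (U : pred T).

(** Only [b] is required to lie in [l]; the index equation then forces [a] into [l]. *)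
Definition follows l a b := (b \in l) && (index b l == (index a l).+1).

Lemma follows_mem l a b : follows l a b -> a \in l /\ b \in l.
Proof.
case/andP=> bl /eqP e; split=> //; rewrite -index_mem.
by rewrite (leq_trans _ (_ : index b l <= size l)) ?index_size // e.
Qed.

Lemma follows_index l a b : follows l a b -> index b l = (index a l).+1.
Proof. by case/andP=> _ /eqP. Qed.

Lemma index_inj_in l x y : x \in l -> index x l = index y l -> x = y.
Proof.
move=> xl e; have yl : y \in l by rewrite -index_mem -e index_mem.
by rewrite -(nth_index x xl) e nth_index.
Qed.

Lemma follows_injr l a b b' : follows l a b -> follows l a b' -> b = b'.
Proof.
move=> f f'; case: (follows_mem f) => _ bl; apply: (index_inj_in bl).
by rewrite (follows_index f) (follows_index f').
Qed.

Lemma follows_injl l a a' b : follows l a b -> follows l a' b -> a = a'.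
Proof.
move=> f f'; case: (follows_mem f) => al _; apply: (index_inj_in al).
by apply: succn_inj; rewrite -(follows_index f) -(follows_index f').
Qed.

Lemma follows_nth l x0 k : uniq l -> k.+1 < size l ->
  follows l (nth x0 l k) (nth x0 l k.+1).
Proof.
move=> ul kl; rewrite /follows mem_nth //= !index_uniq //; exact: ltnW.
Qed.

Lemma follows_path (e : rel T) x l a b :
  path e x l -> follows (x :: l) a b -> e a b.
Proof.
move=> p f; have [al bl] := follows_mem f; have E := follows_index f.
rewrite -(nth_index x al) -(nth_index x bl) E /=.
have/pathP H := p; apply: H.
by move: bl; rewrite -index_mem E /= ltnS.
Qed.

(** The discrete intermediate value argument used throughout. The last clause, that [U] does not
    recur up to [y], makes it usable for sets that a path may leave and re-enter. *)
Lemma last_switch l U x y : uniq l -> x \in l -> y \in l ->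
  index x l <= index y l -> U x -> ~~ U y ->
  exists a b, [/\ follows l a b, U a, index x l <= index a l,
    index b l <= index y l &
    forall z, z \in l -> index b l <= index z l <= index y l -> ~~ U z].
Proof.
move=> ul xl yl xy Ux Uy.
have K j : j < size l -> index x l <= j -> ~~ U (nth x l j) ->
  exists2 k, index x l <= k < j & U (nth x l k) /\
    forall k', k < k' <= j -> ~~ U (nth x l k').
  elim: j => [|j IH] jl.
    by rewrite leqn0 => /eqP e; rewrite -e nth_index ?Ux.
  rewrite leq_eqVlt => /orP[/eqP e|]; first by rewrite -e nth_index ?Ux.
  rewrite ltnS => ij Nj; have [Uj|Uj] := boolP (U (nth x l j)).
    exists j; first by rewrite ij /=.
    split=> // k' /andP[h1 h2]; have -> // : k' = j.+1 by lia.
  have [k /andP[h1 h2] [h3 h4]] := IH (ltnW jl) ij Uj.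
  exists k; first by rewrite h1 ltnW.
  split=> // k' /andP[g1]; rewrite leq_eqVlt => /orP[/eqP->//|g2].
  by apply: h4; rewrite g1.
have [|||k /andP[h1 h2] [h3 h4]] := K (index y l); rewrite ?index_mem ?nth_index //.
have kl : k.+1 < size l by rewrite (leq_ltn_trans h2) // index_mem.
exists (nth x l k), (nth x l k.+1); rewrite !index_uniq ?(ltnW kl) //.
split=> //; first exact: follows_nth.
move=> z zl ziy; rewrite -(nth_index x zl); exact: h4.
Qed.

Lemma first_switch l U x y : uniq l -> x \in l -> y \in l ->
  index x l <= index y l -> U x -> ~~ U y ->
  exists a b, [/\ follows l a b, ~~ U b, index x l <= index a l,
    index b l <= index y l &
    forall z, z \in l -> index x l <= index z l <= index a l -> U z].
Proof.
move=> ul xl yl xy Ux Uy.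
(* [V] says that [U] has not failed since [x]. Once lost it never recovers, so its last switch is
   the first switch of [U]. *)
pose V z := all (fun w => (index x l <= index w l <= index z l) ==> U w) l.
have Vx : V x.
  apply/allP=> w wl; apply/implyP=> h.
  by rewrite -(@index_inj_in l x w) //; lia.
have Vy : ~~ V y.
  by apply/allPn; exists y; rewrite // xy leqnn.
have [a [b [f /allP Va ia ib Nb]]] := last_switch ul xl yl xy Vx Vy.
have [al bl] := follows_mem f; exists a, b; split=> //.
- have/allPn[w wl] := Nb b bl (introT andP (conj (leqnn _) ib)).
  rewrite (follows_index f) negb_imply => /andP[/andP[h1]].
  rewrite leq_eqVlt => /orP[/eqP e|].
    by rewrite -(follows_index f) in e; rewrite (index_inj_in wl e).
  by rewrite ltnS => h2; have := Va w wl; rewrite h1 h2 /= => ->.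
- by move=> z zl h; have := Va z zl; rewrite h.
Qed.

End Follows.

Section DipathFacts.
Variable D : digraph.
Implicit Types (P Q R A B : dipath D) (x y z v w : D).
Local Notation arc := (@arc D).

Definition ix P x := index x (verts P).

Lemma verts_uniq P : uniq (verts P). Proof. by case: (dipathP P). Qed.
Lemma src_mem P : src P \in verts P. Proof. exact: mem_head. Qed.
Lemma tgt_mem P : tgt P \in verts P. Proof. exact: mem_last. Qed.
Lemma ix_src P : ix P (src P) = 0. Proof. by rewrite /ix /= eqxx. Qed.
Lemma ix_tgt P : ix P (tgt P) = size (steps P).
Proof. by rewrite /ix index_last ?verts_uniq. Qed.

Lemma ix_le_tgt P x : x \in verts P -> ix P x <= ix P (tgt P).
Proof. by rewrite ix_tgt -index_mem ltnS. Qed.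

Lemma follows_arc P x y : follows (verts P) x y -> arc x y.
Proof. by apply: follows_path; case: (dipathP P). Qed.

Lemma ix_inj P x y : x \in verts P -> ix P x = ix P y -> x = y.
Proof. exact: index_inj_in. Qed.

Lemma follows_neq_src P x y : follows (verts P) x y -> y != src P.
Proof.
by move=> f; apply/eqP=> e; have := follows_index f; rewrite e -/(ix _ _) ix_src.
Qed.

Lemma follows_neq_tgt P x y : follows (verts P) x y -> x != tgt P.
Proof.
move=> f; apply/eqP=> e; have [_ yP] := follows_mem f.
have := ix_le_tgt yP; rewrite /ix (follows_index f) e; lia.
Qed.

Lemma dipath_of_seq x l : path arc x l -> uniq (x :: l) ->
  exists P, verts P = x :: l.
Proof. by move=> p u; exists (Dipath (conj p u)). Qed.

Lemma verts_inj_src P x l : verts P = x :: l -> src P = x.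
Proof. by case. Qed.

Lemma verts_tgt P x l : verts P = x :: l -> tgt P = last x l.
Proof. by rewrite /tgt => -[-> ->]. Qed.

Lemma dipath_of_connect (V : pred D) x y :
  V x -> connect [rel a b | arc a b && V b] x y ->
  exists P, [/\ src P = x, tgt P = y & {subset verts P <= V}].
Proof.
move=> Vx /connectP[l]; case/shortenP => l' p u _ ->.
have [|P e] := dipath_of_seq (x := x) (l := l') _ u.
  by apply: sub_path p => a b /andP[].
exists P; rewrite (verts_tgt e) e; split=> //; first by case: e.
move=> z; rewrite inE => /predU1P[->//|].
have : all V l'; last by move/allP=> H /H.
by elim: l' (x) p {u e} => //= a l' IH b /andP[/andP[_ ->] /IH].
Qed.

Lemma connect_follow (e : rel D) P x y :
  (forall a b, follows (verts P) a b -> ix P x <= ix P a ->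
     ix P b <= ix P y -> e a b) ->
  x \in verts P -> y \in verts P -> ix P x <= ix P y -> connect e x y.
Proof.
move=> H xP yP.
have K k : ix P x + k <= ix P y ->
  connect e x (nth (src P) (verts P) (ix P x + k)).
  elim: k => [_|k IH].
    by rewrite addn0 nth_index ?connect0.
  rewrite addnS => h; apply: connect_trans (IH (ltnW h)) _; apply: connect1.
  have h' : (ix P x + k).+1 < size (verts P).
    by rewrite (leq_ltn_trans h) // /ix index_mem.
  apply: H; first by apply: follows_nth (verts_uniq P) _.
    rewrite /ix index_uniq ?verts_uniq //; last exact: ltnW.
    exact: leq_addr.
  by rewrite /ix index_uniq ?verts_uniq.
move=> h; have := K (ix P y - ix P x); rewrite subnKC // leqnn => /(_ isT).
by rewrite nth_index.
Qed.

End DipathFacts.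

(** * Tight pairs and their zones *)

Section Zones.
Variable D : digraph.
Implicit Types (P Q R A B X Y : dipath D) (x y z v w : D).
Local Notation arc := (@arc D).

Definition disj P Q := [disjoint verts P & verts Q].

Definition shuntless P Q := forall R, ~ is_shunt P Q R /\ ~ is_shunt Q P R.

Definition unavoidable P Q x := forall P',
  src P' = src P -> tgt P' = tgt P -> disj P' Q -> x \in verts P'.

Definition tight P Q :=
  [/\ disj P Q, shuntless P Q &
   forall x y, x \in verts P -> y \in verts Q -> arc x y || arc y x ->
     unavoidable P Q x /\ unavoidable Q P y].

Lemma disjC P Q : disj P Q = disj Q P. Proof. exact: disjoint_sym. Qed.

Lemma disjF P Q x : disj P Q -> x \in verts P -> x \in verts Q -> False.
Proof. by move=> d xP xQ; rewrite (disjointFr d xP) in xQ. Qed.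

Lemma shuntlessC P Q : shuntless P Q -> shuntless Q P.
Proof. by move=> h R; case: (h R). Qed.

Lemma tightC P Q : tight P Q -> tight Q P.
Proof.
case=> d /shuntlessC s u; split=> // [|x y xQ yP a]; first by rewrite disjC.
by have [] := u y x yP xQ; rewrite // orbC.
Qed.

Definition off P Q x := (x \notin verts P) && (x \notin verts Q).
(** Every vertex entered is off both paths, and only the start is on [P]; thus for disjoint paths no
    vertex of [Q] satisfies it. In [to] the vertices that are left are restricted instead. *)
Definition from P Q w :=
  [exists p in verts P, connect [rel x y | arc x y && off P Q y] p w].
Definition to P Q w :=
  [exists p in verts P, connect [rel x y | arc x y && off P Q x] w p].
Definition zone P Q w := from P Q w && to P Q w.

Lemma offC P Q : off P Q =1 off Q P. Proof. by move=> x; rewrite /off andbC. Qed.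

Lemma from_mem P Q x : x \in verts P -> from P Q x.
Proof. by move=> h; apply/exists_inP; exists x; rewrite ?connect0. Qed.
Lemma to_mem P Q x : x \in verts P -> to P Q x.
Proof. by move=> h; apply/exists_inP; exists x; rewrite ?connect0. Qed.
Lemma zone_mem P Q x : x \in verts P -> zone P Q x.
Proof. by move=> h; rewrite /zone from_mem ?to_mem. Qed.

Lemma from_step P Q x y : from P Q x -> arc x y -> off P Q y -> from P Q y.
Proof.
case/exists_inP=> p pP c a o; apply/exists_inP; exists p => //.
by apply: connect_trans c (connect1 _); rewrite /= a o.
Qed.
Lemma to_step P Q x y : to P Q y -> arc x y -> off P Q x -> to P Q x.
Proof.
case/exists_inP=> p pP c a o; apply/exists_inP; exists p => //.
by apply: connect_trans (connect1 _) c; rewrite /= a o.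
Qed.

Lemma from_off P Q x : from P Q x -> (x \in verts P) || off P Q x.
Proof.
case/exists_inP=> p pP /connectP[l]; case/lastP: l => [_ ->|l y]; first by rewrite pP.
by rewrite rcons_path last_rcons => /andP[_ /= /andP[_ o]] ->; rewrite o orbT.
Qed.
Lemma to_off P Q x : to P Q x -> (x \in verts P) || off P Q x.
Proof.
case/exists_inP=> p pP /connectP[[_ /= <-|y l /=]]; first by rewrite pP.
by case/andP=> /andP[_ ->]; rewrite orbT.
Qed.

Lemma shunt_of_walk P Q p ws q : disj P Q -> p \in verts P -> q \in verts Q ->
  ws != [::] -> all (off P Q) ws -> path arc p (rcons ws q) ->
  exists R, is_shunt P Q R.
Proof.
move=> dPQ pP qQ; case: ws => //= w ws _ /andP[ow ows] /andP[pw].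
rewrite rcons_path => /andP[pws lq].
have := ow; have : all (off P Q) (w :: ws) by rewrite /= ow.
(* The walk is shortened from its first off vertex [w] on, so [w] survives and the dipath has length
   at least 2. *)
case/shortenP: pws lq => l pl ul sl lq ol.
have {}ol : all (off P Q) (w :: l).
  by move: ol => /= /andP[-> /allP h] /=; apply/allP=> z /sl/h.
move=> _.
have u : uniq (p :: rcons (w :: l) q).
  rewrite cons_uniq rcons_uniq ul andbT; apply/andP; split.
    rewrite mem_rcons in_cons negb_or; apply/andP; split.
      by apply/eqP=> e; apply: (disjF dPQ pP); rewrite e.
    by apply/negP=> /(allP ol); rewrite /off pP.
  by apply/negP=> /(allP ol); rewrite /off qQ andbF.
have pt : path arc p (rcons (w :: l) q) by rewrite /= pw rcons_path pl lq.
pose R := Dipath (conj pt u).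
have ii : interior R = w :: l.
  by rewrite /interior /R /= belast_rcons.
exists R; split=> //=.
- by rewrite /dilength /= size_rcons.
- by rewrite /tgt /= last_rcons.
- rewrite ii disjoint_sym; apply/pred0P=> z /=; apply/negP=> /andP[/(allP ol)].
  by case/andP=> /negP.
- rewrite ii disjoint_sym; apply/pred0P=> z /=; apply/negP=> /andP[/(allP ol)].
  by case/andP=> _ /negP.
Qed.

(** Such a vertex is on neither path, hence it is an interior vertex of a connecting walk. All later
    separation of the two zones rests on this. *)
Lemma bridge P Q v : disj P Q -> from P Q v -> to Q P v -> exists R, is_shunt P Q R.
Proof.
move=> dPQ f t; have := from_off f; have := to_off t.
have [vP|nvP] := boolP (v \in verts P).
  by rewrite /off vP /= andbF orbF => vQ _; case: (disjF dPQ vP vQ).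
have [vQ|nvQ] := boolP (v \in verts Q).
  by rewrite /off vQ andbF orbF => _ .
move=> _ _.
case/exists_inP: f => p pP /connectP[l1 p1 e1].
case/exists_inP: t => q qQ /connectP[l2 p2 e2].
have o1 : all (off P Q) l1.
  elim: l1 p {e1 pP} p1 => //= a l IH b /andP[/andP[_ ->]]; exact: IH.
case/lastP: l2 e2 p2 => [/= e|l2 q' + p2]; first by rewrite -e qQ in nvQ.
rewrite last_rcons => e; rewrite -{}e in p2.
have o2 : all (off P Q) l2.
  have : all (off P Q) (belast v (rcons l2 q)).
    elim: (rcons l2 q) v p2 {nvP nvQ e1} => //= a l IH b /andP[/andP[_ o]].
    by rewrite offC o; exact: IH.
  by rewrite belast_rcons /= => /andP[].
apply: (@shunt_of_walk P Q p (l1 ++ l2) q dPQ pP qQ).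
- case: l1 e1 {p1 o1} => //= e; by rewrite e pP in nvP.
- by rewrite all_cat o1.
- rewrite -cats1 -catA cat_path; apply/andP; split.
    by apply: sub_path p1 => ? ? /andP[].
  by rewrite -e1 cats1; apply: sub_path p2 => ? ? /andP[].
Qed.

Lemma no_bridge P Q v : disj P Q -> shuntless P Q -> from P Q v -> to Q P v -> False.
Proof. by move=> d sl f t; have [R sh] := bridge d f t; case: (sl R). Qed.

(** On a walk from the paths to [w] the last path met decides [from], and on a walk from [w] to the
    paths the first one met decides [to]. If they differ, [w] is a bridge. *)
Lemma useful_zone P Q w : disj P Q -> shuntless P Q ->
  (exists2 x, (x \in verts P) || (x \in verts Q) & connect arc x w) ->
  (exists2 y, (y \in verts P) || (y \in verts Q) & connect arc w y) ->
  zone P Q w || zone Q P w.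
Proof.
move=> dPQ sl [x xF /connectP[l1 p1 e1]] [y yF /connectP[l2 p2 e2]].
have f : from P Q w || from Q P w.
  rewrite {w l2 p2 e2}e1; elim/last_ind: l1 p1 => [_|l z IH] /=.
    by case/orP: xF => h; rewrite (from_mem _ h) ?orbT.
  rewrite rcons_path last_rcons => /andP[/IH f a].
  have [zP|nP] := boolP (z \in verts P); first by rewrite from_mem.
  have [zQ|nQ] := boolP (z \in verts Q); first by rewrite orbC from_mem.
  have o : off P Q z by rewrite /off nP.
  by case/orP: f => /from_step/(_ a) ->; rewrite ?orbT // offC.
have t : to P Q w || to Q P w.
  elim: l2 w {l1 p1 e1 f} p2 e2 => [w _ e|z l IH w] /=.
    by rewrite e /= in yF; case/orP: yF => h; rewrite (to_mem _ h) ?orbT.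
  case/andP=> a /IH{}IH /IH t.
  have [zP|nP] := boolP (w \in verts P); first by rewrite to_mem.
  have [zQ|nQ] := boolP (w \in verts Q); first by rewrite orbC to_mem.
  have o : off P Q w by rewrite /off nP.
  by case/orP: t => /to_step/(_ a) ->; rewrite ?orbT // offC.
have dQP : disj Q P by rewrite disjC.
case/orP: f => f; case/orP: t => t; rewrite /zone ?f ?t ?orbT //.
  by case: (no_bridge dPQ sl f t).
by case: (no_bridge dQP (shuntlessC sl) f t).
Qed.

Lemma zone_disj P Q w : disj P Q -> shuntless P Q ->
  zone P Q w -> zone Q P w -> False.
Proof. by move=> d s /andP[f _] /andP[_ t]; exact: no_bridge d s f t. Qed.

(** An end of the arc that is off the paths would inherit [from] or [to] across the arc and become a
    bridge. *)
Lemma cross_arc P Q u v : disj P Q -> shuntless P Q ->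
  zone P Q u -> zone Q P v -> arc u v -> u \in verts P /\ v \in verts Q.
Proof.
move=> d s /andP[fu tu] /andP[fv tv] a.
have [oP|oP] := boolP (off P Q u).
  by case: (no_bridge d s fu (to_step tv a _)); rewrite offC.
have [oQ|oQ] := boolP (off P Q v).
  by case: (no_bridge d s (from_step fu a oQ) tv).
by move: (from_off fu) (from_off fv); rewrite (negPf oP) offC (negPf oQ) !orbF.
Qed.

(* A vertex [x] bypassed by [P'] still hangs off [P'] along [P], so a cross arc
   at [x] extends to a connection of length at least two. *)
Lemma bypass_shunt P P' Q x y : disj P Q -> disj P' Q ->
  src P' = src P -> tgt P' = tgt P -> x \in verts P -> x \notin verts P' ->
  y \in verts Q -> arc x y || arc y x -> ~ shuntless P' Q.
Proof.
move=> d d' es et xP xP' yQ a sl.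
have ox : off P' Q x by rewrite /off xP' (disjointFr d xP).
have H z : z \in verts P -> (z \in verts P') || off P' Q z.
  by move=> zP; rewrite /off (disjointFr d zP) andbT; case: (_ \in _).
case/orP: a => a.
- have fr : from P' Q x.
    (* [p] is the last vertex of [P'] met on [P] before [x]; from there to [x], [P] runs off both
       [P'] and [Q]. *)
    have [||p [q [f pP' qP' h hz]]] := @last_switch _ (verts P) (mem (verts P')) (src P) x
        (verts_uniq P) (src_mem P) xP _ _ xP'.
      by rewrite -/(ix _ _) ix_src.
      by rewrite /= -es src_mem.
    apply/exists_inP; exists p => //=.
    have [pP qP] := follows_mem f.
    apply: (@connect_follow _ _ P) => //; last first.
      by rewrite /ix; rewrite (follows_index f) in h; exact: ltnW.
    move=> b c fbc i1 i2; rewrite /= (follows_arc fbc) /=.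
    have [bP cP] := follows_mem fbc.
    move: (H c cP) => /orP[|//] cP'; have := hz c cP; rewrite /= cP' /=.
    suff -> : index q (verts P) <= index c (verts P) <= index x (verts P) by move/(_ isT).
    by rewrite i2 (follows_index f) (follows_index fbc) ltnS i1.
  have t : to Q P' x by apply: to_step (to_mem _ yQ) a _; rewrite offC.
  exact: no_bridge d' sl fr t.
- have t : to P' Q x.
    have [||p [q [f + h i2 hz]]] := @first_switch _ (verts P) (predC (mem (verts P'))) x (tgt P)
        (verts_uniq P) xP (tgt_mem P) (ix_le_tgt xP).
      by [].
      by rewrite /= negbK -et tgt_mem.
    rewrite /= negbK => qP'; apply/exists_inP; exists q => //=.
    have [pP qP] := follows_mem f.
    apply: (@connect_follow _ _ P) => //; last first.
      by rewrite /ix (follows_index f) ltnW.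
    move=> b c fbc i1 i3; rewrite /= (follows_arc fbc) /=.
    have [bP cP] := follows_mem fbc.
    move: (H b bP) => /orP[bP'|//].
    suff : predC (mem (verts P')) b by rewrite /= bP'.
    apply: hz => //; move: i3; rewrite /ix (follows_index f) (follows_index fbc) ltnS.
    by move=> ->; rewrite andbT.
  have f : from Q P' x by apply: from_step (from_mem _ yQ) a _; rewrite offC.
  by have := no_bridge _ (shuntlessC sl) f t; rewrite disjC d' => /(_ isT).
Qed.

End Zones.

(** * The part of a zone before a given vertex *)

Section Before.
Variable D : digraph.
Variables P Q : dipath D.
Hypotheses (dPQ : disj P Q) (slPQ : shuntless P Q).
Local Notation arc := (@arc D).

(** Reachability from the source in the zone with [c] deleted. The set is closed under arcs within
    the zone except those into [c], so within the zone it is left only by entering [c]. The first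
    conjunct is there because the relation does not constrain the start. *)
Definition bef c x := (src P != c) &&
  connect [rel x y | arc x y && (zone P Q y && (y != c))] (src P) x.

Lemma bef_step c x y : bef c x -> arc x y -> zone P Q y -> y != c -> bef c y.
Proof.
case/andP=> sc h a z n; rewrite /bef sc.
by apply: connect_trans h (connect1 _); rewrite /= a z n.
Qed.

Lemma bef_zone c x : bef c x -> zone P Q x && (x != c).
Proof.
case/andP=> sc /connectP[l]; case/lastP: l => [_ -> /=|l y].
  by rewrite zone_mem ?src_mem.
by rewrite rcons_path last_rcons => /andP[_ /= /andP[_ h]] ->.
Qed.

Lemma zoneF x : zone P Q x -> x \notin verts Q.
Proof.
move=> zx; apply/negP=> xQ; apply: (zone_disj dPQ slPQ zx); exact: zone_mem.
Qed.

Lemma bef_src c : src P != c -> bef c (src P).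
Proof. by rewrite /bef => ->; rewrite connect0. Qed.

(** The zone misses [Q], so a path inside it that avoids [c] would be a rerouting of [P] around
    [c]. *)
Lemma bef_tgt c : unavoidable P Q c -> ~~ bef c (tgt P).
Proof.
move=> uc; apply/negP=> /andP[sc h].
pose V := [pred y | zone P Q y && (y != c)].
have Vs : V (src P) by rewrite /= zone_mem ?src_mem.
have [P' [es et sub]] := @dipath_of_connect D V _ _ Vs h.
have d : disj P' Q.
  apply/pred0P=> z /=; apply/negP=> /andP[/sub/andP[/zoneF/negP]].
  by [].
by have /sub := uc P' es et d; rewrite inE eqxx andbF.
Qed.

Lemma bef_follow c x y : bef c x -> x \in verts P -> y \in verts P ->
  ix P x <= ix P y -> (forall z, z \in verts P -> ix P x < ix P z <= ix P y -> z != c) ->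
  bef c y.
Proof.
move=> b xP yP xy nc; case/andP: b => sc b; rewrite /bef sc.
apply: connect_trans b _; apply: (@connect_follow _ _ P) => // u v f i1 i2 /=.
have [uP vP] := follows_mem f.
rewrite (follows_arc f) zone_mem //=; apply: nc => //.
by rewrite /ix (follows_index f) ltnS i1 -(follows_index f).
Qed.

(** If a vertex at or after [c] on [P] were [bef c], following [P] from it would reach the target
    without entering [c]. *)
Lemma bef_ix c x : unavoidable P Q c -> c \in verts P -> x \in verts P ->
  bef c x = (ix P x < ix P c).
Proof.
move=> uc cP xP; apply/idP/idP=> [b|lt].
  rewrite ltnNge; apply/negP=> h; case/negP: (bef_tgt uc).
  apply: bef_follow b xP (tgt_mem P) (ix_le_tgt xP) _ => z zP /andP[h1 _].
  by apply: contraTneq h1 => ->; rewrite -leqNgt.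
have sc : src P != c by apply: contraTneq lt => <-; rewrite ix_src.
apply: bef_follow (bef_src sc) (src_mem P) xP _ _; first by rewrite ix_src.
move=> z zP /andP[_ h]; apply: contraTneq h => ->; by rewrite -ltnNge.
Qed.

Lemma zone_connect_src w : zone P Q w ->
  connect [rel x y | arc x y && zone P Q y] (src P) w.
Proof.
case/andP=> /exists_inP[p pP /connectP[l pl el]] tw.
have h1 : connect [rel x y | arc x y && zone P Q y] (src P) p.
  apply: (@connect_follow _ _ P) => //; rewrite ?src_mem ?ix_src //.
  by move=> u v f _ _ /=; rewrite (follows_arc f) zone_mem //; case: (follows_mem f).
apply: connect_trans h1 _; rewrite {w}el in tw *.
have : from P Q p by exact: from_mem.
elim: l p pl tw {pP} => [|y l IH] p /=; first by rewrite connect0.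
case/andP=> /andP[a o] pl tw fp; have fy := from_step fp a o.
apply: connect_trans (IH y pl tw fy); apply: connect1; rewrite /= a /zone fy /=.
elim: l y pl tw o {IH a fy} => [//|z l IH] y /= /andP[/andP[a' o'] pl] tw oy.
exact: to_step (IH z pl tw o') a' oy.
Qed.

Lemma zone_connect_tgt w : zone P Q w ->
  connect [rel x y | arc x y && zone P Q y] w (tgt P).
Proof.
case/andP=> fw /exists_inP[p pP /connectP[l pl el]].
have h1 : connect [rel x y | arc x y && zone P Q y] p (tgt P).
  apply: (@connect_follow _ _ P) => //; rewrite ?tgt_mem ?ix_le_tgt //.
  by move=> u v f _ _ /=; rewrite (follows_arc f) zone_mem //; case: (follows_mem f).
apply: connect_trans _ h1.
elim: l w pl el fw => [|y l IH] w /=; first by move=> _ ->; rewrite connect0.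
case/andP=> /andP[a o] pl el fw.
case: l IH pl el => [_ _ e|z l IH /= pl el].
  by rewrite /= in e; rewrite e in pP *; apply: connect1; rewrite /= a zone_mem.
have oy : off P Q y by case/andP: pl => /andP[].
have fy := from_step fw a oy.
apply: connect_trans (IH y pl el fy); apply: connect1; rewrite /= a /zone fy /=.
apply/exists_inP; exists p => //; apply/connectP; by exists (z :: l).
Qed.

End Before.

(** * Crossings *)

Section Crossing.
Variable D : digraph.
Implicit Types (P Q R A B X Y : dipath D) (x y z v w c d : D).
Local Notation arc := (@arc D).

Definition crossing P Q c d d' c' :=
  [/\ [/\ c \in verts P, c' \in verts P, d \in verts Q & d' \in verts Q],
      arc c d, arc d' c', ix P c < ix P c' & ix Q d' < ix Q d].

(** The swap exchanges targets: [A] ends where [Q] does and [B] where [P] does. *)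
Definition swapped P Q c d d' c' A B :=
  verts A = take (ix P c).+1 (verts P) ++ drop (ix Q d) (verts Q) /\
  verts B = take (ix Q d').+1 (verts Q) ++ drop (ix P c') (verts P).

Definition rigid P Q := forall c d d' c', crossing P Q c d d' c' ->
  [/\ ix P c' = (ix P c).+1, ix Q d = (ix Q d').+1 &
      exists A B, swapped P Q c d d' c' A B /\ tight A B].

Lemma crossingC P Q c d d' c' : crossing P Q c d d' c' -> crossing Q P d' c' c d.
Proof. by case=> [[? ? ? ?] ? ? ? ?]. Qed.

Lemma rigidC P Q : rigid P Q -> rigid Q P.
Proof.
move=> H c d d' c' /crossingC/H [-> -> [A [B [[sA sB] t]]]]; split=> //.
by exists B, A; split; [split | exact: tightC].
Qed.

Lemma mem_take_ix P k x : x \in verts P -> (x \in take k (verts P)) = (ix P x < k).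
Proof. by move=> xP; rewrite in_take. Qed.

Lemma mem_drop_ix P k x : x \in verts P -> (x \in drop k (verts P)) = (k <= ix P x).
Proof.
move=> xP; have := xP; rewrite -{1}(cat_take_drop k (verts P)) mem_cat.
have := verts_uniq P; rewrite -{1}(cat_take_drop k (verts P)) cat_uniq.
case/and3P=> _ /hasPn h _; rewrite mem_take_ix // [k <= _]leqNgt.
case: (boolP (x \in drop _ _)) => [/h /=|_]; first by rewrite mem_take_ix // => ->.
by rewrite orbF => ->.
Qed.

Lemma mem_take_verts P k x : x \in take k (verts P) -> x \in verts P.
Proof. exact: mem_take. Qed.
Lemma mem_drop_verts P k x : x \in drop k (verts P) -> x \in verts P.
Proof. exact: mem_drop. Qed.

(* Follow [P] up to [c], then [Q] from [d] on. *)
Lemma splice P Q c d : c \in verts P -> d \in verts Q -> arc c d ->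
  (forall x, x \in verts P -> x \in verts Q -> ix P x <= ix P c -> ix Q x < ix Q d) ->
  exists A, [/\ verts A = take (ix P c).+1 (verts P) ++ drop (ix Q d) (verts Q),
    src A = src P & tgt A = tgt Q].
Proof.
move=> cP dQ a dis.
have dsz : ix Q d < size (verts Q) by rewrite /ix index_mem.
have csz : ix P c < size (verts P) by rewrite /ix index_mem.
set l1 := take _ _; set l2 := drop _ _.
have e1 : l1 = src P :: take (ix P c) (steps P) by [].
have e2 : l2 = d :: drop (ix Q d).+1 (verts Q).
  by rewrite /l2 (drop_nth d dsz) nth_index.
have l1l : last (src P) (take (ix P c) (steps P)) = c.
  rewrite -[LHS]/(last (src P) (take (ix P c).+1 (verts P))).
  by rewrite (take_nth (src P) csz) last_rcons nth_index.
have p1 : path arc (src P) (take (ix P c) (steps P)).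
  by apply: take_path; case: (dipathP P).
have p2 : path arc d (drop (ix Q d).+1 (verts Q)).
  by have: sorted arc l2; [apply: drop_sorted; case: (dipathP Q) | rewrite e2].
have u : uniq (l1 ++ l2).
  rewrite cat_uniq take_uniq ?drop_uniq ?verts_uniq //= andbT.
  apply/hasPn=> x x2; apply/negP=> x1.
  have xP := mem_take x1; have xQ := mem_drop x2.
  move: x1 x2; rewrite /l1 /l2 mem_take_ix // mem_drop_ix // ltnS.
  by move=> /(dis x xP xQ); rewrite ltnNge => /negP.
have [|//|A eA] := @dipath_of_seq D (src P) (take (ix P c) (steps P) ++ l2).
  by rewrite cat_path p1 l1l e2 /= a.
exists A; split; first by rewrite eA.
  exact: verts_inj_src eA.
rewrite (verts_tgt eA) last_cat l1l e2 /=.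
have := last_cat (src Q) (take (ix Q d) (verts Q)) l2.
by rewrite cat_take_drop e2 /= => <-.
Qed.

(** The two inequalities of a crossing are what keeps the pieces of one path, now on different
    sides, apart. *)
Lemma swapped_exists P Q c d d' c' : disj P Q -> crossing P Q c d d' c' ->
  exists A B, [/\ swapped P Q c d d' c' A B, disj A B,
    src A = src P, src B = src Q & tgt A = tgt Q /\ tgt B = tgt P].
Proof.
move=> dPQ [[cP c'P dQ d'Q] a a' lc ld].
have [x xP xQ|A [eA sA tA]] := splice cP dQ a; first by case: (disjF dPQ xP xQ).
have [x xQ xP|B [eB sB tB]] := splice d'Q c'P a'; first by case: (disjF dPQ xP xQ).
exists A, B; split=> //; apply/pred0P=> z /=; apply/negP; rewrite eA eB !mem_cat.
case/andP=> /orP[z1|z1] /orP[z2|z2].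
- exact: disjF dPQ (mem_take z1) (mem_take z2).
- have zP := mem_take z1; move: z1 z2; rewrite mem_take_ix // mem_drop_ix //; lia.
- have zP := mem_take z2; move: z1 z2; rewrite mem_take_ix // mem_drop_ix //; lia.
- exact: disjF dPQ (mem_drop z2) (mem_drop z1).
Qed.

End Crossing.

(** * Structure of the other linkages *)

Definition linkage (D : digraph) (P Q X Y : dipath D) :=
  [/\ disj X Y, [set src X; src Y] = [set src P; src Q] &
      [set tgt X; tgt Y] = [set tgt P; tgt Q]].

Lemma linkageC D (P Q X Y : dipath D) : linkage P Q X Y -> linkage Q P X Y.
Proof. by case=> d s t; split=> //; rewrite ?s ?t setUC. Qed.

Lemma linkageCr D (P Q X Y : dipath D) : linkage P Q X Y -> linkage P Q Y X.
Proof. by case=> d s t; split; rewrite -?s -?t 1?setUC // disjC. Qed.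

Section Linkage.
Variable D : digraph.
Implicit Types (P Q R A B X Y : dipath D) (a b x y z v w c d : D) (U : pred D).
Local Notation arc := (@arc D).

Definition used X Y a b := follows (verts X) a b || follows (verts Y) a b.
Definition inL X Y z := (z \in verts X) || (z \in verts Y).

(* The set [U] is left only along [c -> d] (on [X]) and [d' -> c'] (on [Y]),
   and it is never entered. *)
Definition separates U X Y c d d' c' :=
  [/\ follows (verts X) c d, follows (verts Y) d' c',
      forall z, z \in verts X -> U z = (ix X z <= ix X c) &
      forall z, z \in verts Y -> U z = (ix Y z <= ix Y d')].

Lemma usedC X Y a b : used X Y a b = used Y X a b.
Proof. by rewrite /used orbC. Qed.
Lemma separates_noentry U X Y c d d' c' a b :
  separates U X Y c d d' c' -> used X Y a b -> ~~ U a -> U b -> False.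
Proof.
case=> _ _ hX hY /orP[] f; have [am bm] := follows_mem f.
  by rewrite !hX // /ix (follows_index f); lia.
by rewrite !hY // /ix (follows_index f); lia.
Qed.

(** Re-entering [U] would force a second exit at [a], which the path visits only once. *)
Lemma exit_separates X U a : U (src X) -> ~~ U (tgt X) ->
  (forall a' b', follows (verts X) a' b' -> U a' -> ~~ U b' -> a' = a) ->
  forall z, z \in verts X -> U z = (ix X z <= ix X a).
Proof.
move=> Us Ut H z zX; apply/idP/idP=> [Uz|le].
  have [u [v [f Uu le _ hz]]] := last_switch (verts_uniq X) zX (tgt_mem X) (ix_le_tgt zX) Uz Ut.
  by rewrite -(H u v f Uu) //; apply: hz; rewrite ?leqnn; case: (follows_mem f) => // ? /ix_le_tgt.
apply/negPn/negP=> Nz.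
have [|u [v [f Uu _ le' hz]]] := last_switch (verts_uniq X) (src_mem X) zX _ Us Nz.
  by rewrite -/(ix _ _) ix_src.
have e : u = a by apply: (H _ _ f Uu); apply: hz; rewrite ?leqnn //; case: (follows_mem f).
by move: le; rewrite -e leqNgt /ix -(follows_index f) le'.
Qed.

Lemma exit_exists X U : U (src X) -> ~~ U (tgt X) ->
  exists a b, [/\ follows (verts X) a b, U a & ~~ U b].
Proof.
move=> Us Ut.
have [|u [v [f Uu _ le' hz]]] := last_switch (verts_uniq X) (src_mem X) (tgt_mem X) _ Us Ut.
  exact: ix_le_tgt (src_mem X).
by exists u, v; split=> //; apply: hz; rewrite ?leqnn //; case: (follows_mem f).
Qed.

(** Both paths start in [U] and end outside it. There are only two exits, and disjoint paths cannot
    share one, so each path uses exactly one of them, and only once. *)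
Lemma two_exits U X Y c d d' c' : disj X Y -> c != d' ->
  U (src X) -> U (src Y) -> ~~ U (tgt X) -> ~~ U (tgt Y) ->
  (forall a b, used X Y a b -> U a -> ~~ U b -> (a = c /\ b = d) \/ (a = d' /\ b = c')) ->
  separates U X Y c d d' c' \/ separates U Y X c d d' c'.
Proof.
move=> dXY cd' sX sY tX tY H.
have [a [b [fX Ua Ub]]] := exit_exists sX tX.
have [a2 [b2 [fY Ua2 Ub2]]] := exit_exists sY tY.
have [mX _] := follows_mem fX; have [mY _] := follows_mem fY.
have uX : used X Y a b by rewrite /used fX.
have uY : used X Y a2 b2 by rewrite /used fY orbT.
have [[ea eb]|[ea eb]] := H _ _ uX Ua Ub; have [[ea2 eb2]|[ea2 eb2]] := H _ _ uY Ua2 Ub2; subst.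
- by case: (disjF dXY mX mY).
- left; split=> //; apply: exit_separates => // a' b' f Ua' Ub'.
    have [|[]//|[e _]] := H a' b' _ Ua' Ub'; first by rewrite /used f.
    by case: (disjF dXY (x := a')); rewrite // ?e // -e; case: (follows_mem f).
  have [|[e _]|[]//] := H a' b' _ Ua' Ub'; first by rewrite /used f orbT.
  by case: (disjF dXY (x := a')); rewrite // ?e // -e; case: (follows_mem f).
- right; split=> //; apply: exit_separates => // a' b' f Ua' Ub'.
    have [|[]//|[e _]] := H a' b' _ Ua' Ub'; first by rewrite /used f orbT.
    by case: (disjF dXY (x := a')); rewrite // ?e // -e; case: (follows_mem f).
  have [|[e _]|[]//] := H a' b' _ Ua' Ub'; first by rewrite /used f.
  by case: (disjF dXY (x := a')); rewrite // ?e // -e; case: (follows_mem f).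
- by case: (disjF dXY mX mY).
Qed.

Section Structure.
Variables P Q X Y : dipath D.
Hypotheses (tPQ : tight P Q) (rg : rigid P Q) (lk : linkage P Q X Y).

Let dPQ : disj P Q. Proof. by case: tPQ. Qed.
Let slPQ : shuntless P Q. Proof. by case: tPQ. Qed.
Let dQP : disj Q P. Proof. by rewrite disjC. Qed.
Let slQP : shuntless Q P. Proof. exact: shuntlessC. Qed.
Let dXY : disj X Y. Proof. by case: lk. Qed.

Lemma used_mem a b : used X Y a b -> inL X Y a /\ inL X Y b.
Proof. by case/orP=> /follows_mem[h1 h2]; rewrite /inL h1 h2 ?orbT. Qed.

Lemma used_arc a b : used X Y a b -> arc a b.
Proof. by case/orP=> /follows_arc. Qed.

Lemma used_injr a b b' : used X Y a b -> used X Y a b' -> b = b'.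
Proof.
case/orP=> f; case/orP=> f'; do 1?[exact: follows_injr f f'];
  have [m _] := follows_mem f; have [m' _] := follows_mem f'.
  by case: (disjF dXY m m').
by case: (disjF dXY m' m).
Qed.

Lemma used_injl a a' b : used X Y a b -> used X Y a' b -> a = a'.
Proof.
case/orP=> f; case/orP=> f'; do 1?[exact: follows_injl f f'];
  have [_ m] := follows_mem f; have [_ m'] := follows_mem f'.
  by case: (disjF dXY m m').
by case: (disjF dXY m' m).
Qed.

Lemma srcP : ((src P = src X) \/ (src P = src Y)) /\ ((src Q = src X) \/ (src Q = src Y)).
Proof.
case: lk => _ /setP e _; have := e (src P); have := e (src Q).
by rewrite !inE !eqxx orbT => /orP[] /eqP ? /orP[] /eqP ?; split; auto.
Qed.

Lemma tgtP : ((tgt P = tgt X) \/ (tgt P = tgt Y)) /\ ((tgt Q = tgt X) \/ (tgt Q = tgt Y)).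
Proof.
case: lk => _ _ /setP e; have := e (tgt P); have := e (tgt Q).
by rewrite !inE !eqxx orbT => /orP[] /eqP ? /orP[] /eqP ?; split; auto.
Qed.

Lemma all_src (V : D -> Prop) : V (src P) -> V (src Q) -> V (src X) /\ V (src Y).
Proof.
move=> h1 h2; case: lk => _ /setP e _; have := e (src X); have := e (src Y).
by rewrite !inE !eqxx orbT /= => /esym/orP[] /eqP -> /esym/orP[] /eqP ->.
Qed.

Lemma all_tgt (V : D -> Prop) : V (tgt P) -> V (tgt Q) -> V (tgt X) /\ V (tgt Y).
Proof.
move=> h1 h2; case: lk => _ _ /setP e; have := e (tgt X); have := e (tgt Y).
by rewrite !inE !eqxx orbT /= => /esym/orP[] /eqP -> /esym/orP[] /eqP ->.
Qed.

Lemma used_src a b : used X Y a b -> b != src P /\ b != src Q.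
Proof.
have N S : (S = src X) \/ (S = src Y) -> used X Y a b -> b != S.
  case=> -> /orP[] f; have [_ m] := follows_mem f.
  - exact: follows_neq_src f.
  - by apply/eqP=> e; rewrite e in m; exact: disjF dXY (src_mem X) m.
  - by apply/eqP=> e; rewrite e in m; exact: disjF dXY m (src_mem Y).
  - exact: follows_neq_src f.
by have [hP hQ] := srcP; move=> u; split; exact: N.
Qed.

Lemma used_tgt a b : used X Y a b -> a != tgt P /\ a != tgt Q.
Proof.
have N S : (S = tgt X) \/ (S = tgt Y) -> used X Y a b -> a != S.
  case=> -> /orP[] f; have [m _] := follows_mem f.
  - exact: follows_neq_tgt f.
  - by apply/eqP=> e; rewrite e in m; exact: disjF dXY (tgt_mem X) m.
  - by apply/eqP=> e; rewrite e in m; exact: disjF dXY m (tgt_mem Y).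
  - exact: follows_neq_tgt f.
by have [hP hQ] := tgtP; move=> u; split; exact: N.
Qed.

Lemma src_inL : inL X Y (src P).
Proof. by case: srcP => [[] -> _]; rewrite /inL src_mem ?orbT. Qed.
Lemma tgt_inL : inL X Y (tgt P).
Proof. by case: tgtP => [[] -> _]; rewrite /inL tgt_mem ?orbT. Qed.

Lemma inL_connect z : inL X Y z ->
  (exists2 x, (x \in verts P) || (x \in verts Q) & connect arc x z) /\
  (exists2 x, (x \in verts P) || (x \in verts Q) & connect arc z x).
Proof.
have [sX sY] := @all_src (fun x => (x \in verts P) || (x \in verts Q))
  (introT orP (or_introl (src_mem P))) (introT orP (or_intror (src_mem Q))).
have [tX tY] := @all_tgt (fun x => (x \in verts P) || (x \in verts Q))
  (introT orP (or_introl (tgt_mem P))) (introT orP (or_intror (tgt_mem Q))).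
have K A : z \in verts A -> connect arc (src A) z /\ connect arc z (tgt A).
  move=> zA; split; apply: (@connect_follow _ _ A); rewrite ?src_mem ?tgt_mem ?ix_src ?ix_le_tgt //.
    by move=> a b f _ _; exact: follows_arc f.
  by move=> a b f _ _; exact: follows_arc f.
case/orP=> /K[k1 k2]; split.
- by exists (src X).
- by exists (tgt X).
- by exists (src Y).
- by exists (tgt Y).
Qed.

Lemma inL_zone z : inL X Y z -> zone P Q z || zone Q P z.
Proof. by case/inL_connect=> h1 h2; exact: useful_zone. Qed.

Lemma cross_unavoidable c d : c \in verts P -> d \in verts Q -> arc c d || arc d c ->
  unavoidable P Q c /\ unavoidable Q P d.
Proof. by case: tPQ => _ _; apply. Qed.

(** In a unit square [c'] is the successor of [c] on [P], and [d'] the predecessor of [d] on [Q]. *)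
Lemma crossing_unique c d a b d' c' :
  crossing P Q c d a b -> crossing P Q c d d' c' -> a = d' /\ b = c'.
Proof.
move=> k k'; have [e1 e2 _] := rg k; have [e1' e2' _] := rg k'.
case: k k' => [[cP bP dQ aQ] _ _ _ _] [[_ c'P _ d'Q] _ _ _ _]; split.
  by apply: ix_inj aQ _; apply: succn_inj; rewrite -e2 e2'.
by apply: ix_inj bP _; rewrite e1 e1'.
Qed.

(** Up to and including [c] on the side of [P], strictly before [d] on the side of [Q]; so the arc
    from [c] to [d] leaves the set. *)
Definition low c d z := [|| bef P Q c z, z == c | bef Q P d z].

Lemma neq_PQ c d : c \in verts P -> d \in verts Q -> c != d.
Proof. by move=> cP dQ; apply/eqP=> e; rewrite -e in dQ; exact: disjF dPQ cP dQ. Qed.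

Lemma low_ends c d : c \in verts P -> d \in verts Q -> used X Y c d ->
  [/\ low c d (src X), low c d (src Y), ~~ low c d (tgt X) & ~~ low c d (tgt Y)].
Proof.
move=> cP dQ u; have [uc ud] := cross_unavoidable cP dQ (introT orP (or_introl (used_arc u))).
have [_ dsQ] := used_src u; have [ctP _] := used_tgt u.
have [||-> ->] := @all_src (low c d).
- by rewrite /low; have [->|n] := eqVneq (src P) c; rewrite ?orbT // bef_src.
- by rewrite /low [bef Q P _ _]bef_src ?orbT // eq_sym.
have [||h1 h2] := @all_tgt (fun z => ~~ low c d z).
- rewrite /low !negb_or bef_tgt // eq_sym ctP /=; apply/negP=> /bef_zone/andP[+ _].
  by apply: zone_disj dPQ slPQ _; rewrite zone_mem ?tgt_mem.
- rewrite /low !negb_or (bef_tgt dQP slQP ud) eq_sym (neq_PQ cP (tgt_mem Q)) /= andbT.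
  apply/negP=> /bef_zone/andP[+ _].
  by apply: zone_disj dQP slQP _; rewrite zone_mem ?tgt_mem.
by split.
Qed.

Lemma low_exit c d a b : c \in verts P -> d \in verts Q -> used X Y c d ->
  used X Y a b -> low c d a -> ~~ low c d b ->
  [\/ a = c /\ b = d,
      [/\ a \in verts P, b \in verts Q, ix P a < ix P c & ix Q d < ix Q b] |
      crossing P Q c d a b].
Proof.
move=> cP dQ u u' la; rewrite /low !negb_or => /and3P[nb1 nb2 nb3].
have [uc ud] := cross_unavoidable cP dQ (introT orP (or_introl (used_arc u))).
have ar := used_arc u'; have [aL bL] := used_mem u'.
have [ea|nac] := eqVneq a c.
  by rewrite ea in u'; constructor 1; rewrite ea (used_injr u u').
have nbd : b != d by apply: contra_neq nac => e; rewrite e in u'; exact: used_injl u' u.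
case/or3P: la; rewrite ?(negPf nac) // => la.
  have /andP[za _] := bef_zone la; have /orP[zb|zb] := inL_zone bL.
    by rewrite (bef_step la ar zb nb2) in nb1.
  have [aP bQ] := cross_arc dPQ slPQ za zb ar.
  constructor 2; split=> //; first by rewrite -(bef_ix dPQ slPQ uc).
  move: nb3; rewrite (bef_ix dQP slQP ud) // -leqNgt leq_eqVlt => /orP[/eqP e|//].
  by rewrite (ix_inj dQ e) eqxx in nbd.
have /andP[za _] := bef_zone la; have /orP[zb|zb] := inL_zone bL; last first.
  by rewrite (bef_step la ar zb nbd) in nb3.
have [aQ bP] := cross_arc dQP slQP za zb ar.
constructor 3; split=> //; first exact: used_arc u.
  move: nb1; rewrite (bef_ix dPQ slPQ uc) // -leqNgt leq_eqVlt => /orP[/eqP e|//].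
  by rewrite (ix_inj cP e) eqxx in nb2.
by rewrite -(bef_ix dQP slQP ud).
Qed.

(* Every used cross arc belongs to a used crossing: otherwise the outermost
   used arc [c -> d] nested over it would be the only way out of [low c d]. *)
Lemma partner c d : c \in verts P -> d \in verts Q -> used X Y c d ->
  exists d' c', [/\ crossing P Q c d d' c', used X Y d' c' &
    separates (low c d) X Y c d d' c' \/ separates (low c d) Y X c d d' c'].
Proof.
have [k] := ubnP (ix P c); elim: k c d => // k IH c d; rewrite ltnS => ck cP dQ u.
have [uc ud] := cross_unavoidable cP dQ (introT orP (or_introl (used_arc u))).
(* No used arc is nested over [c -> d]: by induction it has a partner, so [low a b] is never
   re-entered, whereas [c -> d] enters it. *)
have NN a b : used X Y a b ->
    [/\ a \in verts P, b \in verts Q, ix P a < ix P c & ix Q d < ix Q b] -> False.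
  move=> u' [aP bQ lac ldb].
  have [|d' [c' [k' u'' sep]]] := IH a b _ aP bQ u'; first exact: leq_trans lac ck.
  have [ua ub] := cross_unavoidable aP bQ (introT orP (or_introl (used_arc u'))).
  have nlc : ~~ low a b c.
    rewrite /low !negb_or (bef_ix dPQ slPQ ua) // -leqNgt (ltnW lac) /=; apply/andP; split.
      by apply/eqP=> e; rewrite e ltnn in lac.
    apply/negP=> /bef_zone/andP[+ _].
    by apply: zone_disj dPQ slPQ _; rewrite zone_mem.
  have ld : low a b d by rewrite /low [bef Q P _ _](bef_ix dQP slQP ub) // ldb !orbT.
  case: sep => sep; first exact: separates_noentry sep u nlc ld.
  by rewrite usedC in u; exact: separates_noentry sep u nlc ld.
have [lX lY tX tY] := low_ends cP dQ u.
(* [X] and [Y] both leave the set and cannot both do so at [c]. Nested arcs being excluded, the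
   other exit completes a crossing. *)
have [d' [c' [k' u']]] : exists d' c', crossing P Q c d d' c' /\ used X Y d' c'.
  have [a [b [fX la lb]]] := exit_exists lX tX.
  have [a2 [b2 [fY la2 lb2]]] := exit_exists lY tY.
  have uX : used X Y a b by rewrite /used fX.
  have uY : used X Y a2 b2 by rewrite /used fY orbT.
  have [[ea _]|n|k1] := low_exit cP dQ u uX la lb; last by exists a, b.
    have [[ea2 _]|n|k1] := low_exit cP dQ u uY la2 lb2; last by exists a2, b2.
      have [mX _] := follows_mem fX; have [mY _] := follows_mem fY.
      by rewrite ea in mX; rewrite ea2 in mY; case: (disjF dXY mX mY).
    by case: (NN _ _ uY n).
  by case: (NN _ _ uX n).
exists d', c'; split=> //; apply: two_exits => //.
  by case: k' => [[_ _ _ d'Q] _ _ _ _]; exact: neq_PQ.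
move=> a b uab la lb; have [[-> ->]|n|k2] := low_exit cP dQ u uab la lb.
- by left.
- by case: (NN _ _ uab n).
- by right; exact: crossing_unique k2 k'.
Qed.

(** A second cut, taken at the heads [c'] and [d] of the square. It can differ from [low] at
    vertices of the zone of [P] that are reached only through [c] but without [c']; on the linkage
    both cuts agree. *)
Definition low' c' d z := bef P Q c' z || bef Q P d z.

(** A used arc leaving the set within a zone enters [c'] or [d], whose used in-arcs are known. One
    that changes zones forms a crossing with one arc of the square and, crossings being unit
    squares, is the other arc. *)
Lemma square c d d' c' : crossing P Q c d d' c' -> used X Y c d -> used X Y d' c' ->
  separates (low' c' d) X Y c d d' c' \/ separates (low' c' d) Y X c d d' c'.
Proof.
move=> k u u'; have [ic id _] := rg k.
have := k => -[[cP c'P dQ d'Q] acd adc lc ld].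
have [uc ud] := cross_unavoidable cP dQ (introT orP (or_introl acd)).
have [uc' ud'] := cross_unavoidable c'P d'Q (introT orP (or_intror adc)).
have [_ dsQ] := used_src u; have [csP _] := used_src u'.
have [||h1 h2] := @all_src (low' c' d).
- by rewrite /low' bef_src // eq_sym.
- by rewrite /low' [bef Q P _ _]bef_src ?orbT // eq_sym.
have [||h3 h4] := @all_tgt (fun z => ~~ low' c' d z).
- rewrite /low' !negb_or bef_tgt //=; apply/negP=> /bef_zone/andP[+ _].
  by apply: zone_disj dPQ slPQ _; rewrite zone_mem ?tgt_mem.
- rewrite /low' !negb_or (bef_tgt dQP slQP ud) andbT.
  apply/negP=> /bef_zone/andP[+ _].
  by apply: zone_disj dQP slQP _; rewrite zone_mem ?tgt_mem.
apply: two_exits => //; first exact: neq_PQ.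
move=> a b uab la; rewrite /low' !negb_or => /andP[nb1 nb2].
have ar := used_arc uab; have [aL bL] := used_mem uab.
have [eb|nbd] := eqVneq b d; first by left; rewrite eb in uab *; rewrite (used_injl uab u).
have [eb|nbc] := eqVneq b c'; first by right; rewrite eb in uab *; rewrite (used_injl uab u').
case/orP: la => la; have /andP[za _] := bef_zone la; have /orP[zb|zb] := inL_zone bL.
- by rewrite (bef_step la ar zb nbc) in nb1.
- have [aP bQ] := cross_arc dPQ slPQ za zb ar; left.
  move: la nb2; rewrite (bef_ix dPQ slPQ uc') // (bef_ix dQP slQP ud) // -leqNgt => la nb2.
  have k2 : crossing P Q a b d' c' by split=> //; exact: leq_trans ld nb2.
  have [e1 e2 _] := rg k2; split; [apply: ix_inj aP _|apply: ix_inj bQ _].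
    by apply: succn_inj; rewrite -e1 ic.
  by rewrite e2 id.
- have [aQ bP] := cross_arc dQP slQP za zb ar; right.
  move: la nb1; rewrite (bef_ix dPQ slPQ uc') // (bef_ix dQP slQP ud) // -leqNgt => la nb1.
  have k2 : crossing P Q c d a b by split=> //; exact: leq_trans lc nb1.
  exact: crossing_unique k2 k.
- by rewrite (bef_step la ar zb nbd) in nb2.
Qed.

End Structure.
End Linkage.

(** * Backbones inside a zone, and squares separating two vertices *)

Section Completeness.
Variable D : digraph.
Implicit Types (P Q R A B X Y W Z : dipath D) (a b x y z v w c d : D).
Local Notation arc := (@arc D).

(** Where [X] and [Y] leave the zone of [P] and return, they do so along a unit square, and the arc
    of [P] on that square closes the gap. *)
Lemma backbone P Q X Y : tight P Q -> rigid P Q -> linkage P Q X Y ->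
  exists Z, [/\ src Z = src P, tgt Z = tgt P &
    forall z, z \in verts Z -> zone P Q z && inL X Y z].
Proof.
move=> tPQ rg lk; have [dPQ slPQ _] := tPQ; have [dXY _ _] := lk.
have dQP : disj Q P by rewrite disjC.
pose V := [pred z | zone P Q z && inL X Y z].
pose con x := connect [rel a b | arc a b && V b] (src P) x.
have Vs : V (src P) by rewrite /= zone_mem ?src_mem //= (src_inL lk).
have [] := boolP (con (tgt P)); first by exact: dipath_of_connect Vs.
(* [M] consists of the linkage vertices of the zone that are cut off from the source. An arc
   entering it at [w] comes from the zone of [Q], and the tail [c] of its partner is in [M] too,
   because [P] has an arc from [c] to [w]. *)
move=> Nt; pose M z := V z && ~~ con z.
have step a b : con a -> arc a b -> V b -> con b.
  by move=> h ar Vb; apply: connect_trans h (connect1 _); rewrite /= ar; exact: Vb.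
have entry z w : used X Y z w -> ~~ M z -> M w ->
    exists c d, [/\ crossing P Q c d z w, used X Y c d & M c].
  move=> u Mz /andP[Vw nw]; have [zL wL] := used_mem u; have ar := used_arc u.
  have nzz : ~~ zone P Q z.
    apply/negP=> zz; move: Mz; rewrite /M /V /= zz zL /= negbK => cz.
    by rewrite (step z w) in nw.
  have zz : zone Q P z by have := inL_zone tPQ lk zL; rewrite (negPf nzz).
  have zw : zone P Q w by case/andP: Vw.
  have [zQ wP] := cross_arc dQP (shuntlessC slPQ) zz zw ar.
  have [c [d [k u' _]]] := partner (tightC tPQ) (rigidC rg) (linkageC lk) zQ wP u.
  have k' := crossingC k; exists c, d; split=> //.
  have [ic _ _] := rg _ _ _ _ k'; have [[cP _ _ _] _ _ _ _] := k'.
  rewrite /M /V /= zone_mem // (used_mem u').1 /=; apply: contra nw => cc.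
  by apply: step cc _ Vw; apply: (@follows_arc _ P); rewrite /follows wP; apply/eqP.
have Ms : ~~ M (src X) /\ ~~ M (src Y).
  apply: (all_src (V := fun z => ~~ M z) lk).
    by rewrite /M /con connect0 andbF.
  by rewrite /M /V /= (contraNF (zoneF dPQ slPQ (x := src Q))) // src_mem.
(* Descent on the position of [c]: the path through [c] entered [M] at or before [c], and the
   partner of that entry has its tail in [M], strictly earlier on [P]. *)
have noM k c d z w : ix P c < k -> crossing P Q c d z w -> used X Y c d ->
    used X Y z w -> M c -> False.
  elim: k c d z w => // k IH c d z w; rewrite ltnS => ck cr u u' Mc.
  have [[cP _ dQ _] _ _ _ _] := cr.
  have [uc _] := cross_unavoidable tPQ cP dQ (introT orP (or_introl (used_arc u))).
  have K X' Y' z' w' : ~~ M (src X') -> (forall a b, follows (verts X') a b -> used X Y a b) ->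
      separates (low P Q c d) X' Y' c d z' w' -> False.
    move=> Ms' sub [f _ hX' _]; have [cX' _] := follows_mem f.
    have [||a [b [g Ma _ ib hz]]] := @last_switch _ (verts X') (fun z => ~~ M z)
        (src X') c (verts_uniq X') (src_mem X') cX' _ Ms'.
    - by rewrite -/(ix _ _) ix_src.
    - by rewrite negbK.
    have [aX' bX'] := follows_mem g.
    have Mb : M b by apply/negPn; apply: hz; rewrite ?leqnn.
    have [c2 [d2 [cr2 u2 Mc2]]] := entry a b (sub _ _ g) Ma Mb.
    apply: (IH _ _ _ _ _ cr2 u2 (sub _ _ g) Mc2).
    have [[_ bP _ _] _ _ lt _] := cr2; apply: leq_trans lt (leq_trans _ ck).
    have : low P Q c d b by rewrite hX'.
    case/or3P=> [h|/eqP-> //|/bef_zone/andP[h _]].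
      by rewrite (bef_ix dPQ slPQ uc cP bP) in h; exact: ltnW.
    by case: (zone_disj dPQ slPQ (zone_mem Q bP) h).
  have [d' [c' [_ _ [|]]]] := partner tPQ rg lk cP dQ u.
    by apply: K => [|a b f]; [case: Ms | rewrite /used f].
  by apply: K => [|a b f]; [case: Ms | rewrite /used f orbT].
have Mt : M (tgt P) by rewrite /M Nt /V /= zone_mem ?tgt_mem //= (tgt_inL lk).
have K X' : ~~ M (src X') -> (forall a b, follows (verts X') a b -> used X Y a b) ->
    tgt P \in verts X' -> False.
  move=> Ms' sub tX'.
  have [||a [b [g Ma _ ib hz]]] := @last_switch _ (verts X') (fun z => ~~ M z)
      (src X') (tgt P) (verts_uniq X') (src_mem X') tX' _ Ms'.
  - by rewrite -/(ix _ _) ix_src.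
  - by rewrite negbK.
  have [aX' bX'] := follows_mem g.
  have Mb : M b by apply/negPn; apply: hz; rewrite ?leqnn.
  have [c2 [d2 [cr2 u2 Mc2]]] := entry a b (sub _ _ g) Ma Mb.
  exact: noM (ltnSn _) cr2 u2 (sub _ _ g) Mc2.
case/orP: (tgt_inL lk) => tL; exfalso; apply: (K _ _ _ tL); try (by case: Ms);
  by move=> a b f; rewrite /used f ?orbT.
Qed.

(** The backbone is a rerouting of [P] off [Q], so it contains [z], and all its vertices are on the
    linkage. *)
Lemma unavoidable_inL P Q X Y z : tight P Q -> rigid P Q -> linkage P Q X Y ->
  unavoidable P Q z -> inL X Y z.
Proof.
move=> tPQ rg lk u; have [dPQ slPQ _] := tPQ.
have [Z [sZ tZ hZ]] := backbone tPQ rg lk.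
have [] := andP (hZ z (u Z sZ tZ _)) => //.
apply/pred0P=> v /=; apply/negP=> /andP[/hZ/andP[zv _]].
exact/negP/(zoneF dPQ slPQ).
Qed.

(** Asking for both cuts keeps [z] out of the gap between them, past [c] but before [c']. *)
Definition side P Q c d c' z s := low P Q c d z = s /\ low' P Q c' d z = s.

(** The arc [c -> d] lies on only one of the disjoint paths, so both cuts assign the arcs of the
    square to [X] and [Y] in the same way. *)
Lemma square_sides P Q X Y c d d' c' : tight P Q -> rigid P Q -> linkage P Q X Y ->
  crossing P Q c d d' c' -> used X Y c d -> used X Y d' c' ->
  let split X Y := [/\ follows (verts X) c d, follows (verts Y) d' c',
     forall z, z \in verts X -> side P Q c d c' z (ix X z <= ix X c) &
     forall z, z \in verts Y -> side P Q c d c' z (ix Y z <= ix Y d')] in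
  split X Y \/ split Y X.
Proof.
move=> tPQ rg lk k u u' /=; have [dXY _ _] := lk.
have [[cP c'P dQ d'Q] _ _ _ _] := k.
have [d2 [c2 [k2 u2 s1]]] := partner tPQ rg lk cP dQ u.
have [e1 e2] := crossing_unique rg k2 k; subst d2 c2.
have [s2|s2] := square tPQ rg lk k u u'; case: s1 => s1; last first.
- by right; case: s1 s2 => f1 f2 h1 h2 [_ _ h3 h4]; split=> // z zX; split; auto.
- case: s1 s2 => /follows_mem[m1 _] _ _ _ [/follows_mem[m2 _] _ _ _].
  by case: (disjF dXY m1 m2).
- case: s1 s2 => /follows_mem[m1 _] _ _ _ [/follows_mem[m2 _] _ _ _].
  by case: (disjF dXY m2 m1).
- by left; case: s1 s2 => f1 f2 h1 h2 [_ _ h3 h4]; split=> // z zX; split; auto.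
Qed.

Definition used_square P Q X Y c d d' c' :=
  [/\ crossing P Q c d d' c', used X Y c d & used X Y d' c'].

(** [Y] starts on [Q], so it must enter the zone of [P] to reach [y]; the square of its last entry
    has [y] on the far side. If [x] is on the far side too, [X] has left the zone and returned, and
    the square of its last entry serves instead, unless [y] is beyond that one as well. In that case
    both entries would be at the same vertex of [P]. *)
Lemma square_between_aux P Q X Y x y : tight P Q -> rigid P Q -> linkage P Q X Y ->
  src P = src X -> x \in verts X -> y \in verts Y -> zone P Q x -> zone P Q y ->
  exists c d d' c' s, [/\ used_square P Q X Y c d d' c',
    side P Q c d c' x s & side P Q c d c' y (~~ s)].
Proof.
move=> tPQ rg lk es xX yY zx zy; have [dPQ slPQ _] := tPQ; have [dXY _ _] := lk.
have dQP : disj Q P by rewrite disjC.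
have sY : src Y = src Q.
  have [_ [e|//]] := srcP lk; rewrite -es in e.
  by case: (disjF dPQ (src_mem P)); rewrite -e src_mem.
have nzQ v : v \in verts Q -> ~~ zone P Q v.
  by move=> vQ; apply/negP=> /(zoneF dPQ slPQ); rewrite vQ.
have entry Z v q : (forall a b, follows (verts Z) a b -> used X Y a b) ->
    v \in verts Q -> v \in verts Z -> q \in verts Z -> zone P Q q -> ix Z v <= ix Z q ->
    exists z w c d, [/\ follows (verts Z) z w, ix Z v <= ix Z z, ix Z w <= ix Z q,
      crossing P Q c d z w & used X Y c d] /\
      forall u, u \in verts Z -> ix Z w <= ix Z u <= ix Z q -> zone P Q u.
  move=> sub vQ vZ qZ zq le.
  have [||z [w [f nz i1 i2 hz]]] := @last_switch _ (verts Z) (fun z => ~~ zone P Q z) v q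
    (verts_uniq Z) vZ qZ le; rewrite ?negbK ?nzQ //.
  have {}hz u : u \in verts Z -> ix Z w <= ix Z u <= ix Z q -> zone P Q u.
    by move=> uZ h; have := hz u uZ h; rewrite negbK.
  have [zZ wZ] := follows_mem f; have u := sub _ _ f.
  have zw : zone P Q w by apply: hz; rewrite ?leqnn.
  have zz : zone Q P z by have := inL_zone tPQ lk (used_mem u).1; rewrite (negPf nz).
  have [zQ wP] := cross_arc dQP (shuntlessC slPQ) zz zw (used_arc u).
  have [c [d [k u' _]]] := partner (tightC tPQ) (rigidC rg) (linkageC lk) zQ wP u.
  by exists z, w, c, d; split=> //; split=> //; exact: crossingC.
have [||||||z [w [c [d [[f i1 i2 k u] hw]]]]] := entry Y (src Y) y; rewrite ?src_mem ?ix_src //.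
- by move=> a b f; rewrite /used f orbT.
- by rewrite sY src_mem.
have u' : used X Y z w by rewrite /used f orbT.
have [zY wY] := follows_mem f.
have [[f1 f2 hX hY]|[_ /follows_mem[m _] _ _]] := square_sides tPQ rg lk k u u'; last first.
  by case: (disjF dXY m zY).
have sy : side P Q c d w y false.
  have := hY y yY; suff -> : (ix Y y <= ix Y z) = false by [].
  by apply/negbTE; rewrite -ltnNge /ix -(follows_index f).
have [le|lt] := leqP (ix X x) (ix X c).
  by exists c, d, z, w, true; split=> //; have := hX x xX; rewrite le.
have [[_ wP dQ _] _ _ _ _] := k; have [cX dX] := follows_mem f1.
have dx : ix X d <= ix X x by rewrite /ix (follows_index f1).
have [|z2 [w2 [c2 [d2 [[g j1 j2 k2 u2] hw2]]]]] := entry X d x _ dQ dX xX zx dx.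
  by move=> a b h; rewrite /used h.
have u2' : used X Y z2 w2 by rewrite /used g.
have [z2X w2X] := follows_mem g.
have [[_ /follows_mem[m _] _ _]|[g1 g2 hY2 hX2]] := square_sides tPQ rg lk k2 u2 u2'.
  by case: (disjF dXY z2X m).
have sx : side P Q c2 d2 w2 x false.
  have := hX2 x xX; suff -> : (ix X x <= ix X z2) = false by [].
  by apply/negbTE; rewrite -ltnNge /ix -(follows_index g).
have [le2|lt2] := leqP (ix Y y) (ix Y c2).
  by exists c2, d2, z2, w2, false; split=> //; have := hY2 y yY; rewrite le2.
have [[c2P w2P d2Q _] _ _ _ _] := k2; have [c2Y d2Y] := follows_mem g1.
have [[cP _ _ _] acd _ _ _] := k.
(* From [w] to [y] the path [Y] stays in the zone of [P], whereas [d2] is on [Q]. *)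
have d2w : ix Y d2 < ix Y w.
  rewrite ltnNge; apply/negP=> h; case/negP: (nzQ _ d2Q); apply: hw => //.
  by rewrite h /ix (follows_index g1).
have [uc _] := cross_unavoidable tPQ cP dQ (introT orP (or_introl acd)).
have [uc2 _] := cross_unavoidable tPQ c2P d2Q (introT orP (or_introl (used_arc u2))).
(* Otherwise [w] is at or before [c2] on [P], hence in [low P Q c2 d2]; but on [Y] it comes after
   the exit from that set. *)
have i3 : ix P w2 <= ix P w.
  have [ic _ _] := rg _ _ _ _ k2; rewrite ic ltnNge; apply/negP=> h.
  have : low P Q c2 d2 w.
    rewrite /low (bef_ix dPQ slPQ uc2 c2P wP); move: h; rewrite leq_eqVlt.
    by case/orP=> [/eqP/(ix_inj wP)->|->]; rewrite ?eqxx ?orbT.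
  have [-> _] := hY2 w wY; rewrite leqNgt => /negP; apply.
  by rewrite (leq_trans _ d2w) // /ix (follows_index g1).
have i4 : ix P w <= ix P w2.
  have [ic _ _] := rg _ _ _ _ k; rewrite ic ltnNge; apply/negP=> h.
  have : low P Q c d w2.
    rewrite /low (bef_ix dPQ slPQ uc cP w2P); move: h; rewrite leq_eqVlt.
    by case/orP=> [/eqP/(ix_inj w2P)->|->]; rewrite ?eqxx ?orbT.
  have [-> _] := hX w2 w2X; rewrite leqNgt => /negP; apply.
  move: j1; rewrite /ix (follows_index g) (follows_index f1) => j1.
  by rewrite ltnS ltnW.
have e : w = w2 by apply: ix_inj wP _; apply/eqP; rewrite eqn_leq i4.
by case: (disjF dXY w2X); rewrite -e.
Qed.

Lemma square_between P Q X Y x y : tight P Q -> rigid P Q -> linkage P Q X Y ->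
  x \in verts X -> y \in verts Y -> zone P Q x -> zone P Q y ->
  exists c d d' c' s, [/\ used_square P Q X Y c d d' c',
    side P Q c d c' x s & side P Q c d c' y (~~ s)].
Proof.
move=> tPQ rg lk xX yY zx zy; have [[e|e] _] := srcP lk.
  exact: square_between_aux.
have [c [d [d' [c' [s [[k u u'] sy sx]]]]]] :=
  square_between_aux tPQ rg (linkageCr lk) e yY xX zy zx.
by exists c, d, d', c', (~~ s); rewrite negbK; split=> //; split; rewrite // usedC.
Qed.

End Completeness.

(** * Linkages of a rigid tight pair carry no shunt *)

Section NoShunt.
Variable D : digraph.
Implicit Types (P Q R A B X Y W Z : dipath D) (a b x y z v w c d : D).
Local Notation arc := (@arc D).

Lemma mem_interior R z : z \in verts R -> z != src R -> z != tgt R -> z \in interior R.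
Proof.
rewrite /interior /verts lastI mem_rcons inE -/(tgt R) => /orP[->//|].
by case: (steps R) => //= y l; rewrite inE => /predU1P[->|//]; rewrite eqxx.
Qed.

Lemma interior_ends R z : z \in interior R -> [/\ z \in verts R, z != src R & z != tgt R].
Proof.
have u := verts_uniq R; move: u; rewrite /interior /tgt /verts.
case: (steps R) => [|y l] //= /andP[h u] zi.
have e : y :: l = rcons (belast y l) (last y l) by rewrite -lastI.
have zl : z \in y :: l by rewrite e mem_rcons inE zi orbT.
split; first by rewrite inE zl orbT.
  by apply: contraNneq h => <-.
apply: contraTneq zi => ->; have: uniq (y :: l) by [].
by rewrite e rcons_uniq => /andP[].
Qed.

Lemma shunt_interior_off X Y R z : is_shunt X Y R ->
  z \in interior R -> ~~ inL X Y z.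
Proof.
move=> [_ _ _ _ dX dY] zi; rewrite /inL negb_or.
by rewrite (disjointFl dX zi) (disjointFl dY zi).
Qed.

(** With length at least 2, every arc of [R] has an interior vertex as an end, and interior vertices
    are off [X] and [Y]. *)
Lemma shunt_arc_off P Q X Y R a b : linkage P Q X Y -> is_shunt X Y R ->
  follows (verts R) a b -> inL X Y a -> inL X Y b -> False.
Proof.
move=> lk sh f aL bL; have [aR bR] := follows_mem f.
have len := shunt_length sh.
have [ea|na] := eqVneq a (src R); last first.
  have ai := mem_interior aR na (follows_neq_tgt f).
  by have := shunt_interior_off sh ai; rewrite aL.
have [eb|nb] := eqVneq b (tgt R); last first.
  have bi := mem_interior bR (follows_neq_src f) nb.
  by have := shunt_interior_off sh bi; rewrite bL.
move: (follows_index f) len; rewrite ea eb -!/(ix _ _) ix_src ix_tgt /dilength.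
by move=> ->.
Qed.

Lemma shunt_zone P Q X Y R z : disj P Q -> shuntless P Q -> linkage P Q X Y ->
  is_shunt X Y R -> z \in verts R -> zone P Q z || zone Q P z.
Proof.
move=> dPQ slPQ lk sh zR.
have xL : inL X Y (src R) by rewrite /inL (shunt_src sh).
have yL : inL X Y (tgt R) by rewrite /inL (shunt_tgt sh) orbT.
have [[x xF cx] _] := inL_connect lk xL; have [_ [y yF cy]] := inL_connect lk yL.
apply: useful_zone => //; [exists x => //|exists y => //].
  apply: connect_trans cx _; apply: (@connect_follow _ _ R); rewrite ?src_mem ?ix_src //.
  by move=> a b f _ _; exact: follows_arc f.
apply: connect_trans _ cy; apply: (@connect_follow _ _ R); rewrite ?tgt_mem ?ix_le_tgt //.
by move=> a b f _ _; exact: follows_arc f.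
Qed.

(** Along a walk missing [B], a vertex of [A] starts afresh and every other vertex is off both
    paths. *)
Lemma from_along A B W u v : u \in verts W -> v \in verts W -> ix W u <= ix W v ->
  from A B u -> (forall z, z \in verts W -> ix W u <= ix W z <= ix W v -> z \notin verts B) ->
  from A B v.
Proof.
move=> uW vW le fu nB; have [//|nf] := boolP (from A B v); exfalso.
have [a [b [f fa i1 i2 hz]]] := last_switch (U := from A B) (verts_uniq W) uW vW le fu nf.
have [aW bW] := follows_mem f.
have nb : ~~ from A B b by apply: hz; rewrite ?leqnn.
have [bA|nbA] := boolP (b \in verts A); first by rewrite from_mem in nb.
have o : off A B b.
  by rewrite /off nbA /=; apply: nB; rewrite // i2 andbT /ix (follows_index f) ltnW.
by rewrite (from_step fa (follows_arc f) o) in nb.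
Qed.

Lemma to_along A B W u v : u \in verts W -> v \in verts W -> ix W u <= ix W v ->
  to A B v -> (forall z, z \in verts W -> ix W u <= ix W z <= ix W v -> z \notin verts B) ->
  to A B u.
Proof.
move=> uW vW le tv nB; have [//|nt] := boolP (to A B u); exfalso.
have [|a [b [f ta i1 i2 hz]]] := last_switch (U := fun z => ~~ to A B z) (verts_uniq W) uW vW le nt.
  by rewrite negbK.
have [aW bW] := follows_mem f.
have tb : to A B b by have := hz b bW; rewrite negbK; apply; rewrite leqnn.
have [aA|naA] := boolP (a \in verts A); first by rewrite to_mem in ta.
have o : off A B a.
  rewrite /off naA /=; apply: nB; rewrite // i1 /=; apply: leq_trans _ i2.
  by rewrite /ix (follows_index f).
by rewrite (to_step tb (follows_arc f) o) in ta.
Qed.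

Lemma swapped_ends P Q c d d' c' A B : crossing P Q c d d' c' ->
  swapped P Q c d d' c' A B ->
  [/\ src A = src P, tgt A = tgt Q, src B = src Q & tgt B = tgt P].
Proof.
case=> [[cP c'P dQ d'Q] _ _ _ _] [eA eB].
have K S T' k z V : z \in verts T' -> verts V = take k.+1 (verts S) ++ drop (ix T' z) (verts T') ->
    src V = src S /\ tgt V = tgt T'.
  move=> zT e; have sz : ix T' z < size (verts T') by rewrite /ix index_mem.
  split; first exact: verts_inj_src e.
  have := last_cat (src T') (take (ix T' z) (verts T')) (drop (ix T' z) (verts T')).
  rewrite cat_take_drop -[last _ (verts T')]/(tgt T') => ->.
  rewrite -[tgt V]/(last (src T') (verts V)) e last_cat (drop_nth (src T') sz) //.
by have [-> ->] := K _ _ _ _ _ dQ eA; have [-> ->] := K _ _ _ _ _ c'P eB.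
Qed.

Lemma swapped_linkage P Q c d d' c' A B X Y : crossing P Q c d d' c' ->
  swapped P Q c d d' c' A B -> linkage P Q X Y -> linkage A B X Y.
Proof.
move=> k sw [dXY es et]; have [sA tA sB tB] := swapped_ends k sw.
by split; rewrite // ?sA ?tA ?sB ?tB // et setUC.
Qed.

(** * A shunt inside one zone joining the two sides of a used square *)

Section Separated.
Variables (P Q X Y R A B : dipath D) (c d d' c' : D).
Hypotheses (tPQ : tight P Q) (rg : rigid P Q) (lk : linkage P Q X Y).
Hypotheses (sh : is_shunt X Y R) (zR : forall z, z \in verts R -> zone P Q z).
Hypotheses (sq : used_square P Q X Y c d d' c').
Hypotheses (sw : swapped P Q c d d' c' A B) (tAB : tight A B).

Let dPQ : disj P Q. Proof. by case: tPQ. Qed.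
Let slPQ : shuntless P Q. Proof. by case: tPQ. Qed.
Let k : crossing P Q c d d' c'. Proof. by case: sq. Qed.
Let cP : c \in verts P. Proof. by case: k => -[]. Qed.
Let c'P : c' \in verts P. Proof. by case: k => -[]. Qed.
Let dQ : d \in verts Q. Proof. by case: k => -[]. Qed.
Let d'Q : d' \in verts Q. Proof. by case: k => -[]. Qed.
Let uc : unavoidable P Q c.
Proof.
case: k => _ acd _ _ _.
by case: (cross_unavoidable tPQ cP dQ (introT orP (or_introl acd))).
Qed.
Let uc' : unavoidable P Q c'.
Proof.
case: k => _ _ adc _ _.
by case: (cross_unavoidable tPQ c'P d'Q (introT orP (or_intror adc))).
Qed.
Let ic : ix P c' = (ix P c).+1. Proof. by case: (rg k). Qed.
Let id' : ix Q d = (ix Q d').+1. Proof. by case: (rg k). Qed.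
Let cL : inL X Y c. Proof. by case: sq => _ /used_mem[]. Qed.
Let c'L : inL X Y c'. Proof. by case: sq => _ _ /used_mem[]. Qed.
Let zoneNQ z : zone P Q z -> z \notin verts Q. Proof. exact: zoneF. Qed.

Let low_zone z : zone P Q z -> low P Q c d z = bef P Q c z || (z == c).
Proof.
move=> zz; rewrite /low orbA orbC; case: (boolP (bef Q P d z)) => // /bef_zone/andP[h _].
by case: (zone_disj dPQ slPQ zz h).
Qed.
Let low'_zone z : zone P Q z -> low' P Q c' d z = bef P Q c' z.
Proof.
move=> zz; rewrite /low' orbC; case: (boolP (bef Q P d z)) => // /bef_zone/andP[h _].
by case: (zone_disj dPQ slPQ zz h).
Qed.

Lemma memA z : z \in verts A -> zone P Q z -> z \in verts P /\ ix P z <= ix P c.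
Proof.
case: sw => -> _; rewrite mem_cat => /orP[h _|/mem_drop_verts h /zoneNQ]; last by rewrite h.
by have zP := mem_take_verts h; move: h; rewrite mem_take_ix.
Qed.

Lemma memB z : z \in verts B -> zone P Q z -> z \in verts P /\ ix P c' <= ix P z.
Proof.
case: sw => _ ->; rewrite mem_cat => /orP[/mem_take_verts h /zoneNQ|h _]; first by rewrite h.
by have zP := mem_drop_verts h; move: h; rewrite mem_drop_ix.
Qed.

Lemma memA_bef z : z \in verts A -> zone P Q z -> bef P Q c' z.
Proof. by move=> zA /(memA zA)[zP h]; rewrite (bef_ix dPQ slPQ) // ic. Qed.

Lemma memB_nbef z : z \in verts B -> zone P Q z -> ~~ (bef P Q c z || (z == c)).
Proof.
move=> zB /(memB zB)[zP]; rewrite ic => h; rewrite (bef_ix dPQ slPQ) // negb_or.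
rewrite -leqNgt (ltnW h) /=; apply: contraTneq h => ->; by rewrite ltnn.
Qed.

(* [R] cannot run forward: it would bypass the arc from [c] to [c']. *)
Lemma no_forward : side P Q c d c' (src R) true -> side P Q c d c' (tgt R) false -> False.
Proof.
have xR := src_mem R; have yR := tgt_mem R.
case; rewrite low_zone ?low'_zone ?zR // => lx lx'.
case; rewrite low_zone ?low'_zone ?zR // => /negbT ly /negbT ly'.
have srcRle z : ix R (src R) <= ix R z by rewrite ix_src.
have noI z : z \in verts R -> inL X Y z -> z = src R \/ z = tgt R.
  move=> zzR zL; have [->|n1] := eqVneq z (src R); first by left.
  have [->|n2] := eqVneq z (tgt R); first by right.
  by have := shunt_interior_off sh (mem_interior zzR n1 n2); rewrite zL.
(* The part of the zone up to [c] can be left only at [c]. This vertex is on the linkage, which [R]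
   meets only at its ends. *)
have ex : c = src R.
  have [a [b [f la _ _ hz]]] :=
    last_switch (U := fun z => bef P Q c z || (z == c)) (verts_uniq R) xR yR (srcRle _) lx ly.
  have [aR bR] := follows_mem f.
  have ea : a = c.
    case/orP: la => [ba|/eqP//].
    have : ~~ (bef P Q c b || (b == c)) by apply: hz; rewrite ?leqnn //; exact: ix_le_tgt.
    rewrite negb_or => /andP[nb1 nb2].
    by rewrite (bef_step ba (follows_arc f) (zR bR) nb2) in nb1.
  have [//|e] : c = src R \/ c = tgt R by apply: noI; rewrite -?ea // ea.
  by rewrite -e eqxx orbT in ly.
have step' z w a b : z \in verts R -> follows (verts R) a b -> bef P Q c' a -> ~~ bef P Q c' b -> b = c'.
  move=> _ f ba; have [_ bR] := follows_mem f; apply: contraNeq => n.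
  exact: bef_step ba (follows_arc f) (zR bR) n.
have ey : c' = tgt R.
  have [a [b [f la _ ib hz]]] := last_switch (verts_uniq R) xR yR (srcRle _) lx' ly'.
  have [aR bR] := follows_mem f.
  have eb : b = c' by apply: (step' _ c' _ _ xR f la); apply: hz; rewrite ?leqnn.
  have [e|//] : c' = src R \/ c' = tgt R by apply: noI; rewrite -?eb // eb.
  by move: lx'; rewrite -e => /bef_zone; rewrite eqxx andbF.
(* From a vertex of [P] before [c], [R] could move on only by entering [c], its own source; a vertex
   of [P] past [c] could be reached only through [c'], its own target. *)
have offP z : z \in interior R -> z \notin verts P.
  move=> zi; have [zzR nx ny] := interior_ends zi; apply/negP=> zP.
  have [lt|gt|e] := ltngtP (ix P z) (ix P c).
  - have bz : bef P Q c z by rewrite (bef_ix dPQ slPQ).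
    have nby : ~~ bef P Q c (tgt R) by apply: contra ly => ->.
    have [a [b [f la i1 _ hz]]] := last_switch (verts_uniq R) zzR yR (ix_le_tgt zzR) bz nby.
    have [aR bR] := follows_mem f.
    have : ~~ bef P Q c b by apply: hz; rewrite ?leqnn //; exact: ix_le_tgt.
    move/negP; apply; apply: bef_step la (follows_arc f) (zR bR) _.
    by rewrite ex; exact: follows_neq_src f.
  - have nz : ~~ bef P Q c' z by rewrite (bef_ix dPQ slPQ) // ic -leqNgt.
    have [a [b [f la _ i2 hz]]] := last_switch (verts_uniq R) xR zzR (srcRle _) lx' nz.
    have [aR bR] := follows_mem f.
    have eb : b = tgt R.
      by rewrite -ey; apply: (step' _ c' _ _ xR f la); apply: hz; rewrite ?leqnn.
    rewrite eb in i2; case/eqP: ny; apply: (ix_inj zzR); apply/eqP.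
    by rewrite eqn_leq ix_le_tgt //=; exact: i2.
  - by case/eqP: nx; rewrite -ex; exact: ix_inj zP e.
have [dAB slAB _] := tAB; case: (slAB R) => h _; apply: h; split=> //.
- exact: shunt_length sh.
- by rewrite -ex; case: sw => -> _; rewrite mem_cat mem_take_ix // leqnn.
- by rewrite -ey; case: sw => _ ->; rewrite mem_cat mem_drop_ix // leqnn orbT.
- apply/pred0P=> z /=; apply/negP=> /andP[zA zi]; have [zzR _ _] := interior_ends zi.
  by have [zP _] := memA zA (zR zzR); rewrite (negPf (offP z zi)) in zP.
- apply/pred0P=> z /=; apply/negP=> /andP[zB zi]; have [zzR _ _] := interior_ends zi.
  by have [zP _] := memB zB (zR zzR); rewrite (negPf (offP z zi)) in zP.
Qed.

(* Backwards, [R] leads from [B] to [A], hence along an arc from [B] to [A]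
   whose ends are unavoidable for [A] and [B] and thus lie on [X] or [Y]. *)
Lemma no_backward : side P Q c d c' (src R) false -> side P Q c d c' (tgt R) true -> False.
Proof.
have xR := src_mem R; have yR := tgt_mem R.
case; rewrite low_zone ?low'_zone ?zR // => /negbT lx /negbT lx'.
case; rewrite low_zone ?low'_zone ?zR // => ly ly'.
have [dAB slAB uAB] := tAB; have lkA := swapped_linkage k sw lk.
have dBA : disj B A by rewrite disjC.
have slBA := shuntlessC slAB.
have [sA tA sB tB] := swapped_ends k sw.
have cA : c \in verts A by case: sw => -> _; rewrite mem_cat mem_take_ix // leqnn.
have c'B : c' \in verts B by case: sw => _ ->; rewrite mem_cat mem_drop_ix // leqnn orbT.
have cc' : src P != c' by apply/eqP=> e; have := ic; rewrite -e ix_src.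
have zs : zone P Q (src P) by rewrite zone_mem ?src_mem.
(* A walk in the zone from the source of [P] to [src R] leaves [bef P Q c'] for the last time by
   entering [c'], a vertex of [B]; after that it meets no vertex of [A]. *)
have fx : from B A (src R).
  have [W [sW tW zW]] := dipath_of_connect (V := zone P Q) zs (zone_connect_src (zR xR)).
  have xW : src R \in verts W by rewrite -tW tgt_mem.
  have bs := bef_src Q cc'; rewrite -sW in bs.
  have [|a [b [f la _ i2 hz]]] := last_switch (verts_uniq W) (src_mem W) xW _ bs lx'.
    by rewrite -/(ix _ _) ix_src.
  have [aW bW] := follows_mem f.
  have nb : ~~ bef P Q c' b by apply: hz; rewrite ?leqnn.
  have eb : b = c'.
    by apply: contraNeq nb => n; exact: bef_step la (follows_arc f) (zW _ bW) n.
  apply: (from_along bW xW i2); first by rewrite eb from_mem.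
  move=> z zzW h; have nz := hz z zzW h; apply: contra nz => zA.
  exact: memA_bef zA (zW _ zzW).
(* Unless it is [c] itself, [tgt R] starts a walk whose first exit from [bef P Q c] enters [c], a
   vertex of [A]; up to there it meets no vertex of [B]. *)
have ty : to A B (tgt R).
  case/orP: (ly) => [b1|/eqP->]; last by rewrite to_mem.
  have [W [sW tW zW]] := dipath_of_connect (V := zone P Q) (zR yR) (zone_connect_tgt (zR yR)).
  have yW : tgt R \in verts W by rewrite -sW src_mem.
  have nt : ~~ bef P Q c (tgt W) by rewrite tW; exact: bef_tgt.
  have [a [b [f nb i1 i2 hz]]] := first_switch (verts_uniq W) yW (tgt_mem W) (ix_le_tgt yW) b1 nt.
  have [aW bW] := follows_mem f.
  have ba : bef P Q c a by apply: hz; rewrite // i1 leqnn.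
  have eb : b = c.
    by apply: contraNeq nb => n; exact: bef_step ba (follows_arc f) (zW _ bW) n.
  have le : ix W (tgt R) <= ix W b by rewrite /ix (follows_index f); exact: leqW.
  apply: (to_along yW bW le); first by rewrite eb to_mem.
  move=> z zzW /andP[h1 h2]; have zz := zW _ zzW; apply/negP=> zB.
  have := memB_nbef zB zz; rewrite negb_or => /andP[+ /eqP nzc].
  move/negP; apply; apply: hz => //; rewrite h1 /=.
  move: h2; rewrite leq_eqVlt => /orP[/eqP /(ix_inj zzW)|]; first by rewrite eb.
  by rewrite /ix (follows_index f) ltnS.
have zRA z : z \in verts R -> zone A B z || zone B A z by exact: shunt_zone sh.
have zx : zone B A (src R).
  case/orP: (zRA _ xR) => // /andP[_ t]; case: (no_bridge dBA slBA fx t).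
have zy : ~~ zone B A (tgt R).
  by apply/negP=> /andP[f _]; exact: no_bridge dBA slBA f ty.
have [|a [b [f za _ _ hz]]] := last_switch (verts_uniq R) xR yR _ zx zy.
  by rewrite -/(ix _ _) ix_src.
have [aR bR] := follows_mem f.
have zb : zone A B b.
  have : ~~ zone B A b by apply: hz; rewrite ?leqnn //; exact: ix_le_tgt.
  by case/orP: (zRA _ bR) => // ->.
have [aB bA] := cross_arc dBA slBA za zb (follows_arc f).
have [ub ua] := uAB b a bA aB (introT orP (or_intror (follows_arc f))).
have [Z [sZ tZ hZ]] := backbone tPQ rg lk.
have zZ z : z \in verts Z -> zone P Q z by case/hZ/andP.
have dZQ : disj Z Q.
  by apply/pred0P=> v /=; apply/negP=> /andP[/zZ/zoneNQ/negP].
have cZ : c \in verts Z := uc sZ tZ dZQ.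
have c'Z : c' \in verts Z := uc' sZ tZ dZQ.
have [_ acd adc _ lt] := k.
apply: (shunt_arc_off lk sh f).
(* [Q] up to [d'] followed by the backbone from [c'] is a rerouting of [B] off [A], so it contains
   [a]; being in the zone of [P], [a] lies on the backbone. For [b], take the backbone up to [c]
   followed by [Q] from [d]. *)
- suff /hZ/andP[] : a \in verts Z by [].
  have [z zQ zzZ|B' [eB' sB' tB']] := splice d'Q c'Z adc.
    by case: (disjF dZQ zzZ zQ).
  have : a \in verts B'.
    apply: ua; rewrite ?sB' ?tB' ?tZ //; apply/pred0P=> z /=; apply/negP.
    rewrite eB' mem_cat => /andP[/orP[h|h] zA].
      have zQ := mem_take_verts h; move: h zA; rewrite mem_take_ix //; case: sw => -> _ h.
      rewrite mem_cat => /orP[/mem_take_verts zP|]; first exact: disjF dPQ zP zQ.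
      by rewrite mem_drop_ix // leqNgt id' h.
    have zzZ := mem_drop_verts h; move: h; rewrite mem_drop_ix // => h.
    have bz := memA_bef zA (zZ _ zzZ).
    have nt := bef_tgt dPQ slPQ uc'; rewrite -tZ in nt.
    have [a2 [b2 [g la i1 _ hz2]]] := last_switch (verts_uniq Z) zzZ (tgt_mem Z) (ix_le_tgt zzZ) bz nt.
    have [a2Z b2Z] := follows_mem g.
    have nb : ~~ bef P Q c' b2 by apply: hz2; rewrite ?leqnn //; exact: ix_le_tgt.
    have eb : b2 = c'.
      by apply: contraNeq nb => n; exact: bef_step la (follows_arc g) (zZ _ b2Z) n.
    have := leq_trans h i1; rewrite -eb /ix (follows_index g); by rewrite ltnn.
  rewrite eB' mem_cat => /orP[/mem_take_verts h|/mem_drop_verts //].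
  by have := zoneNQ (zR aR); rewrite h.
- suff /hZ/andP[] : b \in verts Z by [].
  have [z zzZ zQ|A' [eA' sA' tA']] := splice cZ dQ acd.
    by case: (disjF dZQ zzZ zQ).
  have : b \in verts A'.
    apply: ub; rewrite ?sA' ?tA' ?sZ //; apply/pred0P=> z /=; apply/negP.
    rewrite eA' mem_cat => /andP[/orP[h|h] zB]; last first.
      have zQ := mem_drop_verts h; move: h zB; rewrite mem_drop_ix //; case: sw => _ -> h.
      rewrite mem_cat => /orP[|/mem_drop_verts zP]; last exact: disjF dPQ zP zQ.
      by rewrite mem_take_ix // ltnS leqNgt -ltnS -id' ltnS h.
    have zzZ := mem_take_verts h; move: h; rewrite mem_take_ix // ltnS leq_eqVlt.
    case/orP=> [/eqP/(ix_inj zzZ) e|h].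
      by have := memB_nbef zB (zZ _ zzZ); rewrite e eqxx orbT.
    have nbz : ~~ bef P Q c z.
      by have := memB_nbef zB (zZ _ zzZ); apply: contra => ->.
    have bs : bef P Q c (src Z).
      by rewrite sZ bef_src //; apply: contraTneq h => <-; rewrite -sZ ix_src.
    have [|a2 [b2 [g la _ i2 hz2]]] := last_switch (verts_uniq Z) (src_mem Z) zzZ _ bs nbz.
      by rewrite -/(ix _ _) ix_src.
    have [a2Z b2Z] := follows_mem g.
    have nb : ~~ bef P Q c b2 by apply: hz2; rewrite ?leqnn.
    have eb : b2 = c.
      by apply: contraNeq nb => n; exact: bef_step la (follows_arc g) (zZ _ b2Z) n.
    by rewrite eb in i2; have := leq_trans h i2; rewrite ltnn.
  rewrite eA' mem_cat => /orP[/mem_take_verts //|/mem_drop_verts h].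
  by have := zoneNQ (zR bR); rewrite h.
Qed.

End Separated.

(** An arc on which [R] leaves the zone would have unavoidable ends, which lie on the linkage. So
    [R] stays inside, and some used square separates its ends. *)
Lemma no_shunt_zone P Q X Y R : tight P Q -> rigid P Q -> linkage P Q X Y ->
  is_shunt X Y R -> zone P Q (src R) -> False.
Proof.
move=> tPQ rg lk sh zs; have [dPQ slPQ _] := tPQ.
have [dQP slQP] : disj Q P /\ shuntless Q P by split; [rewrite disjC | exact: shuntlessC].
have zR z : z \in verts R -> zone P Q z.
  move=> zR; apply/negPn/negP=> nz.
  have [|a [b [f za _ i2 hz]]] := last_switch (verts_uniq R) (src_mem R) zR _ zs nz.
    by rewrite -/(ix _ _) ix_src.
  have [aR bR] := follows_mem f.
  have nb : ~~ zone P Q b by apply: hz; rewrite ?leqnn.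
  have zb : zone Q P b.
    by have := shunt_zone dPQ slPQ lk sh bR; rewrite (negPf nb).
  have ar := follows_arc f; have [aP bQ] := cross_arc dPQ slPQ za zb ar.
  have [ua ub] := cross_unavoidable tPQ aP bQ (introT orP (or_introl ar)).
  apply: (shunt_arc_off lk sh f); first exact: unavoidable_inL ua.
  exact: unavoidable_inL (tightC tPQ) (rigidC rg) (linkageC lk) ub.
have [c [d [d' [c' [s [sq sx sy]]]]]] := square_between tPQ rg lk
  (shunt_src sh) (shunt_tgt sh) zs (zR _ (tgt_mem R)).
have [k _ _] := sq; have [_ _ [A [B [sw tAB]]]] := rg _ _ _ _ k.
by case: s sx sy => sx sy; [exact: no_forward sq sw tAB sx sy | exact: no_backward sq sw tAB sx sy].
Qed.

Lemma no_shunt P Q S T : tight P Q -> rigid P Q ->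
  S = [set src P; src Q] -> T = [set tgt P; tgt Q] -> ~ contains_shunt S T.
Proof.
move=> tPQ rg -> -> [X [Y [R [sh es et]]]]; have [dPQ slPQ _] := tPQ.
have lk : linkage P Q X Y by split=> //; exact: shunt_disjPQ sh.
case/orP: (shunt_zone dPQ slPQ lk sh (src_mem R)).
  exact: no_shunt_zone tPQ rg lk sh.
exact: no_shunt_zone (tightC tPQ) (rigidC rg) (linkageC lk) sh.
Qed.

(* If one crossing at [c] yields a tight linkage, then it is the only crossing at [c]. *)
Lemma rigid_of_swapped P Q : tight P Q ->
  (forall c, c \in verts P -> (exists d d' c', crossing P Q c d d' c') ->
     exists d d' c' A B, [/\ crossing P Q c d d' c', swapped P Q c d d' c' A B & tight A B]) ->
  rigid P Q.
Proof.
move=> [dPQ slPQ _] H c e e' f k2.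
have [||d [d' [c' [A [B [k sw tAB]]]]]] := H c.
- by case: k2 => -[].
- by exists e, e', f.
have [dAB slAB uAB] := tAB; have [sA tA sB tB] := swapped_ends k sw.
have [[cP c'P dQ d'Q] acd adc lc ld] := k; have [eA eB] := sw.
have PQF z : z \in verts P -> z \in verts Q -> False by exact: disjF.
have memA' z : z \in verts P -> (z \in verts A) = (ix P z <= ix P c).
  move=> zP; rewrite eA mem_cat mem_take_ix //.
  by case: (boolP (z \in drop _ _)) => [/mem_drop_verts/(PQF _ zP)//|]; rewrite orbF.
have memB' z : z \in verts P -> (z \in verts B) = (ix P c' <= ix P z).
  move=> zP; rewrite eB mem_cat mem_drop_ix //.
  by case: (boolP (z \in take _ _)) => [/mem_take_verts/(PQF _ zP)//|].
have memA2 z : z \in verts Q -> (z \in verts A) = (ix Q d <= ix Q z).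
  move=> zQ; rewrite eA mem_cat mem_drop_ix //.
  by case: (boolP (z \in take _ _)) => [/mem_take_verts/PQF/(_ zQ)//|].
have memB2 z : z \in verts Q -> (z \in verts B) = (ix Q z <= ix Q d').
  move=> zQ; rewrite eB mem_cat mem_take_ix //.
  by case: (boolP (z \in drop _ _)) => [/mem_drop_verts/PQF/(_ zQ)//|]; rewrite orbF.
(* The vertices strictly between [u] and [v] are off both new paths, so any such vertex would be a
   bridge. *)
have gap S U V u v : disj U V -> u \in verts S -> v \in verts S ->
    (forall z, z \in verts S -> ix S u < ix S z < ix S v -> off U V z) ->
    shuntless U V -> u \in verts U -> v \in verts V -> ix S u < ix S v ->
    ix S v = (ix S u).+1.
  move=> dUV uS vS ho sl uU vV lt; apply/eqP; rewrite eqn_leq lt andbT leqNgt.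
  apply/negP=> gt.
  have usz : (ix S u).+1 < size (verts S).
    by apply: leq_trans gt _; rewrite ltnW // /ix index_mem.
  pose w := nth u (verts S) (ix S u).+1.
  have fo : follows (verts S) u w.
    by rewrite -{1}(nth_index u uS); apply: follows_nth (verts_uniq S) usz.
  have [_ wS] := follows_mem fo.
  have iw : ix S w = (ix S u).+1 by exact: follows_index fo.
  have fw : from U V w.
    by apply: from_step (from_mem _ uU) (follows_arc fo) (ho w wS _); rewrite iw leqnn.
  apply: (no_bridge dUV sl fw).
  have wv : ix S w <= ix S v by rewrite iw ltnW.
  apply: (to_along wS vS wv (to_mem _ vV)) => z zS /andP[i1 i2].
  have [e1|ne] := eqVneq z v; first by rewrite e1; apply/negP=> vU; exact: disjF dUV vU vV.
  have : off U V z.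
    apply: ho => //; rewrite -iw i1 ltn_neqAle i2 andbT.
    by apply: contra_neq ne => /(ix_inj zS).
  by case/andP.
have ic : ix P c' = (ix P c).+1.
  apply: (gap P A B) => //; rewrite ?memA' ?memB' //.
  by move=> z zP /andP[i1 i2]; rewrite /off memA' // memB' // -!ltnNge i1 i2.
have idd : ix Q d = (ix Q d').+1.
  have dBA : disj B A by rewrite disjC.
  apply: (gap Q B A) => //; rewrite ?memA2 ?memB2 //; last exact: shuntlessC.
  by move=> z zQ /andP[i1 i2]; rewrite /off memA2 // memB2 // -!ltnNge i1 i2.
have cA : c \in verts A by rewrite memA'.
have c'B : c' \in verts B by rewrite memB'.
have dA : d \in verts A by rewrite memA2.
have d'B : d' \in verts B by rewrite memB2.
have acc : arc c c' by apply: (@follows_arc _ P); rewrite /follows c'P; apply/eqP.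
have add : arc d' d by apply: (@follows_arc _ Q); rewrite /follows dQ; apply/eqP.
(* The sides [c -> c'] and [d' -> d] of the square join [A] and [B], so each of the four corners is
   unavoidable for the path carrying it. *)
have [uc uc'] := uAB c c' cA c'B (introT orP (or_introl acc)).
have [ud ud'] := uAB d d' dA d'B (introT orP (or_intror add)).
have [[_ fP eQ e'Q] ace aef lf le'] := k2.
have [x xP xQ|A' [eA' sA' tA']] := splice cP eQ ace; first by case: (PQF x).
have [x xQ xP|B' [eB' sB' tB']] := splice e'Q fP aef; first by case: (PQF x).
(* Were [e] later than [d], the path [A'] would be a rerouting of [A] off [B] that misses [d]. *)
have led : ix Q e <= ix Q d.
  rewrite leqNgt; apply/negP=> lt.
  have : d \in verts A'.
    apply: ud; rewrite ?sA ?tA //; apply/pred0P=> z /=; apply/negP.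
    rewrite eA' mem_cat => /andP[/orP[h|h]].
      have zP := mem_take_verts h; rewrite memB' // ic.
      by move: h; rewrite mem_take_ix // ltnS ltnNge => ->.
    have zQ := mem_drop_verts h; rewrite memB2 //; move: h; rewrite mem_drop_ix // => h.
    by rewrite leqNgt -ltnS -idd (leq_trans lt) // ltnW.
  rewrite eA' mem_cat mem_drop_ix // [_ <= ix Q d]leqNgt lt orbF.
  by move/mem_take_verts=> /PQF; apply.
have dB'A : ix Q e' <= ix Q d' -> disj B' A.
  move=> le; apply/pred0P=> z /=; apply/negP; rewrite eB' mem_cat => /andP[/orP[h|h]].
    have zQ := mem_take_verts h; rewrite memA2 // idd; move: h; rewrite mem_take_ix //.
    by rewrite ltnS => h; rewrite ltnNge (leq_trans h le).
  have zP := mem_drop_verts h; rewrite memA' //; move: h; rewrite mem_drop_ix // => h.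
  by rewrite leqNgt (leq_trans lf h).
(* Were [e'] earlier than [d'], the path [B'] would be a rerouting of [B] off [A] that misses
   [d']. *)
have de' : ix Q d' <= ix Q e'.
  rewrite leqNgt; apply/negP=> lt.
  have : d' \in verts B' by apply: ud'; rewrite ?sB ?tB //; apply: dB'A; exact: ltnW.
  rewrite eB' mem_cat mem_take_ix // ltnS leqNgt lt /=.
  by move/mem_drop_verts=> /PQF; apply.
have ee' : e' = d'.
  apply: (ix_inj e'Q); apply/eqP; rewrite eqn_leq de' andbT.
  by rewrite -ltnS -idd; exact: leq_trans le' led.
have ee : e = d.
  apply: (ix_inj eQ); apply/eqP; rewrite eqn_leq led /= idd.
  exact: leq_ltn_trans de' le'.
have cf : f = c'.
  apply: (ix_inj fP); apply/eqP; rewrite eqn_leq ic lf andbT -ic leqNgt; apply/negP=> lt.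
  have : c' \in verts B' by apply: uc'; rewrite ?sB ?tB //; apply: dB'A; rewrite ee'.
  rewrite eB' mem_cat mem_drop_ix // [_ <= ix P c']leqNgt lt orbF.
  by move/mem_take_verts=> /(PQF _ c'P).
by rewrite cf ee ee'; split=> //; exists A, B.
Qed.

(** What the program can certify about one vertex. In the second case [bypass_shunt] shows that no
    arc joins [x] to [Q]. *)
Definition checked P Q x := unavoidable P Q x \/ exists P',
  [/\ src P' = src P, tgt P' = tgt P, disj P' Q, x \notin verts P' & shuntless P' Q].

Lemma tight_of_checked P Q : disj P Q -> shuntless P Q ->
  (forall x, x \in verts P -> checked P Q x) ->
  (forall y, y \in verts Q -> checked Q P y) -> tight P Q.
Proof.
have K P1 Q1 x y : disj P1 Q1 -> checked P1 Q1 x -> x \in verts P1 -> y \in verts Q1 ->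
    arc x y || arc y x -> unavoidable P1 Q1 x.
  move=> d [//|[P' [sP tP d' nx sl]]] xP yQ a.
  by case: (bypass_shunt d d' sP tP xP nx yQ a sl).
move=> dPQ sl hP hQ; split=> // x y xP yQ a; split.
  exact: K dPQ (hP x xP) xP yQ a.
by apply: K (hQ y yQ) yQ xP _; rewrite 1?disjC // orbC.
Qed.

End NoShunt.

(** * Running programs *)

Ltac cost D := clear; move: (#|D|) (#|arcs D|) => ? ?; lia.


Section Machine.
Implicit Types (p q : prog) (st : store) (b : test) (Q : store -> Prop).

Definition run p st T Q := exists st' t, [/\ exec p st st' t, t <= T & Q st'].

Lemma run_weaken p st T T' Q Q' : run p st T Q -> T <= T' ->
  (forall st', Q st' -> Q' st') -> run p st T' Q'.
Proof.
by case=> st' [t [e l h]] lT H; exists st', t; split; [|exact: leq_trans lT|exact: H].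
Qed.

Lemma run_comp p q st T1 T2 T Q1 Q : run p st T1 Q1 ->
  (forall st1, Q1 st1 -> run q st1 T2 Q) -> T1 + T2 < T -> run (Comp p q) st T Q.
Proof.
case=> st1 [t1 [e1 l1 h1]] H lT; have [st2 [t2 [e2 l2 h2]]] := H _ h1.
exists st2, (t1 + t2).+1; split=> //; first exact: ExecComp e1 e2.
by apply: leq_trans lT; rewrite ltnS leq_add.
Qed.

Lemma run_if b p q st T Q : (holds st b -> run p st T Q) ->
  (~~ holds st b -> run q st T Q) -> run (If b p q) st (tcost b + T).+1 Q.
Proof.
have [h H _|h _ H] := boolP (holds st b).
  have [st' [t [e l g]]] := H isT; exists st', (tcost b + t).+1.
  by split; rewrite // ?ltnS ?leq_add2l //; apply: ExecIfTrue.
have [st' [t [e l g]]] := H isT; exists st', (tcost b + t).+1.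
by split; rewrite // ?ltnS ?leq_add2l //; apply: ExecIfFalse.
Qed.

Lemma run_while_false b p st T Q : ~~ holds st b -> tcost b < T -> Q st ->
  run (While b p) st T Q.
Proof. by move=> h lT g; exists st, (tcost b).+1; split=> //; apply: ExecWhileFalse. Qed.

Lemma run_while_true b p st T1 T2 T Q1 Q : holds st b -> run p st T1 Q1 ->
  (forall st1, Q1 st1 -> run (While b p) st1 T2 Q) ->
  tcost b + T1 + T2 < T -> run (While b p) st T Q.
Proof.
move=> h [st1 [t1 [e1 l1 h1]]] H lT; have [st2 [t2 [e2 l2 h2]]] := H _ h1.
exists st2, (tcost b + t1 + t2).+1; split=> //; first exact: ExecWhileTrue e1 e2.
by apply: leq_trans lT; rewrite ltnS leq_add // leq_add.
Qed.

Fixpoint flat p := match p with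
  | Comp p q | If _ p q => flat p && flat q
  | While _ _ => false
  | _ => true
  end.

Fixpoint step p st := match p with
  | Assign x e => set_reg st x (eval st e)
  | Put a i e => set_arr st a (eval st i) (eval st e)
  | Comp p q => step q (step p st)
  | If b p q => if holds st b then step p st else step q st
  | _ => st
  end.

(** The value for [While] is a placeholder: the bound is claimed for [flat] programs only. *)
Fixpoint fcost p := match p with
  | Skip => 1
  | Assign x e => (ecost e).+1
  | Put a i e => (ecost i + ecost e).+1
  | Comp p q => (fcost p + fcost q).+1
  | If b p q => (tcost b + maxn (fcost p) (fcost q)).+1
  | While _ _ => 0
  end.

Lemma exec_flat p st : flat p -> exists2 t, exec p st (step p st) t & t <= fcost p.
Proof.
elim: p st => [|x e|a i e|p IHp q IHq|b p IHp q IHq|b p _] //= st.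
- by exists 1 => //; constructor.
- by exists (ecost e).+1 => //; constructor.
- by exists (ecost i + ecost e).+1 => //; constructor.
- case/andP=> /(IHp st)[t1 e1 l1] /(IHq (step p st))[t2 e2 l2].
  by exists (t1 + t2).+1; [exact: ExecComp e1 e2 | rewrite ltnS leq_add].
- case/andP=> fp fq; case: ifPn => h.
    have [t e l] := IHp st fp; exists (tcost b + t).+1; first exact: ExecIfTrue.
    by rewrite ltnS leq_add2l leq_max l.
  have [t e l] := IHq st fq; exists (tcost b + t).+1; first exact: ExecIfFalse.
  by rewrite ltnS leq_add2l leq_max l orbT.
Qed.

(** Reduces loop-free code to computation: [step] evaluates it and [fcost] bounds its worst case. *)
Lemma run_flat p st T Q : flat p -> fcost p <= T -> Q (step p st) -> run p st T Q.
Proof.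
move=> f l h; have [t e lt] := exec_flat st f; exists (step p st), t.
by split=> //; exact: leq_trans lt l.
Qed.

Lemma run_skip st T Q : Q st -> 0 < T -> run Skip st T Q.
Proof. by move=> h lT; exists st, 1; split=> //; constructor. Qed.

Fixpoint wregs p : seq nat := match p with
  | Assign x _ => [:: x]
  | Comp p q | If _ p q => wregs p ++ wregs q
  | While _ p => wregs p
  | _ => [::]
  end.

Fixpoint warrs p : seq nat := match p with
  | Put a _ _ => [:: a]
  | Comp p q | If _ p q => warrs p ++ warrs q
  | While _ p => warrs p
  | _ => [::]
  end.

(** A frame condition. [exec_agree] derives it from the syntactic write sets, so specifications need
    not list what is preserved. *)
Definition agree (rs xs : seq nat) st st' :=
  (forall x, x \notin rs -> reg st' x = reg st x) /\
  (forall a, a \notin xs -> arr st' a = arr st a).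


Lemma agree_set_reg st x v : agree [:: x] [::] st (set_reg st x v).
Proof. by split=> // y; rewrite inE /= /upd => /negPf->. Qed.

Lemma agree_trans rs xs st1 st2 st3 :
  agree rs xs st1 st2 -> agree rs xs st2 st3 -> agree rs xs st1 st3.
Proof. by case=> r1 a1 [r2 a2]; split=> z h; rewrite ?r2 ?a2 ?r1 ?a1. Qed.

Lemma agree_sub rs xs rs' xs' st st' : agree rs xs st st' ->
  {subset rs <= rs'} -> {subset xs <= xs'} -> agree rs' xs' st st'.
Proof.
by case=> r a hr ha; split=> z h; [apply: r; apply: contra h; apply: hr
                              |apply: a; apply: contra h; apply: ha].
Qed.

Lemma exec_agree p st st' t : exec p st st' t -> agree (wregs p) (warrs p) st st'.
Proof.
elim=> {p st st' t} //=.
- by move=> st x e; split=> // y; rewrite inE /= /upd => /negPf->.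
- by move=> st a i e; split=> // y; rewrite inE /= /upd => /negPf->.
- move=> st st1 st2 p q t1 t2 _ A1 _ A2; apply: agree_trans (agree_sub A1 _ _) (agree_sub A2 _ _);
    by move=> z; rewrite mem_cat => ->; rewrite ?orbT.
- move=> st st1 b p q t h _ A; apply: agree_sub A _ _ => z; by rewrite mem_cat => ->.
- move=> st st1 b p q t h _ A; apply: agree_sub A _ _ => z; by rewrite mem_cat => ->; rewrite orbT.
- move=> st st1 st2 b p t1 t2 _ _ A1 _ A2; exact: agree_trans A1 A2.
Qed.

Lemma run_agree p st T Q : run p st T Q ->
  run p st T (fun st' => Q st' /\ agree (wregs p) (warrs p) st st').
Proof.
by case=> st' [t [e l h]]; exists st', t; split=> //; split=> //; exact: exec_agree e.
Qed.

Lemma run_comp_agree p q st T1 T2 T Q1 Q : run p st T1 Q1 ->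
  (forall st1, Q1 st1 -> agree (wregs p) (warrs p) st st1 -> run q st1 T2 Q) ->
  T1 + T2 < T -> run (Comp p q) st T Q.
Proof. by move/run_agree=> r H lT; apply: run_comp r _ lT => st1 []; exact: H. Qed.

Lemma run_loop b p (J : nat -> store -> Prop) (f : nat -> nat) N st Q :
  J 0 st ->
  (forall i st', i < N -> J i st' -> holds st' b /\ run p st' (f i) (J i.+1)) ->
  (forall st', J N st' -> ~~ holds st' b /\ Q st') ->
  run (While b p) st (\sum_(i < N) (f i + (tcost b).+1) + (tcost b).+1) Q.
Proof.
move=> J0 Jstep Jend.
have K m i st' : i + m = N -> J i st' ->
    run (While b p) st' (\sum_(i <= j < N) (f j + (tcost b).+1) + (tcost b).+1) Q.
  elim: m i st' => [|m IH] i st' e Ji.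
    rewrite addn0 in e; subst i; have [h g] := Jend _ Ji.
    by apply: run_while_false h _ g; rewrite leq_addl.
  have lt : i < N by rewrite -e addnS ltnS leq_addr.
  have [h r] := Jstep _ _ lt Ji; apply: run_while_true h r _ _.
    by move=> st1; apply: IH; rewrite addSnnS.
  by rewrite (@big_ltn _ _ _ i N) //; lia.
by have := K N 0 st erefl J0; rewrite big_mkord.
Qed.

Definition For x p := Comp (Assign x (Num 0))
  (While (TLt (Reg x) (Reg 0)) (Comp p (Assign x (Succ (Reg x))))).

(** [J] has to tolerate any value of [x], since the counter is set before the first round and
    increased after each one. Register 0 holds the bound. *)
Lemma run_for x p (J : nat -> store -> Prop) (f : nat -> nat) N st T Q :
  x != 0 -> x \notin wregs p -> 0 \notin wregs p -> reg st 0 = N ->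
  (forall i st' v, J i st' -> J i (set_reg st' x v)) ->
  J 0 st ->
  (forall i st', i < N -> agree (x :: wregs p) (warrs p) st st' -> reg st' x = i ->
     J i st' -> run p st' (f i) (J i.+1)) ->
  (forall st', agree (x :: wregs p) (warrs p) st st' -> J N st' -> Q st') ->
  \sum_(i < N) f i + 8 * N + 8 <= T ->
  run (For x p) st T Q.
Proof.
move=> x0 xp p0 eN Jx J0 Jstep Jend lT.
pose J' i st' := [/\ J i st', reg st' x = i & agree (x :: wregs p) (warrs p) st st'].
have N' st' : agree (x :: wregs p) (warrs p) st st' -> reg st' 0 = N.
  by case=> h _; rewrite h // inE negb_or eq_sym x0.
apply: (@run_comp _ _ _ 2 (\sum_(i < N) (f i + 4 + 4) + 4) _
    (fun st' => J' 0 st')).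
- apply: run_flat => //; split=> //=; first exact: Jx.
    by rewrite /upd eqxx.
  by split=> //= y; rewrite inE negb_or /upd => /andP[/negPf->].
- move=> st1 J1; apply: (run_loop (J := J') (f := fun i => f i + 4)) => // [i st' iN [Ji ei ag]|st' [Ji ei ag]].
    split; first by rewrite /= ei N'.
    apply: (run_comp_agree (Jstep i st' iN ag ei Ji)) => [st2 J2 ag2|]; last first.
      by rewrite addnS ltnS.
    apply: run_flat => //; split=> /=; first exact: Jx.
      by rewrite /upd eqxx; case: ag2 => -> //; rewrite ei.
    apply: agree_trans ag _; split=> [y|a] /= h; last by case: ag2 => _ ->.
    move: h; rewrite inE negb_or /upd => /andP[/negPf-> h].
    by case: ag2 => ->.
  by split; [rewrite /= ei N' // ltnn | exact: Jend].
apply: leq_trans lT; under eq_bigr do rewrite -addnA.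
by rewrite big_split /= sum_nat_const card_ord; lia.
Qed.

Definition nbrs st k := [seq arr st 1 j | j <- iota (arr st 0 k) (arr st 0 k.+1 - arr st 0 k)].

Definition ForArc x i y p := Comp (Assign i (Get 0 (Reg x)))
  (While (TLt (Reg i) (Get 0 (Succ (Reg x))))
     (Comp (Assign y (Get 1 (Reg i))) (Comp p (Assign i (Succ (Reg i)))))).

(** The invariant is indexed by the neighbours already handled, which at the end are the whole
    list. *)
Lemma run_forarc x i y p (J : seq nat -> store -> Prop) c st T Q :
  uniq [:: x; i; y] -> x \notin wregs p -> i \notin wregs p -> y \notin wregs p ->
  0 \notin warrs p -> 1 \notin warrs p ->
  (forall l st' v, J l st' -> J l (set_reg st' i v)) ->
  (forall l st' v, J l st' -> J l (set_reg st' y v)) ->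
  J [::] st ->
  (forall l1 w l2 st', nbrs st (reg st x) = l1 ++ w :: l2 ->
     agree [:: i, y & wregs p] (warrs p) st st' -> reg st' y = w ->
     J l1 st' -> run p st' c (J (rcons l1 w))) ->
  (forall st', agree [:: i, y & wregs p] (warrs p) st st' ->
     J (nbrs st (reg st x)) st' -> Q st') ->
  (c + 16) * size (nbrs st (reg st x)) + 12 <= T ->
  run (ForArc x i y p) st T Q.
Proof.
move=> /= /and3P[+ + _] xp ip yp p0 p1 Ji Jy J0 Jstep Jend lT.
rewrite !inE !negb_or => /andP[nxi nxy] niy.
set l := nbrs st (reg st x) in lT Jstep Jend *.
pose o := arr st 0 (reg st x); pose o' := arr st 0 (reg st x).+1.
have sl : size l = o' - o by rewrite size_map size_iota.
pose J' k st' := [/\ J (take k l) st', reg st' i = o + k &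
  agree [:: i, y & wregs p] (warrs p) st st'].
have rx st' : agree [:: i, y & wregs p] (warrs p) st st' -> reg st' x = reg st x.
  by case=> h _; rewrite h // !inE !negb_or nxi nxy.
have a0 st' : agree [:: i, y & wregs p] (warrs p) st st' -> arr st' 0 = arr st 0.
  by case=> _ ->.
have a1 st' : agree [:: i, y & wregs p] (warrs p) st st' -> arr st' 1 = arr st 1.
  by case=> _ ->.
apply: (@run_comp _ _ _ 3 (\sum_(k < size l) (c + 9 + 6) + 6) _ (fun st' => J' 0 st')).
- apply: run_flat => //; split=> //=; first by rewrite take0; exact: Ji.
    by rewrite /upd eqxx addn0.
  by split=> //= z; rewrite !inE !negb_or /upd => /andP[/negPf->].
- move=> st1 J1; apply: (run_loop (J := J') (f := fun _ => c + 9)) => // [k st' kl [Jk ek ag]|st' [Jk ek ag]].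
    have lt : o + k < o' by lia.
    split; first by rewrite /= ek rx // a0.
    have ew : arr st 1 (o + k) = nth 0 l k.
      by rewrite /l /nbrs -/o -/o' (nth_map 0) ?size_iota -?sl // nth_iota // -sl.
    apply: (@run_comp_agree _ _ _ 3 (c + 5) _ (fun st' =>
       J (take k l) st' /\ reg st' y = nth 0 l k)); last by lia.
      by apply: run_flat => //=; split; [exact: Jy | rewrite /upd eqxx a1 // ek].
    move=> st2 [J2 e2] ag2.
    have ag2' : agree [:: i, y & wregs p] (warrs p) st st2.
      apply: agree_trans ag (agree_sub ag2 _ _) => //= z; by rewrite !inE => ->; rewrite orbT.
    have el : l = take k l ++ nth 0 l k :: drop k.+1 l.
      by rewrite -drop_nth // cat_take_drop.
    apply: (run_comp_agree (Jstep _ _ _ st2 el ag2' e2 J2) _ (T2 := 4)); last by lia.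
    move=> st3 J3 ag3; apply: run_flat => //; split=> /=.
    - by rewrite (take_nth 0) //; exact: Ji.
    - rewrite /upd eqxx; case: ag3 => -> // _; case: ag2 => -> //; first by rewrite ek addnS.
      by rewrite /= inE.
    apply: agree_trans ag2' _; split=> [z|a] /= h; last by case: ag3 => _ ->.
    move: h; rewrite !inE !negb_or /upd => /and3P[/negPf-> _ h].
    by case: ag3 => ->.
  split; first by rewrite /= ek rx // a0 // -/o' -leqNgt; lia.
  by apply: Jend => //; move: Jk; rewrite take_size.
apply: leq_trans lT; rewrite sum_nat_const card_ord; lia.
Qed.

End Machine.

(** * Graph search *)

Notation "p ;; q" := (Comp p q) (at level 61, right associativity).
(* Arrays [7], [10] and [12] hold the predecessors along the paths of the base,
   the swapped and the rerouted linkage; [8], [11], [13] tell which path a vertex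
   is on, and [9], [14] its distance to the end of that path. *)
Notation rANS := 5. Notation rOU := 6. Notation rOV := 7. Notation rX := 8.
Notation rI := 9. Notation rY := 10. Notation rH := 11. Notation rK := 12.
Notation rU := 13. Notation rW := 14. Notation rZ := 15. Notation rA1 := 16.
Notation rA2 := 17. Notation rC := 18. Notation rS := 19. Notation rD := 20.
Notation rD' := 21. Notation rC' := 22. Notation rN := 23.
Notation aF := 2. Notation aSEEN := 3. Notation aPAR := 4. Notation aVIA := 5.
Notation aQUE := 6.

(* From a node [u], the search looks at [w = u] and at the out-neighbours [w] of
   [u], and enters the node [F w], which is recorded with its parent [u] and with
   [w].  The node [n] is a sink, and [F w = n + 1] forbids [w]. *)
Definition visit F :=
  Assign rZ (Get F (Reg rW)) ;;
  If (TEq (Get aSEEN (Reg rZ)) (Num 0))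
    (Put aSEEN (Reg rZ) (Num 1) ;; Put aPAR (Reg rZ) (Reg rU) ;;
     Put aVIA (Reg rZ) (Reg rW) ;; Put aQUE (Reg rK) (Reg rZ) ;;
     Assign rK (Succ (Reg rK)))
    Skip.

Definition search F :=
  Assign rH (Num 0) ;;
  While (TLt (Reg rH) (Reg rK))
    (Assign rU (Get aQUE (Reg rH)) ;; Assign rH (Succ (Reg rH)) ;;
     Assign rW (Reg rU) ;; visit F ;; ForArc rU rI rW (visit F)).

(** Marking node [n + 1] as seen in advance is what makes it forbidden; the sink [n] starts
    unseen. *)
Definition clear :=
  For rX (Put aSEEN (Reg rX) (Num 0)) ;; Put aSEEN (Reg 0) (Num 0) ;;
  Put aSEEN (Succ (Reg 0)) (Num 1) ;; Assign rK (Num 0).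

Definition push e :=
  Put aSEEN e (Num 1) ;; Put aQUE (Reg rK) e ;; Assign rK (Succ (Reg rK)).

(** Flips the recorded alternating path: each vertex crossed is reassigned to the parent. When [F]
    merely keeps or forbids vertices, each reached node other than a start was entered through
    itself, and the loop just writes predecessors along a dipath. *)
Definition walk A :=
  While (TNot (TEq (Reg rC) (Reg rS)))
    (Put A (Get aVIA (Reg rC)) (Get aPAR (Reg rC)) ;;
     Assign rC (Get aPAR (Reg rC))).

Section Search.
Variables (n m : nat) (nb : nat -> seq nat).
Hypotheses (nb_lt : forall k w, w \in nb k -> w < n) (nb_n : nb n = [::])
  (nb_sum : \sum_(k < n) size (nb k) <= m).
Implicit Types (st : store) (q : seq nat).

Definition graph st := reg st 0 = n /\ forall k, k <= n -> nbrs st k = nb k.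

Lemma graph_agree rs xs st st' : agree rs xs st st' -> 0 \notin rs ->
  0 \notin xs -> 1 \notin xs -> graph st -> graph st'.
Proof.
case=> hr ha r0 a0 a1 [g1 g2]; split=> [|k /g2]; first by rewrite hr.
by rewrite /nbrs !ha.
Qed.

Definition queue q st :=
  [/\ forall j, j < size q -> arr st aQUE j = nth 0 q j, reg st rK = size q, uniq q,
      all (leq^~ n) q &
      forall x, x <= n.+1 -> (arr st aSEEN x != 0) = (x \in q) || (x == n.+1)].

Lemma queue_agree q rs xs st st' : agree rs xs st st' -> rK \notin rs ->
  aQUE \notin xs -> aSEEN \notin xs -> queue q st -> queue q st'.
Proof.
case=> hr ha h1 h2 h3 [q1 q2 q3 q4 q5]; split=> //; first by move=> j; rewrite ha; auto.
  by rewrite hr.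
by move=> x; rewrite ha; auto.
Qed.

Lemma run_clear st : graph st -> run clear st (30 * n.+1) (queue [::]).
Proof.
clear nb_sum; case=> g0 _.
apply: (run_comp (T1 := 12 * n + 8) (T2 := 12) (Q1 := fun st' => reg st' 0 = n /\
   forall x, x < n -> arr st' aSEEN x = 0)); last by lia.
  apply: (@run_for _ _ (fun i st' => forall x, x < i -> arr st' aSEEN x = 0)
     (fun => 4) n) => //=.
  - move=> i st' _ _ ei h; apply: run_flat => //= x; rewrite ltnS leq_eqVlt.
    by rewrite /upd /= ei; case: eqVneq => //= _; exact: h.
  - by move=> st' [h _] H; rewrite h.
  - by rewrite sum_nat_const card_ord; lia.
move=> st' [e0 h]; apply: run_flat => //; split=> //= x xn.
rewrite /upd /= e0; case: (eqVneq x n.+1) => //= ne.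
case: (eqVneq x n) => //= ne'. rewrite h //; lia.
Qed.

Lemma queue_push e q st : queue q st -> eval st e <= n -> eval st e \notin q ->
  eval (set_arr st aSEEN (eval st e) 1) e = eval st e ->
  queue (rcons q (eval st e)) (step (push e) st).
Proof.
move=> [q1 q2 q3 q4 q5] en eq ee; split=> /=.
- move=> j; rewrite size_rcons ltnS /upd /= q2 ee nth_rcons leq_eqVlt.
  by case: eqVneq => [->|ne] /=; rewrite ?ltnn // => lt; rewrite lt q1.
- by rewrite /upd /= q2 size_rcons.
- by rewrite rcons_uniq eq.
- by rewrite all_rcons en.
- move=> x xn; rewrite /upd /= mem_rcons inE; case: (eqVneq x (eval st e)) => //= _; exact: q5.
Qed.

Section Sources.
Variable q0 : seq nat.

(** [c] lists the ancestors of [x], up to the first one that is a start of the search. *)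
Definition chain (par : nat -> nat) q x c :=
  [/\ path (fun a b => b == par a) x c, last x c \in q0, uniq (x :: c),
      {subset c <= q} & {in belast x c, forall y, y \notin q0}].

Definition searched F q st :=
  [/\ queue q st, {subset q0 <= q} &
   forall x, x \in q -> (exists c, chain (arr st aPAR) q x c) /\
     (x \notin q0 ->
      [/\ arr st aPAR x \in q, arr st aVIA x \in arr st aPAR x :: nb (arr st aPAR x) &
          arr st F (arr st aVIA x) = x])].

Definition closed_at F q st u :=
  forall w, w \in u :: nb u -> arr st F w \in q \/ arr st F w = n.+1.

Lemma searched_init F st : queue q0 st -> searched F q0 st.
Proof.
move=> h; split=> // x xq; split; last by rewrite xq.
by exists [::]; split.
Qed.

Lemma searched_agree F q rs xs st st' : agree rs xs st st' -> rK \notin rs ->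
  F \notin xs -> aSEEN \notin xs -> aPAR \notin xs -> aVIA \notin xs -> aQUE \notin xs ->
  searched F q st -> searched F q st'.
Proof.
move=> ag h1 h2 h3 h4 h5 h6 [s1 s2 s3]; split=> //; first exact: queue_agree ag _ _ _ s1.
by case: ag => _ ha x /s3; rewrite !ha.
Qed.

Definition scratch := [:: aSEEN; aPAR; aVIA; aQUE].

Lemma step_visit F st q u w : F \notin scratch ->
  (forall k, k <= n -> arr st F k <= n.+1) ->
  searched F q st -> reg st rU = u -> reg st rW = w -> u \in q -> w \in u :: nb u ->
  exists q2, [/\ searched F (q ++ q2) (step (visit F) st),
    arr st F w \in q ++ q2 \/ arr st F w = n.+1,
    arr (step (visit F) st) F = arr st F & agree (wregs (visit F)) (warrs (visit F)) st (step (visit F) st)].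
Proof.
move=> nF hF S eu ew uq wu.
have ag : agree (wregs (visit F)) (warrs (visit F)) st (step (visit F) st).
  by have [t e _] := @exec_flat (visit F) st isT; exact: exec_agree e.
have eF : arr (step (visit F) st) F = arr st F by case: ag => _ ->.
have un : u <= n by case: S => [[_ _ _ /allP h _] _ _]; exact: h.
have wn : w <= n by move: wu; rewrite inE => /predU1P[->//|/nb_lt/ltnW].
have zn := hF w wn; set z := arr st F w in zn *.
have [[q1 q2 q3 q4 q5] s2 s3] := S.
have [sz|sz] := boolP (arr st aSEEN z == 0); last first.
  exists [::]; rewrite cats0; split=> //.
    apply: (searched_agree (rs := [:: rZ]) (xs := [::]) _ _ _ _ _ _ _ S) => //.
    have -> : step (visit F) st = set_reg st rZ z.
      by rewrite /= ew {1}/upd /= -/z (negPf sz).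
    exact: agree_set_reg.
  by have := q5 z zn; rewrite sz => /esym/orP[|/eqP]; auto.
have zq : (z \in q) || (z == n.+1) = false by rewrite -q5 // sz.
have [zq1 zn1] : z \notin q /\ z != n.+1 by apply/norP; rewrite zq.
have {zq} zn' : z <= n by lia.
exists [:: z]; split=> //; last by left; rewrite mem_cat inE eqxx orbT.
have zu : z != u by apply: contraNneq zq1 => ->.
have es : step (visit F) st = step (Put aSEEN (Reg rZ) (Num 1) ;; Put aPAR (Reg rZ) (Reg rU) ;;
     Put aVIA (Reg rZ) (Reg rW) ;; Put aQUE (Reg rK) (Reg rZ) ;;
     Assign rK (Succ (Reg rK))) (set_reg st rZ z).
  by rewrite /= ew {1}/upd /= -/z sz.
have eP y : y \in q -> arr (step (visit F) st) aPAR y = arr st aPAR y.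
  move=> yq; rewrite es /= /upd /=; case: eqVneq => // e.
  by rewrite -e yq in zq1.
have eV y : y \in q -> arr (step (visit F) st) aVIA y = arr st aVIA y.
  move=> yq; rewrite es /= /upd /=; case: eqVneq => // e.
  by rewrite -e yq in zq1.
have eP' : arr (step (visit F) st) aPAR z = u by rewrite es /= /upd /= eqxx.
have eV' : arr (step (visit F) st) aVIA z = w by rewrite es /= /upd /= eqxx.
have sub : {subset q <= q ++ [:: z]} by move=> y yq; rewrite mem_cat yq.
(* A parent is written only at the new node [z], which is not in [q], so existing chains survive. *)
have ch y c : y \in q -> chain (arr st aPAR) q y c ->
    chain (arr (step (visit F) st) aPAR) (q ++ [:: z]) y c.
  case: ag => _ _ yq [c1 c2 c3 c4 c5]; split=> // [|x /c4/sub//].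
  elim: c y yq c1 c4 {c2 c3 c5} => //= x c IH y yq /andP[e1 e2] c4.
  rewrite eP // e1; apply: IH => //; first by apply: c4; rewrite mem_head.
  by move=> v vc; apply: c4; rewrite inE vc orbT.
split.
- split.
  + move=> j; rewrite size_cat addn1 ltnS es /= /upd /= q2 nth_cat leq_eqVlt.
    by case: eqVneq => [->|ne] /=; rewrite ?ltnn ?subnn // => lt; rewrite lt q1.
  + by rewrite es /= /upd /= q2 size_cat addn1.
  + by rewrite cat_uniq q3 /= orbF zq1.
  + by rewrite all_cat q4 /= zn'.
  + move=> x xn; rewrite es /= /upd /= mem_cat inE.
    by case: (eqVneq x z) => //= _; rewrite ?orbT // orbF q5.
- by move=> y /s2/sub.
move=> x; rewrite mem_cat inE => /orP[xq|/eqP->].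
  have [[c hc] h] := s3 x xq; split; first by exists c; exact: ch.
  by move/h=> [h1 h2 h3]; rewrite eP // eV // eF; split=> //; exact: sub.
split; last by rewrite eP' eV' eF; split=> //; exact: sub.
have [[c hc] _] := s3 u uq; have [c1 c2 c3 c4 c5] := ch u c uq hc.
exists (u :: c); split=> //.
- by rewrite /= eP' eqxx.
- rewrite cons_uniq c3 andbT inE negb_or zu; apply: contra zq1.
  by case: hc => _ _ _ h _; exact: h.
- by move=> y; rewrite inE => /predU1P[->|/c4//]; exact: sub.
- move=> y; rewrite inE => /predU1P[->|/c5//].
  by apply: contra zq1 => /s2.
Qed.

Lemma run_visit_all F st q u : graph st -> F \notin scratch ->
  (forall k, k <= n -> arr st F k <= n.+1) ->
  searched F q st -> u \in q -> reg st rU = u -> reg st rW = u ->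
  run (visit F ;; ForArc rU rI rW (visit F)) st (50 * (size (nb u)).+1) (fun st' =>
    exists q2, searched F (q ++ q2) st' /\ closed_at F (q ++ q2) st' u).
Proof.
move=> g nF hF S uq eu ew.
have un : u <= n by case: S => [[_ _ _ /allP h _] _ _]; exact: h.
pose J l st' := exists q2, [/\ searched F (q ++ q2) st', arr st' F = arr st F &
  forall w, w \in u :: l -> arr st F w \in q ++ q2 \/ arr st F w = n.+1].
have [q2 [S2 c2 eF2 ag2]] := step_visit nF hF S eu ew uq (mem_head _ _).
apply: (run_comp (T1 := fcost (visit F)) (T2 := 46 * size (nb u) + 12) (Q1 := fun st1 => st1 = step (visit F) st)).
- exact: run_flat.
- move=> _ ->; set st1 := step _ st in S2 eF2 ag2 *.
  have eu1 : reg st1 rU = u by case: ag2 => -> //; rewrite eu.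
  have g1 : graph st1 by apply: graph_agree ag2 _ _ _ g.
  have enb : nbrs st1 (reg st1 rU) = nb u by rewrite eu1; case: g1 => _ ->.
  apply: (@run_forarc rU rI rW (visit F) J 30) => //.
  + by exists q2; split=> // w; rewrite mem_seq1 => /eqP->.
  + move=> l1 w l2 st' e ag ew' [q' [h1 h2 h3]]; rewrite enb in e.
    have eu' : reg st' rU = u by case: ag => ->.
    have hF' k : k <= n -> arr st' F k <= n.+1 by rewrite h2; exact: hF.
    have uq' : u \in q ++ q' by rewrite mem_cat uq.
    have wu : w \in u :: nb u by rewrite e inE mem_cat mem_head !orbT.
    have [q3 [S3 c3 eF3 _]] := step_visit nF hF' h1 eu' ew' uq' wu.
    apply: run_flat => //; exists (q' ++ q3); rewrite catA; split=> //; first by rewrite eF3.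
    move=> x; rewrite -rcons_cons mem_rcons inE => /predU1P[->|/h3[h|h]].
    * by rewrite -h2.
    * by left; rewrite mem_cat h.
    * by right.
  + move=> st' ag [q' [h1 h2 h3]]; rewrite enb in h3; exists q'; split=> //.
    by move=> w wu; rewrite h2; exact: h3.
  + by rewrite enb.
- rewrite /=; lia.
Qed.

Lemma leq_sum_uniq (q r : seq nat) (f : nat -> nat) : uniq q -> uniq r ->
  {subset q <= r} -> \sum_(u <- q) f u <= \sum_(u <- r) f u.
Proof.
move=> uq ur sub.
have /perm_to_subseq[s pr] := filter_subseq (mem q) r.
rewrite (perm_big _ pr) big_cat; apply: leq_trans (leq_addr _ _).
rewrite leq_eqVlt; apply/orP; left; apply/eqP; apply: perm_big; apply: uniq_perm => //.
  by rewrite filter_uniq.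
by move=> x; rewrite mem_filter /=; case: (boolP (x \in q)) => // /sub ->.
Qed.

(** Distinct queue entries scan each adjacency list at most once. Each node also counts one unit,
    including the sink, whose list is empty. *)
Lemma sum_nb (q : seq nat) : uniq q -> all (leq^~ n) q ->
  \sum_(u <- q) (size (nb u)).+1 <= m + n.+1.
Proof.
move=> uq qn; apply: (@leq_trans (\sum_(u <- iota 0 n.+1) (size (nb u)).+1)).
  by apply: leq_sum_uniq (iota_uniq _ _) _ => // x /(allP qn); rewrite mem_iota.
rewrite -[iota 0 n.+1]/(index_iota 0 n.+1) big_nat_recr //= nb_n big_mkord.
under eq_bigr do rewrite -addn1; rewrite big_split /= sum_nat_const card_ord muln1.
by rewrite -addnA addn1 leq_add2r.
Qed.

Lemma run_search F st : graph st -> F \notin scratch ->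
  (forall k, k <= n -> arr st F k <= n.+1) -> queue q0 st ->
  run (search F) st (100 * (m + n.+2)) (fun st' =>
    exists q, searched F q st' /\ {in q, forall u, closed_at F q st' u}).
Proof.
move=> g nF hF Q0.
(* Amortization: a node is charged 80 units for itself and 80 for each arc leaving it. In [K], [T]
   is the budget left once the nodes before the head have been charged. *)
pose cost q := \sum_(u <- q) 80 * (size (nb u)).+1.
have cost_le q : uniq q -> all (leq^~ n) q -> cost q <= 80 * (m + n.+1).
  by move=> uq qn; rewrite /cost -big_distrr /= leq_mul2l sum_nb.
rewrite /search; set body := (Assign rU _ ;; _).
(* [h] is the head of the queue. The queue never holds more than [n.+1] distinct nodes, so
   [n.+1 - h] bounds the remaining rounds. *)
have K k q h st' T : n.+1 - h < k -> h <= size q ->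
    graph st' -> (forall k, k <= n -> arr st' F k <= n.+1) ->
    searched F q st' -> reg st' rH = h ->
    {in take h q, forall u, closed_at F q st' u} ->
    80 * (m + n.+1) + 10 <= cost (take h q) + T ->
    run (While (TLt (Reg rH) (Reg rK)) body) st' T (fun st'' =>
      exists q, searched F q st'' /\ {in q, forall u, closed_at F q st'' u}).
  elim: k q h st' T => // k IH q h st' T hk hq g' hF' S eh cl lT.
  have [[q1 q2 q3 q4 q5] s2 s3] := S.
  have ct : cost (take h q) <= 80 * (m + n.+1).
    by apply: cost_le; rewrite ?take_uniq //; apply/allP=> x /mem_take/(allP q4).
  move: hq; rewrite leq_eqVlt => /orP[/eqP e|hq].
    apply: run_while_false; first by rewrite /= eh q2 e ltnn.
      by rewrite /=; lia.
    by exists q; split=> // u; move: cl; rewrite e take_size => cl /cl.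
  have sq : size q <= n.+1.
    rewrite -(size_iota 0 n.+1); apply: uniq_leq_size => // x /(allP q4).
    by rewrite mem_iota.
  pose u := nth 0 q h; have uq : u \in q by exact: mem_nth.
  have un : u <= n by exact: (allP q4).
  have et : take h.+1 q = rcons (take h q) u by exact: take_nth.
  have ct' : cost (take h q) + 80 * (size (nb u)).+1 <= 80 * (m + n.+1).
    have -> : cost (take h q) + 80 * (size (nb u)).+1 = cost (take h.+1 q).
      by rewrite /cost et -cats1 big_cat /= big_seq1.
    by apply: cost_le; rewrite ?take_uniq //; apply/allP=> x /mem_take/(allP q4).
  pose st1 := set_reg (set_reg (set_reg st' rU u) rH h.+1) rW u.
  have ag1 : agree [:: rU; rH; rW] [::] st' st1.
    by split=> // y; rewrite !inE !negb_or /= /upd => /and3P[/negPf-> /negPf-> /negPf->].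
  have S1 : searched F q st1 by exact: searched_agree ag1 _ _ _ _ _ _ S.
  have g1 : graph st1 by exact: graph_agree ag1 _ _ _ g'.
  have hF1 j : j <= n -> arr st1 F j <= n.+1 by exact: hF'.
  have R := run_agree (run_visit_all g1 nF hF1 S1 uq erefl erefl).
  apply: (run_while_true (T1 := 50 * (size (nb u)).+1 + 12) (T2 := T - 80 * (size (nb u)).+1)).
  - by rewrite /= eh q2.
  - apply: (run_comp (T1 := 3) (T2 := 50 * (size (nb u)).+1 + 8)); last by lia.
      apply: (run_flat (Q := fun s => s = set_reg st' rU u)) => //=.
      by rewrite eh q1.
    move=> _ ->.
    apply: (run_comp (T1 := 3) (T2 := 50 * (size (nb u)).+1 + 4)); last by lia.
      by apply: (run_flat (Q := fun s => s = set_reg (set_reg st' rU u) rH h.+1)) => //=; rewrite /upd /= eh.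
    move=> _ ->.
    apply: (run_comp (T1 := 2) (T2 := 50 * (size (nb u)).+1)); last by lia.
      by apply: (run_flat (Q := fun s => s = st1)).
    move=> _ ->; exact: R.
  - move=> st2 [[q' [S2 cl2]] ag2].
    have eF : arr st2 F = arr st' F.
      case: ag2 => _ -> //; move: nF; rewrite /scratch /= !inE !negb_or.
      by case/and4P=> -> -> -> ->.
    apply: (IH (q ++ q') h.+1) => //.
    + lia.
    + by rewrite size_cat (leq_trans hq) // leq_addr.
    + exact: graph_agree ag2 _ _ _ g1.
    + by move=> j; rewrite eF; exact: hF'.
    + by case: ag2 => hr _; rewrite hr.
    + rewrite takel_cat // et => x; rewrite mem_rcons inE => /predU1P[->//|xh] w wx.
      rewrite eF; case: (cl x xh w wx) => h1; [left|by right].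
      by rewrite mem_cat h1.
    + rewrite takel_cat // et /cost -cats1 big_cat /= big_seq1 -/(cost _).
      move: lT ct'; lia.
  - rewrite /=; lia.
apply: (run_comp (T1 := 2) (T2 := 80 * (m + n.+1) + 10) (Q1 := fun st' => st' = set_reg st rH 0)).
- exact: run_flat.
- move=> _ ->; have ag := agree_set_reg st rH 0.
  apply: (K n.+2 q0 0) => //.
  + by apply: searched_agree ag _ _ _ _ _ _ (searched_init F Q0).
  + by move=> u; rewrite take0.
  + by rewrite take0 /cost big_nil.
- lia.
Qed.

End Sources.
End Search.

Lemma arr_set_arr st a i v b j :
  arr (set_arr st a i v) b j = if (b == a) && (j == i) then v else arr st b j.
Proof. by rewrite /= /upd; case: eqVneq => [->|] //=; case: eqVneq. Qed.

(** Distinctness of the keys [via y] ensures that no later write undoes an earlier one. *)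
Lemma run_walk A st x c : A != aPAR -> A != aVIA -> reg st rC = x ->
  path (fun a b => b == arr st aPAR a) x c -> last x c = reg st rS -> uniq (x :: c) ->
  uniq [seq arr st aVIA y | y <- belast x c] ->
  run (walk A) st (20 * (size c).+1) (fun st' =>
    (forall y, y \in belast x c -> arr st' A (arr st aVIA y) = arr st aPAR y) /\
    (forall w, w \notin [seq arr st aVIA y | y <- belast x c] -> arr st' A w = arr st A w)).
Proof.
move=> nP nV; elim: c st x => [|y c IH] st x ex.
  move=> _ /= el _ _; apply: run_while_false; rewrite /= ?negbK ?ex ?el ?eqxx //.
move=> pc el uc uv; have := pc => /= /andP[/eqP ey pc'].
have nxs : x != reg st rS.
  have := uc; rewrite /= => /andP[+ _]; apply: contraNneq => e.
  by rewrite e -el /= mem_last.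
pose st1 := set_reg (set_arr st A (arr st aVIA x) y) rC y.
have eP : arr st1 aPAR = arr st aPAR by rewrite /= /upd eq_sym (negPf nP).
have eV : arr st1 aVIA = arr st aVIA by rewrite /= /upd eq_sym (negPf nV).
have eA w : arr st1 A w = if w == arr st aVIA x then y else arr st A w.
  by rewrite /= /upd eqxx.
apply: (@run_while_true _ _ _ 9 (20 * (size c).+1) _ (fun s => s = st1)).
- by rewrite /= ex.
- apply: run_flat => //=; rewrite ex -ey; congr set_reg.
  by rewrite /upd eq_sym (negPf nP).
- move=> _ ->; have := IH st1 y erefl; rewrite eP eV => /(_ pc' el).
  have /andP[_ uc'] := uc; have /andP[nin uv'] := uv.
  move=> /(_ uc' uv') R.
  apply: run_weaken R _ _ => // st' [h1 h2]; split.
    move=> z; rewrite inE => /predU1P[->|/h1//].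
    by rewrite h2 // eA eqxx ey.
  move=> w; rewrite inE negb_or => /andP[n1 n2].
  by rewrite h2 // eA (negPf n1).
- by rewrite /=; lia.
Qed.

(** The loop tests for both sources because it is not known which of them the path comes from. *)
Definition trace t lab X L O :=
  Assign rC (Reg t) ;; Assign rN (Num 0) ;; Put L (Reg rC) (Num lab) ;;
  Put O (Reg rC) (Num 0) ;;
  While (TAnd (TNot (TEq (Reg rC) (Reg 1))) (TNot (TEq (Reg rC) (Reg 2))))
    (Assign rC (Get X (Reg rC)) ;; Assign rN (Succ (Reg rN)) ;;
     Put L (Reg rC) (Num lab) ;; Put O (Reg rC) (Reg rN)).

Definition label X L O :=
  For rX (Put L (Reg rX) (Num 0)) ;;
  trace 3 1 X L O ;; Assign rA1 (Reg rC) ;; trace 4 2 X L O ;; Assign rA2 (Reg rC).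

(** * The input digraph and the labelling of a linkage *)

Section Instance.
Variables (D : digraph) (adj : D -> seq D) (s1 s2 t1 t2 : D).
Hypotheses (adjP : adjacency_lists adj) (ust : uniq [:: s1; s2; t1; t2]).
Implicit Types (st : store) (u v w : D) (P Q : dipath D).
Local Notation n := #|D|.
Local Notation m := #|arcs D|.

(** Numbers that code no vertex, in particular the sink [n], get the empty list. *)
Definition nb k : seq nat :=
  if insub k is Some i then map (@code D) (adj (enum_val (i : 'I_n))) else [::].

Lemma nb_code v : nb (code v) = map (@code D) (adj v).
Proof. by rewrite /nb /code valK enum_rankK. Qed.

Lemma code_lt v : code v < n. Proof. exact: ltn_ord. Qed.
Lemma code_inj : injective (@code D).
Proof. by move=> u v /val_inj/enum_rank_inj. Qed.
Lemma codeP k : k < n -> exists v, k = code v.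
Proof. by move=> h; exists (enum_val (Ordinal h)); rewrite /code enum_valK. Qed.
Lemma code_eq u v : (code u == code v) = (u == v).
Proof. exact: (inj_eq code_inj). Qed.

Lemma nb_n : nb n = [::].
Proof. by rewrite /nb insubF // ltnn. Qed.

Lemma nb_lt k (w : nat) : w \in nb k -> w < n.
Proof.
by rewrite /nb; case: insubP => // i _ _ /mapP[v _ ->]; exact: code_lt.
Qed.

Lemma mem_nb u v : (code v \in nb (code u)) = arc u v.
Proof.
by rewrite nb_code (mem_map code_inj); case: (adjP u) => _ ->.
Qed.

Lemma nb_sum : \sum_(k < n) size (nb k) = m.
Proof.
have -> : m = \sum_(u : D) #|[pred v | arc u v]|.
  rewrite -sum1_card (eq_bigl (fun a : D * D => xpredT a.1 && arc a.1 a.2)); last first.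
    by move=> a; rewrite inE.
  rewrite -(pair_big_dep xpredT (fun u v => arc u v) (fun _ _ => 1)) /=.
  by apply: eq_bigr => u _; rewrite sum1_card.
rewrite (reindex (fun u : D => enum_rank u)) /=; last first.
  by exists enum_val => i _; [exact: enum_rankK | exact: enum_valK].
apply: eq_bigr => u _; have [ua ea] := adjP u.
rewrite -[nb _]/(nb (code u)) nb_code size_map -(card_uniqP ua).
by apply: eq_card.
Qed.

Lemma input_nbrs k : k <= n -> nbrs (shunt_input adj s1 s2 t1 t2) k = nb k.
Proof.
move=> kn; rewrite /nbrs -[arr _ 0]/(nth 0 (offsets adj)) -[arr _ 1]/(nth 0 (targets adj)).
have eoff i : i <= n -> nth 0 (offsets adj) i = sumn (take i (outdegrees adj)).
  by move=> h; rewrite (nth_map 0) ?size_iota // nth_iota.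
move: kn; rewrite leq_eqVlt => /predU1P[->|kn].
  (* Offset [n.+1] is past the end of the array and reads as 0, so truncated subtraction leaves the
     sink without neighbours. *)
  rewrite nb_n [nth 0 _ n.+1]nth_default ?sub0n //.
  by rewrite size_map size_iota.
have [v ek] := codeP kn; rewrite {1 2}eoff ?(ltnW kn) // eoff // ek nb_code -ek.
have kE : k < size (enum D) by rewrite -cardE.
have ev : nth v (enum D) k = v by rewrite ek /code nth_enum_rank.
have sd : size (outdegrees adj) = n by rewrite size_map -cardE.
rewrite (take_nth 0) ?sd // sumn_rcons addKn.
have -> : nth 0 (outdegrees adj) k = size (adj v) by rewrite (nth_map v) ?ev.
have -> : sumn (take k (outdegrees adj)) = size (flatten (map adj (take k (enum D)))).
  by rewrite size_flatten /shape -map_take -map_comp.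
have et : targets adj = map (@code D) (flatten (map adj (take k (enum D)))) ++
    map (@code D) (adj v) ++ map (@code D) (flatten (map adj (drop k.+1 (enum D)))).
  rewrite /targets -{1}(cat_take_drop k (enum D)) (drop_nth v) // ev.
  by rewrite map_cat flatten_cat /= !map_cat.
rewrite et; set l0 := flatten (map adj (take k (enum D))).
apply: (@eq_from_nth _ 0); first by rewrite !size_map size_iota.
move=> i; rewrite size_map size_iota => il.
rewrite (nth_map 0) ?size_iota // nth_iota // nth_cat size_map ltnNge leq_addr /=.
by rewrite addKn nth_cat size_map il.
Qed.

Definition env st := [/\ graph n nb st, reg st 1 = code s1, reg st 2 = code s2,
  reg st 3 = code t1 & reg st 4 = code t2].

Lemma env_input : env (shunt_input adj s1 s2 t1 t2).
Proof. by split=> //; split=> // k; exact: input_nbrs. Qed.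

Lemma env_agree rs xs st st' : agree rs xs st st' ->
  all [pred x | x \notin rs] [:: 0; 1; 2; 3; 4] ->
  all [pred x | x \notin xs] [:: 0; 1] -> env st -> env st'.
Proof.
move=> ag /= /and5P[r0 r1 r2 r3 /andP[r4 _]] /and3P[x0 x1 _] [g e1 e2 e3 e4].
by split; first [exact: graph_agree ag _ _ _ g | case: ag => hr _; rewrite hr].
Qed.

(** The paths are named by their targets; which source belongs to which is left open. *)
Definition valid P Q := [/\ disj P Q, tgt P = t1, tgt Q = t2 &
  [set src P; src Q] = [set s1; s2]].

Definition prv (f : nat -> nat) P :=
  forall a b, follows (verts P) a b -> f (code b) = code a.

Definition labels (f : nat -> nat) P Q := forall v, f (code v) =
  if v \in verts P then 1 else if v \in verts Q then 2 else 0.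

Lemma valid_src P Q : valid P Q ->
  (forall v, v \in verts P -> (v == s1) || (v == s2) = (v == src P)) /\
  (forall v, v \in verts Q -> (v == s1) || (v == s2) = (v == src Q)).
Proof.
case=> d _ _ /setP e; split=> v vm; have := e v; rewrite !inE => <-.
  case: (eqVneq v (src Q)) => [ev|]; last by rewrite orbF.
  by rewrite ev in vm; case: (disjF d vm (src_mem Q)).
case: (eqVneq v (src P)) => [ev|//].
by rewrite ev in vm; case: (disjF d (src_mem P) vm).
Qed.

Lemma ix_leq_n P v : v \in verts P -> (ix P v).+1 <= n.
Proof.
move=> vP; apply: (@leq_trans (size (verts P))); first by rewrite /ix index_mem.
by rewrite -(card_uniqP (verts_uniq P)) max_card.
Qed.

Lemma run_trace t lab X L O P st : X != L -> X != O -> L != O ->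
  env st -> reg st t = code (tgt P) -> prv (arr st X) P ->
  (forall v, v \in verts P -> (v == s1) || (v == s2) = (v == src P)) ->
  run (trace t lab X L O) st (40 * n.+1) (fun st' =>
    [/\ reg st' rC = code (src P),
      forall v, v \in verts P -> arr st' L (code v) = lab,
      forall v, v \in verts P -> arr st' O (code v) = ix P (tgt P) - ix P v &
      forall v, v \notin verts P -> arr st' L (code v) = arr st L (code v) /\
        arr st' O (code v) = arr st O (code v)]).
Proof.
clear ust; move=> nXL nXO nLO E et pX hs.
rewrite /trace; set loop := While _ _.
(* Only vertices strictly before [v] are written here: [v] itself was labelled before the loop or in
   the previous round. *)
have K j st' v : v \in verts P -> ix P v = j -> reg st' rC = code v ->
    reg st' 1 = code s1 -> reg st' 2 = code s2 ->
    reg st' rN = ix P (tgt P) - j -> prv (arr st' X) P ->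
    run loop st' (35 * j.+1) (fun st'' => [/\ reg st'' rC = code (src P),
      forall u, u \in verts P -> ix P u < j -> arr st'' L (code u) = lab,
      forall u, u \in verts P -> ix P u < j -> arr st'' O (code u) = ix P (tgt P) - ix P u &
      forall u, ~~ ((u \in verts P) && (ix P u < j)) ->
        arr st'' L (code u) = arr st' L (code u) /\
        arr st'' O (code u) = arr st' O (code u)]).
  elim: j st' v => [|j IH] st' v vP ij ec e1 e2 en pX'.
    have ev : v = src P by apply: (ix_inj vP); rewrite ij ix_src.
    apply: run_while_false => //=.
    - by rewrite ec e1 e2 !code_eq -negb_or negbK hs // ev eqxx.
    - by split=> //; rewrite ec ev.
  have jl : j < size (verts P) by rewrite ltnW // -ij /ix index_mem.
  pose u := nth v (verts P) j.
  have iu : ix P u = j by rewrite /ix index_uniq // verts_uniq.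
  have uP : u \in verts P by exact: mem_nth.
  have fuv : follows (verts P) u v.
    by rewrite /follows vP; apply/eqP; rewrite -!/(ix _ _) iu.
  pose N := (reg st' rN).+1.
  pose st1 := set_arr (set_arr (set_reg (set_reg st' rC (code u)) rN N) L (code u) lab) O (code u) N.
  apply: (@run_while_true _ _ _ 16 (35 * j.+1) _ (fun s => s = st1)).
  - rewrite /= ec e1 e2 !code_eq -negb_or hs //; apply/eqP=> e.
    by move: ij; rewrite e ix_src.
  - by apply: run_flat => //=; rewrite ec (pX' _ _ fuv).
  - move=> _ ->; have eN : N = ix P (tgt P) - j.
      rewrite /N en; have := ix_le_tgt vP; rewrite ij; lia.
    have [|||||st'' [t' [ex lt' [h1 h2 h3 h4]]]] := IH st1 u uP iu.
    + by [].
    + by [].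
    + by [].
    + by rewrite /= {1}/upd /= -eN.
    + move=> a b f; rewrite !arr_set_arr (negPf nXL) (negPf nXO) /=; exact: pX' f.
    exists st'', t'; split=> //; split=> //.
    + move=> z zP; rewrite ltnS leq_eqVlt => /orP[/eqP e|]; last exact: h2.
      have -> : z = u by apply: (ix_inj zP); rewrite e iu.
      have [|-> _] := h4 u; first by rewrite iu ltnn andbF.
      by rewrite !arr_set_arr (negPf nLO) !eqxx.
    + move=> z zP; rewrite ltnS leq_eqVlt => /orP[/eqP e|]; last exact: h3.
      have -> : z = u by apply: (ix_inj zP); rewrite e iu.
      have [|_ ->] := h4 u; first by rewrite iu ltnn andbF.
      by rewrite !arr_set_arr !eqxx iu.
    + move=> z nz; have [|-> ->] := h4 z.
        by apply: contra nz => /andP[-> h]; rewrite ltnS ltnW.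
      have zu : z != u by apply: contraNneq nz => ->; rewrite uP iu ltnSn.
      by rewrite !arr_set_arr !code_eq (negPf zu) !andbF.
  - by rewrite /=; lia.
pose st1 := set_arr (set_arr (set_reg (set_reg st rC (code (tgt P))) rN 0) L (code (tgt P)) lab) O (code (tgt P)) 0.
have [_ e1 e2 _ _] := E.
apply: (@run_comp _ _ _ 2 (35 * n + 15) _ (fun s => s = set_reg st rC (code (tgt P)))); last by lia.
  by apply: run_flat => //=; rewrite et.
move=> _ ->.
apply: (@run_comp _ _ _ 2 (35 * n + 11) _ (fun s => s = set_reg (set_reg st rC (code (tgt P))) rN 0)); last by lia.
  exact: run_flat.
move=> _ ->.
apply: (@run_comp _ _ _ 3 (35 * n + 7) _ (fun s => s = set_arr (set_reg (set_reg st rC (code (tgt P))) rN 0) L (code (tgt P)) lab)); last by lia.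
  exact: run_flat.
move=> _ ->.
apply: (@run_comp _ _ _ 3 (35 * n) _ (fun s => s = st1)); last by lia.
  exact: run_flat.
move=> _ ->.
have [|||||st' [t' [ex lt' [h1 h2 h3 h4]]]] := K (ix P (tgt P)) st1 _ (tgt_mem P) erefl.
- by [].
- by [].
- by [].
- by rewrite subnn.
- by move=> a b f; rewrite !arr_set_arr (negPf nXL) (negPf nXO) /=; exact: pX f.
exists st', t'; split=> //.
  by apply: leq_trans lt' _; rewrite leq_mul2l ix_leq_n ?tgt_mem.
split=> //.
- move=> v vP; have := ix_le_tgt vP; rewrite leq_eqVlt => /orP[/eqP/(ix_inj vP) ->|]; last exact: h2.
  have [|-> _] := h4 (tgt P); first by rewrite ltnn andbF.
  by rewrite !arr_set_arr (negPf nLO) !eqxx.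
- move=> v vP; have := ix_le_tgt vP; rewrite leq_eqVlt => /orP[/eqP/(ix_inj vP) ->|]; last exact: h3.
  have [|_ ->] := h4 (tgt P); first by rewrite ltnn andbF.
  by rewrite !arr_set_arr !eqxx subnn.
- move=> v vP; have [|-> ->] := h4 v; first by rewrite (negPf vP).
  have nv : v != tgt P by apply: contraNneq vP => ->; exact: tgt_mem.
  by rewrite !arr_set_arr !code_eq (negPf nv) !andbF.
Qed.

Lemma run_label X L O P Q st : X != L -> X != O -> L != O -> 1 < L -> 1 < O ->
  env st -> valid P Q -> prv (arr st X) P -> prv (arr st X) Q ->
  run (label X L O) st (100 * n.+1) (fun st' =>
    [/\ labels (arr st' L) P Q, reg st' rA1 = code (src P), reg st' rA2 = code (src Q) &
      (forall v, v \in verts P -> arr st' O (code v) = ix P (tgt P) - ix P v) /\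
      (forall v, v \in verts Q -> arr st' O (code v) = ix Q (tgt Q) - ix Q v)]).
Proof.
clear ust; move=> nXL nXO nLO L1 O1 E V pP pQ; have [hP hQ] := valid_src V; have [d tP tQ _] := V.
have [/proj1 g0 _ _ _ _] := E; rewrite /label.
apply: (@run_comp _ _ _ (12 * n + 8) (80 * n.+1 + 8) _ (fun st' =>
   [/\ env st', arr st' X = arr st X & forall x, x < n -> arr st' L x = 0])); last by lia.
  apply: (@run_for _ _ (fun i st' => forall x, x < i -> arr st' L x = 0) (fun => 4) n) => //=.
  - move=> i st' _ _ ei h; apply: run_flat => //= x; rewrite ltnS leq_eqVlt.
    by rewrite /upd eqxx ei; case: eqVneq => //= _; exact: h.
  - move=> st' ag H; split=> //.
      by apply: env_agree ag _ _ E => //; rewrite /= !inE; case: (L) L1 => [|[]].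
    by case: ag => _ ->; rewrite // inE.
  - by rewrite sum_nat_const card_ord; lia.
move=> sta [Ea eX hL].
have eTP : reg sta 3 = code (tgt P) by rewrite tP; case: Ea.
apply: (run_comp_agree (run_trace 1 nXL nXO nLO Ea eTP _ hP) (T2 := 40 * n.+1 + 7)).
- by rewrite eX.
- move=> stb [c1 c2 c3 c4] ag.
  have Eb : env stb by apply: env_agree ag _ _ Ea => //=; rewrite !inE; case: (L) L1 (O) O1 => [|[|?]] // _ [|[|?]].
  have eXb : arr stb X = arr st X by case: ag => _ -> //; rewrite /= !inE !negb_or nXL nXO.
  have eTQ : reg stb 4 = code (tgt Q) by rewrite tQ; case: Eb.
  apply: (@run_comp _ _ _ 2 (40 * n.+1 + 4) _ (fun s => s = set_reg stb rA1 (code (src P)))); last by lia.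
    by apply: run_flat => //=; rewrite c1.
  move=> _ ->; set stc := set_reg _ _ _.
  have Ec : env stc by apply: env_agree (agree_set_reg _ _ _) _ _ Eb.
  apply: (run_comp_agree (run_trace 2 nXL nXO nLO Ec (eTQ : reg stc 4 = _) _ hQ) (T2 := 2)); last by lia.
    by rewrite /= eXb.
  move=> std [d1 d2 d3 d4] [hr _].
  apply: run_flat => //; split=> /=.
  + move=> v; have [vP|vP] := boolP (v \in verts P).
      by have [|-> _] := d4 v; [rewrite (disjointFr d vP) | exact: c2].
    have [vQ|vQ] := boolP (v \in verts Q); first exact: d2.
    by have [-> _] := d4 v vQ; have [-> _] := c4 v vP; rewrite hL ?code_lt.
  + by rewrite /upd /= hr.
  + by rewrite /upd /= d1.
  split=> v vP; last exact: d3.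
  by have [|_ ->] := d4 v; [rewrite (disjointFr d vP) | exact: c3].
- lia.
Qed.

End Instance.

Lemma uniq_map_inj (T1 T2 : eqType) (f : T1 -> T2) l :
  uniq (map f l) -> {in l &, injective f}.
Proof.
elim: l => //= a l IH /andP[na /IH H] x y; rewrite !inE.
case/predU1P=> [->|xl] /predU1P[->|yl] e //; last exact: H.
  by rewrite e map_f in na.
by rewrite -e map_f in na.
Qed.

Lemma path_map_belast (T : eqType) (f : T -> T) x c :
  path (fun a b => b == f a) x c -> c = map f (belast x c).
Proof. by elim: c x => //= y c IH x /andP[/eqP <- /IH <-]. Qed.

(** * Linkages as matchings *)

Section Matching.
Variables (D : digraph) (adj : D -> seq D) (s1 s2 t1 t2 : D).
Hypotheses (adjP : adjacency_lists adj) (ust : uniq [:: s1; s2; t1; t2]).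
Implicit Types (u v w : D) (P Q X Y : dipath D) (f : nat -> nat) (U : {set D}).
Local Notation n := #|D|.
Local Notation nb := (@nb D adj).
Local Notation S := [set s1; s2].
Local Notation T := [set t1; t2].
Local Notation valid := (valid s1 s2 t1 t2).

Lemma disjST u : u \in S -> u \notin T.
Proof.
move: ust; rewrite /= !inE !negb_or => /and4P[/and3P[_ a b] /andP[c d] _ _].
by case/orP=> /eqP ->; rewrite ?a ?b ?c ?d.
Qed.

Lemma s12 : s1 != s2.
Proof. by move: ust; rewrite /= !inE !negb_or => /andP[/andP[]]. Qed.
Lemma t12 : t1 != t2.
Proof. by move: ust; rewrite /= !inE !negb_or => /and4P[_ _ ? _]. Qed.

(* A linkage from [S] to [T] is a perfect matching between [V \ T] and [V \ S]
   in which the vertices off the paths are matched to themselves; [f w] is the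
   partner of [w], and [n] when [w] is unmatched.  [U] is the set of unmatched
   sources. *)
Record matching f U : Prop := Matching {
  matching_n : f n = n.+1;
  matching_src : forall s, s \in S -> f (code s) = n.+1;
  matching_val : forall w, w \notin S -> f (code w) = n \/
    exists u, [/\ u \notin T, f (code w) = code u & (u == w) || arc u w];
  matching_inj : forall w w', f (code w) = f (code w') -> f (code w) < n -> w = w';
  matching_free : forall u w, u \in U -> f (code w) <> code u;
  matching_card : #|[set w : D | f (code w) == n]| = #|U|
}.

Lemma matching_init f : f n = n.+1 -> (forall w, f (code w) =
    if w \in S then n.+1 else if w \in T then n else code w) -> matching f S.
Proof.
move=> fn fE; have cn w : code w == n = false by rewrite ltn_eqF // code_lt.
split=> //.
- by move=> s sS; rewrite fE sS.
- move=> w /negPf wS; rewrite fE wS; case: (boolP (w \in T)) => wT; first by left.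
  by right; exists w; rewrite eqxx.
- move=> w w'; rewrite !fE; case: (w \in S); first by rewrite ltnNge leqnSn.
  case: (w \in T); first by rewrite ltnn.
  case: (w' \in S) => [e|]; first by rewrite e ltnNge leqnSn.
  by case: (w' \in T) => [e|/code_inj//]; rewrite e ltnn.
- move=> u w uS; rewrite fE; case: (boolP (w \in S)) => [_ e|wS].
    by have := code_lt u; rewrite -e ltnNge leqnSn.
  case: (w \in T) => [e|/code_inj e]; first by have := code_lt u; rewrite -e ltnn.
  by rewrite e uS in wS.
- have -> : [set w : D | f (code w) == n] = T.
    apply/setP=> w; rewrite inE fE; case: (boolP (w \in S)) => [wS|_].
      by rewrite (negPf (disjST wS)) gtn_eqF.
    by case: (w \in T); rewrite ?eqxx ?cn.
  by rewrite !cards2 s12 t12.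
Qed.

Section Augment.
Variables (f : nat -> nat) (U : {set D}) (s : D) (st : store) (F : nat) (q : seq nat).
Hypotheses (M : matching f U) (sU : s \in U) (sS : U \subset S) (ef : arr st F = f).
Hypothesis SE : searched n nb [:: code s] F q st.

Let qn x : x \in q -> x <= n.
Proof. by case: SE => [[_ _ _ /allP h _] _ _]; exact: h. Qed.

(** Apart from the start, a vertex is entered as the partner of some other one, and partners are
    never in [T]. *)
Lemma searched_notT u : code u \in q -> u \notin T.
Proof.
move=> uq; have [_ _ /(_ _ uq)[_]] := SE; rewrite inE code_eq.
have [->|ne] := eqVneq u s; first by move=> _; apply: disjST; exact: subsetP sU.
move=> /(_ isT)[pq vq]; rewrite ef => fv.
have vn : arr st aVIA (code u) < n.
  move: vq; rewrite inE => /predU1P[e|/nb_lt//].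
  have := qn pq; rewrite -e leq_eqVlt => /predU1P[e'|//].
  by have := code_lt u; rewrite -fv e' (matching_n M) ltnNge leqnSn.
have [w ew] := codeP vn; rewrite ew in fv.
have wS : w \notin S.
  by apply/negP=> /(matching_src M) e; have := code_lt u; rewrite -fv e ltnNge leqnSn.
have [e|[u' [uT e _]]] := matching_val M wS.
  by have := code_lt u; rewrite -fv e ltnn.
by have -> : u = u' by apply: code_inj; rewrite -fv.
Qed.

Section Chain.
Variables (c : seq nat) (f' : nat -> nat).
Hypothesis CH : chain [:: code s] (arr st aPAR) q n c.
Hypothesis nq : n \in q.
Local Notation par := (arr st aPAR).
Local Notation via := (arr st aVIA).
Hypothesis f'V : forall y, y \in belast n c -> f' (via y) = par y.
Hypothesis f'N : forall w : nat, w \notin [seq via y | y <- belast n c] -> f' w = f w.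

Lemma chain_mem y : y \in n :: c -> y \in q.
Proof. by case: CH => _ _ _ h _; rewrite inE => /predU1P[->//|/h]. Qed.

Lemma chain_cases y : y \in n :: c -> y = code s \/ y \in belast n c.
Proof.
rewrite lastI mem_rcons inE => /predU1P[->|]; last by right.
by case: CH => _; rewrite inE => /eqP ->; left.
Qed.

(** One step of the alternating path: [w] is matched to [y] and could be matched to [u] instead. *)
Lemma chain_step y : y \in belast n c ->
  exists u w, [/\ par y = code u, via y = code w, f (code w) = y,
    (u == w) || arc u w & code u \in c /\ (u \notin T)].
Proof.
move=> yc; have [c1 c2 c3 c4 c5] := CH.
have yq : y \in q by apply: chain_mem; exact: mem_belast.
have [_ _ /(_ _ yq)[_ /(_ (c5 _ yc))[pq vq fv]]] := SE.
have pc : par y \in c by rewrite (path_map_belast c1) map_f.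
have pn : par y < n.
  rewrite ltn_neqAle qn // andbT; apply: contraTneq pc => ->.
  by move: c3; rewrite /= => /andP[].
have [u eu] := codeP pn; exists u.
have vn : via y < n by move: vq; rewrite inE => /predU1P[->//|/nb_lt].
have [w ew] := codeP vn; exists w; rewrite -ew -eu; split=> //.
- by rewrite -ef.
- move: vq; rewrite ew eu inE code_eq eq_sym => /predU1P[->|]; first by rewrite eqxx.
  by rewrite mem_nb // => ->; rewrite orbT.
- by split=> //; apply: searched_notT; rewrite -eu.
Qed.

Lemma via_notS y w : y \in belast n c -> via y = code w -> w \notin S.
Proof.
move=> yc e; have [u [w' [_ e' fw _ _]]] := chain_step yc.
apply/negP=> /(matching_src M); rewrite -e e' fw => ey.
have := qn (chain_mem (mem_belast yc)); by rewrite ey ltnn.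
Qed.

Lemma par_inj : {in belast n c &, injective par}.
Proof.
case: CH => c1 _ c3 _ _; apply: uniq_map_inj; rewrite -(path_map_belast c1).
by move: c3; rewrite /= => /andP[].
Qed.

Lemma notin_via_sink : n \in belast n c.
Proof.
case: CH => _ + _ _ _; case: (c) => [|a l]; last by rewrite mem_head.
by rewrite /= inE => /eqP e; have := code_lt s; rewrite -e ltnn.
Qed.

(** Along the chain each [w] passes from its old partner [y] to the parent of [y]. Parents are old
    partners of other chain vertices, except for the free source [s], so nothing is matched twice.
    The chain starts at the sink [n], so one unmatched [w] becomes matched. *)
Lemma matching_augment : matching f' (U :\ s).
Proof.
have viaP w : (code w \in [seq via y | y <- belast n c]) -> exists2 y, y \in belast n c & via y = code w.
  by case/mapP=> y yc e; exists y.
have next_via y : y \in belast n c -> par y = code s \/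
    exists w, [/\ f (code w) = par y & code w \in [seq via y | y <- belast n c]].
  move=> yc; have [u [w [eu _ _ _ [uc _]]]] := chain_step yc.
  have [|e|uc'] := @chain_cases (code u); first by rewrite inE uc orbT.
    by left; rewrite eu.
  right; have [_ [w' [_ ev fw _ _]]] := chain_step uc'.
  by exists w'; rewrite eu fw -ev map_f.
split.
- rewrite f'N ?(matching_n M) //; apply/negP=> /mapP[y yc e].
  by have [_ [w [_ ew _ _ _]]] := chain_step yc; have := code_lt w; rewrite -ew -e ltnn.
- move=> v vS; rewrite f'N ?(matching_src M) //; apply/negP=> /viaP[y yc e].
  by have := via_notS yc e; rewrite vS.
- move=> w wS; have [/viaP[y yc e]|nv] := boolP (code w \in [seq via y | y <- belast n c]).
    have [u [w' [eu ew _ a [_ uT]]]] := chain_step yc.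
    right; exists u; rewrite -e f'V //; split=> //.
    by rewrite (_ : w = w') //; apply: code_inj; rewrite -e.
  by rewrite f'N //; exact: (matching_val M).
- have mixed (a b : D) : code a \in [seq via y | y <- belast n c] ->
      code b \notin [seq via y | y <- belast n c] -> f' (code a) = f' (code b) -> False.
    move=> va nb'; have [y yc e] := viaP a va; rewrite -e f'V // f'N //.
    move=> e2; have [es|[w [fw wv]]] := next_via y yc.
      by apply: (matching_free M sU (w := b)); rewrite -e2.
    have eb : b = w.
      apply: (matching_inj M); rewrite -e2 ?fw //.
      by have [u [_ [-> _ _ _ _]]] := chain_step yc; exact: code_lt.
    by rewrite eb wv in nb'.
  move=> a b e lt; have [va|na] := boolP (code a \in [seq via y | y <- belast n c]);
    have [vb|nb'] := boolP (code b \in [seq via y | y <- belast n c]).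
  + have [y yc ey] := viaP _ va; have [z zc ez] := viaP _ vb.
    apply: code_inj; rewrite -ey -ez; congr via; apply: par_inj => //.
    by rewrite -f'V // -f'V // ey ez.
  + by case: (mixed a b va nb' e).
  + by case: (mixed b a vb na (esym e)).
  + by move: e lt; rewrite !f'N //; exact: (matching_inj M).
- move=> u w; rewrite !inE => /andP[us uU].
  have [/viaP[y yc e]|nv] := boolP (code w \in [seq via y | y <- belast n c]).
    rewrite -e f'V // => eu; have [es|[w' [fw _]]] := next_via y yc.
      by case/eqP: us; apply: code_inj; rewrite -eu.
    by apply: (matching_free M uU (w := w')); rewrite fw.
  by rewrite f'N //; exact: (matching_free M uU).
- have [u0 [w0 [e0 ew0 fw0 _ _]]] := chain_step notin_via_sink.
  have -> : [set w : D | f' (code w) == n] = [set w : D | f (code w) == n] :\ w0.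
    apply/setP=> w; rewrite !inE.
    have [/viaP[y yc e]|nv] := boolP (code w \in [seq via y | y <- belast n c]).
      have [u [w' [eu ew fw _ _]]] := chain_step yc.
      rewrite -e f'V // eu ltn_eqF ?code_lt // ew fw; apply/esym/negP=> /andP[/eqP + /eqP ey].
      by apply; apply: code_inj; rewrite -e -ew0 ey.
    rewrite f'N //; case: (eqVneq w w0) => //= ww; case/negP: nv.
    by rewrite ww -ew0 map_f // notin_via_sink.
  have := matching_card M.
  rewrite (cardsD1 w0) inE fw0 eqxx (cardsD1 s U) sU => e; exact: succn_inj e.
Qed.

End Chain.

(** A counting argument: sending [u] to the partner of its image under the perfect matching [g] of
    the linkage maps the reached set [Z] injectively into itself, hence onto itself. But the free
    source [s] is in [Z] and is nobody's partner. *)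
Lemma no_linkage_of_search X Y : {in q, forall u : nat, closed_at n nb F q st u} -> n \notin q ->
  disj X Y -> [set src X; src Y] = S -> [set tgt X; tgt Y] = T -> False.
Proof.
move=> cl nq dXY eS eT.
(* [next] on this list is a permutation fixing all other vertices. Its two steps that follow neither
   path start in [T], where [g] is never applied. *)
pose cyc := verts X ++ verts Y.
have ucyc : uniq cyc.
  rewrite cat_uniq !verts_uniq andbT andTb; apply/hasPn=> z zY; apply/negP=> zX.
  exact: disjF dXY zX zY.
pose g := next cyc.
have gE u : u \in cyc -> g u = nth (src X) (steps X ++ verts Y) (index u cyc).
  by move=> h; rewrite /g next_nth h.
have srcS z : (z \in S) = (z == src X) || (z == src Y) by rewrite -eS !inE.
have tgtT z : (z \in T) = (z == tgt X) || (z == tgt Y) by rewrite -eT !inE.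
have gX u : u \in verts X -> u \notin T -> follows (verts X) u (g u).
  move=> uX; rewrite tgtT negb_or => /andP[ut _].
  have lt : index u (verts X) < size (steps X).
    have := ix_le_tgt uX; rewrite ix_tgt leq_eqVlt => /predU1P[e|//].
    by case/eqP: ut; apply: (ix_inj uX); rewrite ix_tgt.
  rewrite gE ?mem_cat ?uX // /cyc index_cat uX nth_cat lt.
  have := @follows_nth _ (verts X) (src X) _ (verts_uniq X) (lt : (index u (verts X)).+1 < size (verts X)).
  by rewrite nth_index.
have gY u : u \in verts Y -> u \notin T -> follows (verts Y) u (g u).
  move=> uY; rewrite tgtT negb_or => /andP[_ ut].
  have lt : index u (verts Y) < size (steps Y).
    have := ix_le_tgt uY; rewrite ix_tgt leq_eqVlt => /predU1P[e|//].
    by case/eqP: ut; apply: (ix_inj uY); rewrite ix_tgt.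
  have nuX : u \notin verts X by apply/negP=> uX; exact: disjF dXY uX uY.
  rewrite gE ?mem_cat ?uY ?orbT // /cyc index_cat (negPf nuX).
  rewrite nth_cat -[size (verts X)]/(size (steps X)).+1 addSnnS ltnNge leq_addr addKn /=.
  have := @follows_nth _ (verts Y) (src X) _ (verts_uniq Y) (lt : (index u (verts Y)).+1 < size (verts Y)).
  by rewrite nth_index.
have gP u : u \notin T -> g u \notin S /\ ((u == g u) || arc u (g u)).
  move=> uT; have [uX|nX] := boolP (u \in verts X).
    have fo := gX u uX uT; rewrite (follows_arc fo) orbT srcS negb_or; split=> //.
    rewrite (follows_neq_src fo); apply/eqP=> e; have [_ h] := follows_mem fo.
    by apply: (disjF dXY h); rewrite e src_mem.
  have [uY|nY] := boolP (u \in verts Y).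
    have fo := gY u uY uT; rewrite (follows_arc fo) orbT srcS negb_or; split=> //.
    rewrite (follows_neq_src fo) andbT; apply/eqP=> e; have [_ h] := follows_mem fo.
    by apply: (disjF dXY _ h); rewrite e src_mem.
  rewrite /g next_nth mem_cat (negPf nX) (negPf nY) eqxx /=; split=> //.
  by rewrite srcS negb_or; apply/andP; split; [apply: contraNneq nX|apply: contraNneq nY]; move=> ->; rewrite src_mem.
pose h u := odflt u [pick v | f (code (g u)) == code v].
pose Z := [set u : D | code u \in q].
have hZ u : u \in Z -> f (code (g u)) = code (h u) /\ h u \in Z.
  rewrite inE => uq; have uT := searched_notT uq; have [gS ga] := gP u uT.
  have w1 : code (g u) \in code u :: nb (code u).
    by rewrite inE code_eq mem_nb // eq_sym.
  have [fq|e] := cl _ uq _ w1; last first.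
    rewrite ef in e; have [e'|[v [_ e' _]]] := matching_val M gS.
      by have := ltnSn n; rewrite -{2}e e' ltnn.
    by have := code_lt v; rewrite -e' e ltnNge leqnSn.
  rewrite ef in fq; have [e'|[v [_ e' _]]] := matching_val M gS.
    by rewrite e' (negPf nq) in fq.
  rewrite /h; case: pickP => [v' /eqP e2|/(_ v)]; last by rewrite e' eqxx.
  by rewrite e2 /= inE -e2.
have hinj : {in Z &, injective h}.
  move=> u v uZ vZ e; have [eu _] := hZ u uZ; have [ev _] := hZ v vZ.
  apply: (can_inj (prev_next ucyc)); apply: (matching_inj M); rewrite eu ?e ?ev //.
  exact: code_lt.
have sub : h @: Z \subset Z by apply/subsetP=> _ /imsetP[u uZ ->]; case: (hZ u uZ).
have eZ : h @: Z = Z by apply/eqP; rewrite eqEcard sub card_in_imset ?leqnn.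
have : s \in h @: Z.
  by rewrite eZ inE; case: SE => _ h0 _; apply: h0; rewrite mem_head.
case/imsetP=> u uZ es; have [eu _] := hZ u uZ.
by apply: (matching_free M sU (w := g u)); rewrite eu es.
Qed.

End Augment.

(** By injectivity two orbits from the targets can be cancelled step by step. No value of [F]
    outside [S] is in [T], so these orbits neither cycle nor meet before reaching [S], and
    finiteness makes them reach it. Reversed, they are the two paths. *)
Lemma linkage_of_perfect (F : D -> D) :
  (forall w, w \notin S -> F w \notin T /\ ((F w == w) || arc (F w) w)) ->
  {in [predC S] &, injective F} ->
  exists P Q, valid P Q /\
    (forall a b, follows (verts P) a b \/ follows (verts Q) a b -> F b = a).
Proof.
move=> HF inj.
have cancel t t' i d : t \in T -> (forall j, j < i -> iter j F t \notin S) ->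
    (forall j, j < i + d -> iter j F t' \notin S) ->
    iter i F t = iter (i + d) F t' -> d = 0 /\ t = t'.
  elim: i => [|i IH] tT h h'.
    case: d h' => [//|d] h' /= e; have [+ _] := HF _ (h' d (ltnSn _)).
    by rewrite -e tT.
  move=> /= e; apply: IH => // [j lt|j lt|]; [exact/h/ltnW|exact/h'/ltnW|].
  by apply: inj e; rewrite inE; [apply: h | apply: h'; rewrite addSn].
have stop t : t \in T -> exists k, iter k F t \in S.
  move=> tT; suff /existsP[k kS] : [exists k : 'I_n.+1, iter k F t \in S] by exists k.
  have [//|] := boolP [exists k : 'I_n.+1, iter k F t \in S].
  rewrite negb_exists => /forallP h; exfalso.
  have h' j : j < n.+1 -> iter j F t \notin S by move=> lt; exact: (h (Ordinal lt)).
  have : injective (fun k : 'I_n.+1 => iter k F t).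
    have W (i j : 'I_n.+1) : i <= j -> iter i F t = iter j F t -> i = j.
      move=> le e; apply: val_inj => /=.
      have := cancel t t i (j - i) tT; rewrite subnKC // => /(_ _ _ e)[||+ _].
      - by move=> l lt; apply: h'; apply: ltn_trans lt _.
      - by move=> l lt; apply: h'; apply: ltn_trans lt _.
      - by move/eqP; rewrite subn_eq0 => h3; apply/eqP; rewrite eqn_leq le.
    by move=> i j e; case/orP: (leq_total i j) => le; [apply: W|apply/esym/W].
  by move/leq_card; rewrite card_ord ltnn.
have build t : t \in T -> exists P k, [/\ tgt P = t, src P \in S,
    (forall a b, follows (verts P) a b -> F b = a),
    (forall j, j < k -> iter j F t \notin S) &
    (forall v, v \in verts P -> exists2 j, j <= k & v = iter j F t)].
  move=> tT; have [k kS mk] := ex_minnP (stop t tT).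
  have h j : j < k -> iter j F t \notin S by rewrite ltnNge; apply: contra => /mk.
  have inj' i j : i <= j <= k -> iter i F t = iter j F t -> i = j.
    case/andP=> le jk e; have := cancel t t i (j - i) tT; rewrite subnKC //.
    case=> // [l lt|l lt|/eqP + _]; try by apply: h; apply: leq_trans lt _; lia.
    by rewrite subn_eq0 => h3; apply/eqP; rewrite eqn_leq le.
  pose l := traject F t k.+1.
  have el i : i <= k -> nth t l i = iter i F t by move=> ik; exact: nth_traject.
  have ul : uniq l.
    apply/(uniqP t) => i j; rewrite !inE size_traject !ltnS => ik jk; rewrite !el // => e.
    by case/orP: (leq_total i j) => le; [apply: inj'|apply/esym/inj']; rewrite ?le.
  pose e a b := arc a b && (F b == a).
  have pl : path (fun z y => e y z) t (traject F (F t) k).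
    apply/(pathP t)=> i; rewrite size_traject => ik.
    have -> : nth t (traject F (F t) k) i = F (iter i F t) by rewrite (set_nth_default (F t)) ?size_traject // nth_traject // -iterSr.
    rewrite -[t :: _]/l el ?(ltnW ik) // /e eqxx andbT.
    (* A fixed point of [F] would repeat an iterate, so every step is a genuine arc. *)
    have [_ /orP[/eqP e'|//]] := HF _ (h i ik).
    by have := inj' i i.+1; rewrite leqnSn ik => /(_ isT (esym e')) /eqP; rewrite ltn_eqF.
  have pr : path e (last t (traject F (F t) k)) (rev (belast t (traject F (F t) k))).
    by rewrite rev_path.
  have er : last t (traject F (F t) k) :: rev (belast t (traject F (F t) k)) = rev l.
    by rewrite /l /= (lastI t) rev_rcons.
  have [||P eP] := @dipath_of_seq D _ _ (sub_path _ pr).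
  - by move=> a b /andP[].
  - by rewrite er rev_uniq.
  exists P, k; split=> //.
  - by rewrite (verts_tgt eP) -(last_cons t) er /l /= rev_cons last_rcons.
  - rewrite (verts_inj_src eP); have <- : iter k F t = last t (traject F (F t) k).
      by rewrite last_traject.
    by [].
  - by move=> a b; rewrite eP => /(follows_path pr)/andP[_ /eqP].
  - move=> v; rewrite eP er mem_rev => /trajectP[i ik ->]; by exists i.
have [P [k1 [tP sP fP hP mP]]] := build t1 (set21 _ _).
have [Q [k2 [tQ sQ fQ hQ mQ]]] := build t2 (set22 _ _).
have d : disj P Q.
  apply/pred0P=> v /=; apply/negP=> /andP[/mP[i ik ei] /mQ[j jk ej]].
  rewrite ei in ej; have /eqP[] := t12; case/orP: (leq_total i j) => le.
    have := cancel t1 t2 i (j - i) (set21 _ _); rewrite subnKC //.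
    case=> // l lt; [exact: hP (leq_trans lt ik)|exact: hQ (leq_trans lt jk)].
  have := cancel t2 t1 j (i - j) (set22 _ _); rewrite subnKC //.
  case=> // l lt; [exact: hQ (leq_trans lt jk)|exact: hP (leq_trans lt ik)].
exists P, Q; split; last by move=> a b [/fP|/fQ].
split=> //; apply/eqP; rewrite eqEcard; apply/andP; split.
  by apply/subsetP=> z; rewrite !inE => /orP[] /eqP->; [move: sP|move: sQ]; rewrite !inE.
rewrite !cards2 s12 (_ : src P != src Q) //; apply/eqP=> e.
by apply: (disjF d (src_mem P)); rewrite e src_mem.
Qed.

Lemma linkage_of_matching f : matching f set0 ->
  exists P Q, [/\ valid P Q, prv f P & prv f Q].
Proof.
move=> M; pose F w := odflt w [pick u | f (code w) == code u].
have FP w : w \notin S -> [/\ f (code w) = code (F w), F w \notin T & (F w == w) || arc (F w) w].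
  move=> wS; have [e|[u [uT e a]]] := matching_val M wS.
    have := matching_card M; rewrite cards0 => /eqP; rewrite cards_eq0 => /eqP/setP/(_ w).
    by rewrite !inE e eqxx.
  have -> : F w = u; last by [].
  by rewrite /F; case: pickP => [v /eqP|/(_ u)]; rewrite e ?eqxx // => /code_inj.
have [w /FP[]||P [Q [V h]]] := @linkage_of_perfect F; first by [].
  move=> w w' wS w'S e; have [e1 _ _] := FP w wS; have [e2 _ _] := FP w' w'S.
  by apply: (matching_inj M); rewrite e1 ?e2 ?e // code_lt.
have [hP hQ] := valid_src V.
exists P, Q; split=> // a b fo; have [_ bP] := follows_mem fo.
  by have [|-> _ _] := FP b; [rewrite !inE hP // (follows_neq_src fo) | rewrite (h a b) //; left].
by have [|-> _ _] := FP b; [rewrite !inE hQ // (follows_neq_src fo) | rewrite (h a b) //; right].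
Qed.

End Matching.

(** * The subprograms *)

Definition setup :=
  For rX (Put 7 (Reg rX) (Reg rX)) ;; Put 7 (Reg 0) (Succ (Reg 0)) ;;
  Put 7 (Reg 1) (Succ (Reg 0)) ;; Put 7 (Reg 2) (Succ (Reg 0)) ;;
  Put 7 (Reg 3) (Reg 0) ;; Put 7 (Reg 4) (Reg 0).

Definition seek s := clear ;; push (Reg s) ;; search 7.

Definition augment s := Assign rC (Reg 0) ;; Assign rS (Reg s) ;; walk 7.

(** Every vertex not labelled [j] enters itself, which turns the search into plain reachability. *)
Definition block L j :=
  For rX (If (TEq (Get L (Reg rX)) (Num j)) (Put aF (Reg rX) (Succ (Reg 0)))
    (Put aF (Reg rX) (Reg rX))) ;;
  Put aF (Reg 0) (Succ (Reg 0)).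

(** The source of the path is skipped, since every path with the same ends contains it. *)
Definition repl i j a t :=
  If (TAnd (TEq (Get 11 (Reg rOV)) (Num i)) (TNot (TEq (Reg rOV) (Reg a))))
   (block 11 j ;; Put aF (Reg rOV) (Succ (Reg 0)) ;;
    clear ;; push (Reg a) ;; search aF ;;
    If (TEq (Get aSEEN (Reg t)) (Num 0)) Skip
      (Assign rC (Reg t) ;; Assign rS (Reg a) ;; walk 12))
   Skip.

(** The last vertex before path [j] must carry label 0: a single arc between the paths is no
    shunt. *)
Definition probe i j :=
  block 13 j ;; clear ;;
  For rX (If (TEq (Get 13 (Reg rX)) (Num i)) (push (Reg rX)) Skip) ;;
  search aF ;;
  For rX (If (TAnd (TEq (Get 13 (Reg rX)) (Num 0)) (TNot (TEq (Get aSEEN (Reg rX)) (Num 0))))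
    (ForArc rX rI rY (If (TEq (Get 13 (Reg rY)) (Num j)) (Assign rANS (Num 1)) Skip))
    Skip).

Section Procedures.
Variables (D : digraph) (adj : D -> seq D) (s1 s2 t1 t2 : D).
Hypotheses (adjP : adjacency_lists adj) (ust : uniq [:: s1; s2; t1; t2]).
Implicit Types (s t u v w : D) (P Q R X Y : dipath D) (f : nat -> nat) (U : {set D}) (st : store).
Local Notation n := #|D|.
Local Notation m := #|arcs D|.
Local Notation nb := (@nb D adj).
Local Notation S := [set s1; s2].
Local Notation T := [set t1; t2].
Local Notation valid := (valid s1 s2 t1 t2).
Local Notation env := (env adj s1 s2 t1 t2).
Local Notation matching := (matching s1 s2 t1 t2).
Local Notation arc := (@arc D).

Lemma run_setup st : env st ->
  run setup st (12 * n + 40) (fun st' => matching (arr st' 7) S).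
Proof.
move=> E; have [[g0 _] e1 e2 e3 e4] := E; rewrite /setup.
apply: (@run_comp_agree _ _ _ (12 * n + 8) 25 _ (fun st' =>
   forall x, x < n -> arr st' 7 x = x)); last by lia.
  apply: (@run_for _ _ (fun i st' => forall x, x < i -> arr st' 7 x = x) (fun => 4) n) => //=.
  - move=> i st' _ _ ei h; apply: run_flat => //= x; rewrite ltnS leq_eqVlt.
    by rewrite /upd /= ei; case: eqVneq => //= _; exact: h.
  - by rewrite sum_nat_const card_ord; lia.
move=> st' h [hr _]; apply: run_flat => //.
have r0 : reg st' 0 = n by rewrite hr.
have r1 : reg st' 1 = code s1 by rewrite hr.
have r2 : reg st' 2 = code s2 by rewrite hr.
have r3 : reg st' 3 = code t1 by rewrite hr.
have r4 : reg st' 4 = code t2 by rewrite hr.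
have nc u : n == code u = false by rewrite gtn_eqF // code_lt.
apply: matching_init => //=; rewrite /upd /= r0 r1 r2 r3 r4.
  by rewrite !nc eqxx.
move=> w; rewrite !code_eq !inE h ?code_lt // [code w == n]eq_sym nc.
have := disjST ust (u := w); rewrite !inE.
case: (w == s1); case: (w == s2); case: (w == t1); case: (w == t2) => //=;
  by move/(_ isT).
Qed.

Lemma matching_bound f U k : matching f U -> k <= n -> f k <= n.+1.
Proof.
move=> M; rewrite leq_eqVlt => /predU1P[->|/codeP[w ->]]; first by rewrite (matching_n M).
have [/(matching_src M) -> //|wS] := boolP (w \in S).
by have [->//|[u [_ -> _]]] := matching_val M wS; rewrite leqW // ltnW // code_lt.
Qed.

Lemma run_seek st s U i : env st -> matching (arr st 7) U -> reg st i = code s -> i < 5 ->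
  run (seek i) st (200 * (m + n.+2)) (fun st' => exists q,
    searched n nb [:: code s] 7 q st' /\ {in q, forall u : nat, closed_at n nb 7 q st' u}).
Proof.
move=> E M es i5; have [g _ _ _ _] := E; rewrite /seek.
apply: (run_comp_agree (run_clear g) (T2 := 12 + 100 * (m + n.+2))); last by lia.
move=> st1 q1 ag.
have E1 : env st1 by apply: env_agree ag _ _ E.
have es1 : reg st1 i = code s by case: ag => -> //=; case: (i) i5 => [|[|[|[|[|]]]]].
apply: (@run_comp_agree _ _ _ 11 (100 * (m + n.+2)) _ (queue n [:: code s])); last by lia.
  apply: run_flat => //; have := @queue_push n (Reg i) [::] st1 q1.
  by rewrite /= es1; apply; rewrite // ltnW // code_lt.
move=> st2 q2 ag2.
have [g2 _ _ _ _] : env st2 by apply: env_agree ag2 _ _ E1.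
have e7 : arr st2 7 = arr st 7.
  by case: ag2 => _ -> //; case: ag => _ ->.
apply: (run_search (nb_lt (adj := adj)) (nb_n adj) _ g2 _ _ q2) => //.
- by rewrite nb_sum.
- by move=> k kn; rewrite e7; exact: matching_bound M kn.
Qed.

Lemma run_augment st s U q i : env st -> matching (arr st 7) U -> s \in U -> U \subset S ->
  reg st i = code s -> i < 5 -> searched n nb [:: code s] 7 q st -> n \in q ->
  run (augment i) st (20 * n + 60) (fun st' => matching (arr st' 7) (U :\ s)).
Proof.
move=> E M sU sS es i5 SE nq; have [[g0 _] _ _ _ _] := E.
have [[_ _ uq qn _] _ h] := SE; have [[c CH] _] := h n nq.
have [c1 c2 c3 c4 c5] := CH.
pose st1 := set_reg (set_reg st rC n) rS (code s).
rewrite /augment.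
apply: (@run_comp _ _ _ 2 (20 * n + 50) _ (fun st' => st' = set_reg st rC n)); last by lia.
  by apply: run_flat => //=; rewrite g0.
move=> _ ->.
apply: (@run_comp _ _ _ 2 (20 * n + 40) _ (fun st' => st' = st1)); last by lia.
  apply: run_flat => //=; congr set_reg; rewrite -es /upd.
  by case: (i) i5 => [|[|[|[|[|]]]]].
move=> _ ->.
have lastc : last n c = code s by move: c2; rewrite inE => /eqP.
have viainj : uniq [seq arr st aVIA y | y <- belast n c].
  rewrite map_inj_in_uniq; first by have := c3; rewrite lastI rcons_uniq => /andP[].
  move=> y z yc zc e.
  have [_ [w [_ ew fw _ _]]] := chain_step adjP ust M sU sS (erefl (arr st 7)) SE CH nq yc.
  have [_ [w' [_ ew' fw' _ _]]] := chain_step adjP ust M sU sS (erefl (arr st 7)) SE CH nq zc.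
  by rewrite -fw -fw' -ew -ew' e.
have sc : size c <= n.+1.
  rewrite -(size_iota 0 n.+1); apply: uniq_leq_size; first by move: c3 => /= /andP[].
  by move=> x /c4/(allP qn); rewrite mem_iota.
have R := @run_walk 7 st1 n c isT isT erefl c1 lastc c3 viainj.
apply: run_weaken R _ _; first by lia.
move=> st' [h1 h2].
exact: (matching_augment adjP ust M sU sS (erefl (arr st 7)) SE CH nq h1 h2).
Qed.

Lemma run_block L j st : env st -> L != aF ->
  run (block L j) st (20 * n + 20) (fun st' => arr st' aF n = n.+1 /\
    forall w, arr st' aF (code w) = if arr st L (code w) == j then n.+1 else code w).
Proof.
clear ust; move=> [[g0 _] _ _ _ _] LF; rewrite /block.
apply: (@run_comp_agree _ _ _ (20 * n + 10) 5 _ (fun st' => forall x, x < n ->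
    arr st' aF x = if arr st L x == j then n.+1 else x)); last by lia.
  apply: (@run_for _ _ (fun i st' => forall x, x < i ->
      arr st' aF x = if arr st L x == j then n.+1 else x) (fun => 10) n) => //=.
  - move=> i st' _ ag ei h; have eL : arr st' L = arr st L by case: ag => _ -> //; rewrite !inE negb_or LF.
    have r0 : reg st' 0 = n by case: ag => hr _; rewrite hr.
    apply: run_flat => //= x; rewrite ltnS ei eL r0.
    case: ifP => hL /=; rewrite /upd /= leq_eqVlt ?ei ?r0; case: eqVneq => [->|] //=; rewrite ?hL // => _; exact: h.
  - by rewrite sum_nat_const card_ord; lia.
move=> st' h [hr _]; have r0 : reg st' 0 = n by rewrite hr.
apply: run_flat => //=; rewrite /upd /= r0 eqxx; split=> // w.
by rewrite ltn_eqF ?code_lt // h // code_lt.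
Qed.

Lemma dipath_of_chain (par : nat -> nat) s c t :
  path (fun a b => b == par a) (code t) c -> last (code t) c = code s ->
  uniq (code t :: c) ->
  (forall y, y \in belast (code t) c -> exists u w, [/\ y = code w, par y = code u & arc u w]) ->
  exists P, [/\ src P = s, tgt P = t, map (@code D) (verts P) = rev (code t :: c) &
    forall a b, follows (verts P) a b -> par (code b) = code a].
Proof.
elim: c t => [|y c IH] t /=.
  move=> _ /code_inj <- _ _; exists (@Dipath D t [::] (conj isT isT)); split=> //.
  by move=> a b /andP[/=]; rewrite inE => /eqP-> /=; rewrite eqxx.
case/andP=> /eqP ey pc lc /andP[nt uc] H.
have [u [w [/code_inj ew eu a]]] := H (code t) (mem_head _ _).
rewrite -ew in a; rewrite {y}ey eu in pc lc nt uc H *.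
have [|P [sP tP eP fP]] := IH u pc lc uc.
  by move=> y yc; apply: H; rewrite inE yc orbT.
have tnP : t \notin verts P.
  by rewrite -(mem_map (@code_inj D)) eP mem_rev.
have [p1 u1] := dipathP P.
have p' : path arc (src P) (rcons (steps P) t) by rewrite rcons_path p1 -/(tgt P) tP.
have u' : uniq (src P :: rcons (steps P) t) by rewrite -rcons_cons rcons_uniq tnP.
exists (Dipath (conj p' u')); split; first exact: sP.
- by rewrite /tgt /= last_rcons.
- apply: (etrans (map_rcons _ (verts P) t)); by rewrite eP [in RHS]rev_cons.
move=> a' b h; have {h} : follows (rcons (verts P) t) a' b by exact: h.
rewrite /follows mem_rcons inE -cats1 !index_cat.
case/andP=> /predU1P[->|bP].
  have i0 : index t [:: t] = 0 by rewrite /= eqxx.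
  rewrite (negPf tnP) i0 addn0.
  case: (boolP (a' \in verts P)) => [aP /eqP ea|_ /eqP e]; last first.
    by have := leq_addr (index a' [:: t]) (size (verts P)); rewrite -ltnS -e ltnn.
  by have -> // : a' = u; rewrite -tP; apply: (ix_inj aP); rewrite ix_tgt; apply: succn_inj; exact: esym ea.
rewrite bP; case: (boolP (a' \in verts P)) => [aP e|_ /eqP e]; first by apply: fP; rewrite /follows bP.
by have := index_size b (verts P); rewrite e ltnNge leq_addr.
Qed.

End Procedures.

(** * Rerouting around a vertex, and testing a linkage for a shunt *)

Section Tests.
Variables (D : digraph) (adj : D -> seq D) (s1 s2 t1 t2 : D).
Hypotheses (adjP : adjacency_lists adj).
Implicit Types (s t u v w : D) (P Q R X Y : dipath D) (f : nat -> nat) (st : store).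
Local Notation n := #|D|.
Local Notation m := #|arcs D|.
Local Notation nb := (@nb D adj).
Local Notation env := (env adj s1 s2 t1 t2).
Local Notation arc := (@arc D).

Section Searched.
Variables (st : store) (q0 q : seq nat).
Hypothesis SE : searched n nb q0 aF q st.
Hypothesis Fn : arr st aF n = n.+1.
Hypothesis FP : forall w, arr st aF (code w) = code w \/ arr st aF (code w) = n.+1.
Hypothesis q0n : forall x : nat, x \in q0 -> x < n.

(** As [F] only keeps or forbids vertices, a node is entered by looking at that very vertex. *)
Lemma searched_vertex y : y \in q -> y \notin q0 -> exists w,
  [/\ y = code w, arr st aVIA y = y & arr st aF (code w) = code w].
Proof.
move=> yq y0; have [[_ _ _ /allP qn _] _ h] := SE; have [_ /(_ y0)[pq vq fv]] := h y yq.
have yn := qn _ yq.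
have vn : arr st aVIA y <= n.
  by move: vq; rewrite inE => /predU1P[->|/nb_lt/ltnW//]; exact: qn.
move: vn; rewrite leq_eqVlt => /predU1P[e|/codeP[w ew]].
  by move: yn; rewrite -fv e Fn ltnn.
exists w; rewrite ew in fv *; case: (FP w) => e; rewrite e in fv; first by rewrite e -fv.
by rewrite -fv ltnn in yn.
Qed.

Lemma searched_step y : y \in q -> y \notin q0 -> exists u w,
  [/\ y = code w, arr st aPAR y = code u, arr st aVIA y = y,
      arr st aF (code w) = code w & arc u w].
Proof.
move=> yq y0; have [[_ _ _ /allP qn _] _ h] := SE.
have [[c [c1 c2 c3 c4 c5]] /(_ y0)[pq vq fv]] := h y yq.
have [w [ey ev ew]] := searched_vertex yq y0.
have [u eu] : exists u, arr st aPAR y = code u.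
  have [p0|p0] := boolP (arr st aPAR y \in q0); first by have [u ->] := codeP (q0n p0); exists u.
  by have [u [-> _ _]] := searched_vertex pq p0; exists u.
exists u, w; split=> //; move: vq; rewrite ev eu inE => /predU1P[e|]; last by rewrite ey mem_nb.
(* The parent differs from the node, since the chain has no repetition; so the step is an arc. *)
case: c c1 c2 c3 {c4 c5} => [|z c]; first by rewrite /= (negPf y0).
by rewrite /= => /andP[/eqP-> _] _; rewrite eu -e inE eqxx.
Qed.

Lemma searched_from X Y w : (forall v, code v \in q0 -> v \in verts X) ->
  (forall v, v \in verts X -> code v \in q0) ->
  (forall v, v \in verts Y -> arr st aF (code v) = n.+1) ->
  code w \in q -> from X Y w.
Proof.
move=> h0 h1 hY wq; have [_ _ h] := SE; have [[c]] := h _ wq.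
elim: c w wq => [|z c IH] w wq [c1 c2 c3 c4 c5] _; first by apply: from_mem; apply: h0.
have w0 : code w \notin q0 by apply: c5; rewrite /= mem_head.
have [u [w' [/code_inj ew eu _ fw a]]] := searched_step wq w0.
move: c1 => /= /andP[/eqP ez c1]; rewrite eu in ez; rewrite -ew in a fw.
have zq : code u \in q by rewrite -ez; apply: c4; rewrite mem_head.
apply: from_step a _; last first.
  apply/andP; split; first by apply: contra w0; exact: h1.
  by apply/negP=> /hY; rewrite fw => e; have := code_lt w; rewrite e ltnNge leqnSn.
apply: (IH u zq); last by case: (h _ zq).
rewrite -ez; split=> //.
- by have /andP[] := c3.
- by move=> x xc; apply: c4; rewrite inE xc orbT.
- by move=> x xc; apply: c5; rewrite /= inE xc orbT.
Qed.

End Searched.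

Section Avoid.
Variables (X Y : dipath D) (v : D) (st : store) (q : seq nat).
Hypothesis SE : searched n nb [:: code (src X)] aF q st.
Hypothesis Fn : arr st aF n = n.+1.
Hypothesis FE : forall w, arr st aF (code w) = if (w \in verts Y) || (w == v) then n.+1 else code w.
Hypotheses (dXY : disj X Y) (vs : v != src X).

Let FP w : arr st aF (code w) = code w \/ arr st aF (code w) = n.+1.
Proof. by rewrite FE; case: ifP; auto. Qed.
Let q0n (x : nat) : x \in [:: code (src X)] -> x < n.
Proof. by rewrite inE => /eqP->; exact: code_lt. Qed.

Lemma avoid_unreached : {in q, forall u : nat, closed_at n nb aF q st u} ->
  code (tgt X) \notin q -> unavoidable X Y v.
Proof.
move=> cl tq P sP tP d; apply/negPn/negP=> vP.
have sq : code (src P) \in q by rewrite sP; case: SE => _ h _; apply: h; rewrite mem_head.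
have le : ix P (src P) <= ix P (tgt P) by rewrite ix_src.
rewrite -tP in tq.
have [a [b [f aq _ i2 hz]]] := last_switch (U := fun z => code z \in q) (verts_uniq P) (src_mem P) (tgt_mem P) le sq tq.
have [aP bP] := follows_mem f.
have : code b \notin q by apply: hz; rewrite ?leqnn.
have fb : arr st aF (code b) = code b.
  by rewrite FE (disjointFr d bP) /=; case: eqVneq => // e; rewrite -e bP in vP.
have [|h|e] := cl _ aq (code b); first by rewrite inE mem_nb // (follows_arc f) orbT.
  by rewrite fb in h; rewrite h.
by rewrite fb in e; have := code_lt b; rewrite e ltnNge leqnSn.
Qed.

Lemma avoid_reached t : code t \in q -> exists c X',
  [/\ chain [:: code (src X)] (arr st aPAR) q (code t) c,
      {in belast (code t) c, forall y, arr st aVIA y = y},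
      [/\ src X' = src X, tgt X' = t, disj X' Y & v \notin verts X'],
      map (@code D) (verts X') = rev (code t :: c) &
      forall a b, follows (verts X') a b -> arr st aPAR (code b) = code a].
Proof.
move=> tq; have [_ _ h] := SE; have [[c CH] _] := h _ tq; have [c1 c2 c3 c4 c5] := CH.
have cq y : y \in code t :: c -> y \in q by rewrite inE => /predU1P[->//|/c4].
have step y : y \in belast (code t) c -> exists u w,
  [/\ y = code w, arr st aPAR y = code u, arr st aVIA y = y, arr st aF (code w) = code w & arc u w].
  by move=> yc; have yq := cq _ (mem_belast yc); exact: (searched_step SE Fn FP q0n yq (c5 _ yc)).
have [||X' [sX tX eX fX]] := @dipath_of_chain D (arr st aPAR) (src X) c t c1 _ c3.
- by move: c2; rewrite inE => /eqP.
- by move=> y /step[u [w [ey eu _ _ a]]]; exists u, w.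
have allowed w : w \in verts X' -> w = src X \/ arr st aF (code w) = code w.
  rewrite -(mem_map (@code_inj D)) eX mem_rev lastI mem_rcons inE => /predU1P[e|].
    by left; apply: code_inj; rewrite e; move: c2; rewrite inE => /eqP.
  by move/step=> [u [w' [/code_inj <- _ _ fw _]]]; right.
have ok w : w \in verts X' -> (w \notin verts Y) /\ (w != v).
  case/allowed=> [->|]; first by rewrite (disjointFr dXY (src_mem X)) eq_sym.
  rewrite FE; case: ifP => [_ e|/norP[]//].
  by have := code_lt w; rewrite -e ltnNge leqnSn.
exists c, X'; split=> //; first by move=> y /step[? [? []]].
split=> //; first by apply/pred0P=> z /=; apply/negP=> /andP[/ok[/negP]].
by apply/negP=> /ok[_]; rewrite eqxx.
Qed.

End Avoid.

Lemma code_neq w : (code w == n.+1) = false.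
Proof. by rewrite ltn_eqF // leqW // code_lt. Qed.

Definition work_regs := [:: rX; rI; rY; rH; rK; rU; rW; rZ; rC; rS].

Lemma repl_skip i j a (t : nat) st : arr st 11 (reg st rOV) != i ->
  run (repl i j a t) st 20 (fun st' => st' = st).
Proof.
move=> h; apply: (@run_weaken _ _ (tcost (TAnd (TEq (Get 11 (Reg rOV)) (Num i)) (TNot (TEq (Reg rOV) (Reg a)))) + 1).+1 _ (fun st' => st' = st)) => //.
by apply: run_if => [|_]; [rewrite /= (negPf h) | apply: run_flat].
Qed.

Lemma run_repl i j a (t : nat) v X Y st : a \notin work_regs -> t \notin work_regs ->
  env st -> disj X Y -> (forall w, (arr st 11 (code w) == i) = (w \in verts X)) ->
  (forall w, (arr st 11 (code w) == j) = (w \in verts Y)) ->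
  reg st a = code (src X) -> reg st t = code (tgt X) -> reg st rOV = code v ->
  prv (arr st 12) X -> prv (arr st 12) Y -> v \in verts X ->
  run (repl i j a t) st (300 * (m + n.+2)) (fun st' => exists X',
    [/\ src X' = src X, tgt X' = tgt X, disj X' Y, prv (arr st' 12) X' & prv (arr st' 12) Y] /\
    ((X' = X /\ unavoidable X Y v) \/ v \notin verts X')).
Proof.
move=> ha ht E dXY hi hj ea et ev pX pY vX.
apply: (@run_weaken _ _ (tcost (TAnd (TEq (Get 11 (Reg rOV)) (Num i)) (TNot (TEq (Reg rOV) (Reg a)))) + (280 * (m + n.+2))).+1 _ _ _ _ _ (fun st' h => h)); last by rewrite /=; cost D.
apply: run_if => /=; rewrite ev ea hi vX code_eq; last first.
  rewrite negbK => /eqP e; apply: run_skip; last by cost D.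
  exists X; split=> //; left; split=> // P sP _ _.
  by rewrite e -sP src_mem.
move=> /= vs.
have keep rs xs st' st'' : agree rs xs st' st'' -> all (mem work_regs) rs ->
    forall r, r \notin work_regs -> reg st'' r = reg st' r.
  by case=> hr _ /allP sub r hw; apply: hr; apply: contra hw => /sub.
apply: (run_comp_agree (run_block j E (L := 11) isT) (T2 := 260 * (m + n.+2))); last by cost D.
move=> sta [Fna FEa] aga.
have Ea : env sta by apply: env_agree aga _ _ E.
apply: (@run_comp_agree _ _ _ 4 (240 * (m + n.+2)) _ (fun st' => arr st' aF n = n.+1 /\
    forall w, arr st' aF (code w) = if (w \in verts Y) || (w == v) then n.+1 else code w)); last by cost D.
  have [[g0 _] _ _ _ _] := Ea.
  have ova : reg sta rOV = code v by rewrite -ev; case: aga => -> //.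
  apply: run_flat => //=; rewrite /upd /= ova g0; split; first by rewrite gtn_eqF ?code_lt.
  move=> w; rewrite code_eq; case: eqVneq => //= [->|_]; first by rewrite orbT.
  by rewrite orbF FEa hj.
move=> stb [Fnb FEb] agb.
have Eb : env stb by apply: env_agree agb _ _ Ea.
have [gb _ _ _ _] := Eb.
apply: (run_comp_agree (run_clear gb) (T2 := 200 * (m + n.+2))); last by cost D.
move=> stc qc agc.
have Ec : env stc by apply: env_agree agc _ _ Eb.
have eac : reg stc a = code (src X).
  by rewrite (keep _ _ _ _ agc) // (keep _ _ _ _ agb) // (keep _ _ _ _ aga).
apply: (@run_comp_agree _ _ _ 11 (180 * (m + n.+2)) _ (queue n [:: code (src X)])); last by cost D.
  apply: run_flat => //; have := @queue_push n (Reg a) [::] stc qc.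
  by rewrite /= eac; apply; rewrite // ltnW // code_lt.
move=> std qd agd.
have Ed : env std by apply: env_agree agd _ _ Ec.
have [gd _ _ _ _] := Ed.
have eFd : arr std aF = arr stb aF by case: agd => _ -> //; case: agc => _ ->.
have FPd k : k <= n -> arr std aF k <= n.+1.
  rewrite eFd leq_eqVlt => /predU1P[->|/codeP[w ->]]; first by rewrite Fnb.
  by rewrite FEb; case: ifP => // _; rewrite leqW // ltnW // code_lt.
have nbs : \sum_(k < n) size (nb k) <= m by rewrite nb_sum.
apply: (run_comp_agree (@run_search n m nb (@nb_lt D adj) (nb_n adj) nbs _ aF std gd isT FPd qd) (T2 := 60 * (m + n.+2))); last by cost D.
move=> ste [q [SE cl]] age.
have eFe : arr ste aF = arr stb aF by case: age => _ ->.
have Fne : arr ste aF n = n.+1 by rewrite eFe.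
have FEe w : arr ste aF (code w) = if (w \in verts Y) || (w == v) then n.+1 else code w by rewrite eFe.
have e12 : arr ste 12 = arr st 12.
  case: age => _ -> //; case: agd => _ -> //; case: agc => _ -> //.
  by case: agb => _ -> //; case: aga => _ ->.
have keepe r : r \notin work_regs -> reg ste r = reg st r.
  move=> hr; rewrite (keep _ _ _ _ age) // (keep _ _ _ _ agd) // (keep _ _ _ _ agc) //.
  by rewrite (keep _ _ _ _ agb) // (keep _ _ _ _ aga).
have eae : reg ste a = code (src X) by rewrite keepe.
have ete : reg ste t = code (tgt X) by rewrite keepe.
apply: (@run_weaken _ _ (tcost (TEq (Get aSEEN (Reg t)) (Num 0)) + (50 * (m + n.+2))).+1 _ _ _ _ _ (fun st' h => h)); last by rewrite /=; cost D.
have seen : (arr ste aSEEN (code (tgt X)) == 0) = (code (tgt X) \notin q).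
  have [[_ _ _ _ q5] _ _] := SE; have := q5 _ (leqW (ltnW (code_lt (tgt X)))).
  by rewrite code_neq orbF => <-; rewrite negbK.
apply: run_if => /=; rewrite ete seen ?negbK => tq.
  apply: run_skip; last by cost D.
  exists X; rewrite e12; split=> //; left; split=> //.
  exact: avoid_unreached SE FEe cl tq.
have [c [X' [CH viaE [sX tX d nv] eX fX]]] := avoid_reached SE Fne FEe dXY vs tq.
have [c1 c2 c3 c4 c5] := CH.
pose stf := set_reg (set_reg ste rC (code (tgt X))) rS (code (src X)).
apply: (@run_comp _ _ _ 2 (45 * (m + n.+2)) _ (fun st' => st' = set_reg ste rC (code (tgt X)))); last by cost D.
  by apply: run_flat => //=; rewrite ete.
move=> _ ->.
apply: (@run_comp _ _ _ 2 (40 * (m + n.+2)) _ (fun st' => st' = stf)); last by cost D.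
  apply: run_flat => //=; congr set_reg; rewrite -eae /upd.
  by case: eqVneq => // e; rewrite e in ha.
move=> _ ->.
have bl : [seq arr ste aVIA y | y <- belast (code (tgt X)) c] = belast (code (tgt X)) c.
  by rewrite -[RHS]map_id; apply/eq_in_map => y /viaE.
have lastc : last (code (tgt X)) c = code (src X) by move: c2; rewrite inE => /eqP.
have uvia : uniq [seq arr stf aVIA y | y <- belast (code (tgt X)) c].
  by rewrite bl; have := c3; rewrite lastI rcons_uniq => /andP[].
have sc : (size c).+1 <= n.
  have := congr1 size eX; rewrite size_map size_rev => e.
  rewrite -[(size c).+1]/(size (code (tgt X) :: c)) -e.
  by rewrite -(card_uniqP (verts_uniq X')) max_card.
apply: run_weaken (@run_walk 12 stf _ c isT isT erefl c1 lastc c3 uvia) _ _.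
  by apply: (@leq_trans (20 * n)); [rewrite leq_mul2l sc | cost D].
move=> st' [h1 h2]; rewrite bl in h2; exists X'; split; last by right.
split=> //.
- move=> x y f; have [xX yX] := follows_mem f.
  have yb : code y \in belast (code (tgt X)) c.
    have : code y \in rev (code (tgt X) :: c) by rewrite -eX map_f.
    rewrite mem_rev lastI mem_rcons inE lastc => /predU1P[/code_inj e|//].
    by have := follows_neq_src f; rewrite e sX eqxx.
  by have := h1 _ yb; rewrite /= (viaE _ yb) (fX _ _ f).
- move=> x y f; have [_ yY] := follows_mem f.
  rewrite h2; first by rewrite /= e12; exact: pY.
  apply/negP=> /mem_belast yb.
  have : code y \in map (@code D) (verts X') by rewrite eX mem_rev.
  by rewrite (mem_map (@code_inj D)) => yX; exact: disjF d yX yY.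
Qed.

Lemma run_probe i j X Y st : env st -> disj X Y ->
  (forall w, (arr st 13 (code w) == i) = (w \in verts X)) ->
  (forall w, (arr st 13 (code w) == j) = (w \in verts Y)) ->
  (forall w, (arr st 13 (code w) == 0) = off X Y w) ->
  run (probe i j) st (500 * (m + n.+2)) (fun st' =>
    (reg st' rANS != 0) <-> (reg st rANS != 0) \/ exists R, is_shunt X Y R).
Proof.
move=> E dXY hi hj h0; rewrite /probe.
apply: (run_comp_agree (run_block j E (L := 13) isT) (T2 := 450 * (m + n.+2))); last by cost D.
move=> sta [Fna FEa] aga.
have Ea : env sta by apply: env_agree aga _ _ E.
have [ga _ _ _ _] := Ea.
apply: (run_comp_agree (run_clear ga) (T2 := 400 * (m + n.+2))); last by cost D.
move=> stb qb agb.
have Eb : env stb by apply: env_agree agb _ _ Ea.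
have e13b : arr stb 13 = arr st 13 by case: agb => _ -> //; case: aga => _ ->.
have [[g0 _] _ _ _ _] := Eb.
apply: (@run_comp_agree _ _ _ (38 * n + 8) (350 * (m + n.+2)) _ (fun st' =>
   exists q0, [/\ queue n q0 st', forall w, (code w \in q0) = (w \in verts X) &
     forall x : nat, x \in q0 -> x < n])); last by cost D.
  apply: (@run_for _ _ (fun k st' => exists2 q0, queue n q0 st' &
      forall x, (x \in q0) = (x < k) && (arr st 13 x == i)) (fun => 30) n) => //=.
  - by exists [::].
  - move=> k st' kn ag ek [q0 hq eq0].
    have e13 : arr st' 13 = arr st 13 by case: ag => _ ->.
    apply: run_flat => //=; rewrite ek e13; case: ifPn => hk.
      exists (rcons q0 k).
        have := @queue_push n (Reg rX) q0 st' hq; rewrite /= ek; apply=> //; first exact: ltnW.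
        by rewrite eq0 ltnn.
      move=> x; rewrite mem_rcons inE eq0 ltnS [x <= k]leq_eqVlt.
      by case: (eqVneq x k) => //= ->; rewrite hk.
    exists q0 => // x; rewrite eq0 ltnS [x <= k]leq_eqVlt.
    by case: (eqVneq x k) => //= ->; rewrite ltnn (negPf hk).
  - by move=> st' _ [q0 hq eq0]; exists q0; split=> // [w|x]; rewrite eq0 ?code_lt ?hi // => /andP[].
  - by rewrite sum_nat_const card_ord; cost D.
move=> stc [q0 [qc eq0 q0n]] agc.
have Ec : env stc by apply: env_agree agc _ _ Eb.
have [gc _ _ _ _] := Ec.
have eFc : arr stc aF = arr sta aF by case: agc => _ -> //; case: agb => _ ->.
have FPc k : k <= n -> arr stc aF k <= n.+1.
  rewrite eFc leq_eqVlt => /predU1P[->|/codeP[w ->]]; first by rewrite Fna.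
  by rewrite FEa; case: ifP => // _; rewrite leqW // ltnW // code_lt.
have nbs : \sum_(k < n) size (nb k) <= m by rewrite nb_sum.
apply: (run_comp_agree (@run_search n m nb (@nb_lt D adj) (nb_n adj) nbs _ aF stc gc isT FPc qc) (T2 := 200 * (m + n.+2))); last by cost D.
move=> std [q [SE cl]] agd.
have Ed : env std by apply: env_agree agd _ _ Ec.
have [[gd0 gd1] _ _ _ _] := Ed.
have eFd : arr std aF = arr sta aF by case: agd => _ ->.
have FE w : arr std aF (code w) = if w \in verts Y then n.+1 else code w.
  by rewrite eFd FEa hj.
have Fn : arr std aF n = n.+1 by rewrite eFd.
have e13 : arr std 13 = arr st 13 by case: agd => _ -> //; case: agc => _ ->.
have eANS : reg std rANS = reg st rANS.
  case: agd => -> // _; case: agc => -> // _; case: agb => -> // _.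
  by case: aga => ->.
pose hit w := exists y, [/\ off X Y w, code w \in q, arc w y & y \in verts Y].
(* A hit is a bridge. Conversely, the last but one vertex of a shunt is off both paths and is
   reached along the shunt. *)
have hitP : (exists w, hit w) <-> exists R, is_shunt X Y R.
  have FP w : arr std aF (code w) = code w \/ arr std aF (code w) = n.+1.
    by rewrite FE; case: ifP; auto.
  split=> [[w [y [ow wq a yY]]]|[R sh]].
    have fw : from X Y w.
      apply: (searched_from SE Fn FP q0n) wq => [v|v|v vY]; rewrite ?eq0 // FE vY //.
    apply: bridge dXY fw _; apply: to_step (to_mem _ yY) a _.
    by rewrite offC.
  have len := shunt_length sh; rewrite /dilength in len.
  pose w := nth (src R) (verts R) (size (steps R)).-1.
  have fw : follows (verts R) w (tgt R).
    have -> : tgt R = nth (src R) (verts R) (size (steps R)).-1.+1.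
      by rewrite prednK ?(ltnW len) // -ix_tgt nth_index ?tgt_mem.
    by apply: follows_nth (verts_uniq R) _; rewrite prednK ?(ltnW len) //=.
  have [wR _] := follows_mem fw.
  have offI z : z \in verts R -> z != src R -> z != tgt R -> off X Y z.
    move=> zR n1 n2; have zi := mem_interior zR n1 n2; case: sh => _ _ _ _ dX dY.
    by rewrite /off (disjointFl dX zi) (disjointFl dY zi).
  have wsrc : w != src R.
    apply/eqP=> e; have := follows_index fw; rewrite e -!/(ix _ _) ix_src ix_tgt.
    by move=> e'; rewrite e' in len.
  have wt := follows_neq_tgt fw.
  have qs : code (src R) \in q by case: SE => _ sub _; rewrite sub // eq0 (shunt_src sh).
  exists w, (tgt R); split; [exact: offI|..|exact: follows_arc fw|exact: shunt_tgt sh].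
  have [//|nq] := boolP (code w \in q); exfalso.
  have le : ix R (src R) <= ix R w by rewrite ix_src.
  have [a [b [f aq _ i2 hz]]] := last_switch (U := fun z => code z \in q) (verts_uniq R) (src_mem R) wR le qs nq.
  have [aR bR] := follows_mem f.
  have nbq : code b \notin q by apply: hz; rewrite ?leqnn.
  have bt : b != tgt R.
    by apply: contraTneq i2 => ->; rewrite (follows_index fw) ltnn.
  have /andP[_ bY] := offI b bR (follows_neq_src f) bt.
  have fb : arr std aF (code b) = code b by rewrite FE (negPf bY).
  have [|h|e] := cl _ aq (code b); first by rewrite inE mem_nb // (follows_arc f) orbT.
    by rewrite fb in h; rewrite h in nbq.
  by rewrite fb in e; have := code_lt b; rewrite e ltnNge leqnSn.
apply: (@run_for _ _ (fun k st' => (reg st' rANS != 0) <->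
   (reg st rANS != 0) \/ exists2 w, code w < k & hit w) (fun k => 40 * (size (nb k)).+1) n) => //.
- by rewrite eANS; split=> [|[//|[]]]; auto.
- move=> k st' kn ag ek J0.
  have e13' : arr st' 13 = arr st 13 by case: ag => _ ->.
  have eS : arr st' aSEEN = arr std aSEEN by case: ag => _ ->.
  have [w ew] := codeP kn.
  have enb : nbrs st' (reg st' rX) = nb k.
    by rewrite ek -gd1 ?(ltnW kn) // /nbrs; case: ag => _ ha; rewrite !ha.
  have offk : (arr st 13 k == 0) = off X Y w by rewrite ew h0.
  have seen : (arr std aSEEN k != 0) = (code w \in q).
    have [[_ _ _ _ q5] _ _] := SE.
    by rewrite ew (q5 _ (leqW (ltnW (code_lt w)))) code_neq orbF.
  apply: (@run_weaken _ _ (tcost (TAnd (TEq (Get 13 (Reg rX)) (Num 0)) (TNot (TEq (Get aSEEN (Reg rX)) (Num 0)))) + (23 * size (nb k) + 12)).+1 _ _ _ _ _ (fun st' h => h)); last by rewrite /=; lia.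
  have step_w : (exists2 w', code w' < k.+1 & hit w') <->
      (exists2 w', code w' < k & hit w') \/ hit w.
    split=> [[w' + hw']|[[w' lt hw']|hw]].
    - rewrite ltnS leq_eqVlt ew => /predU1P[/code_inj <-|lt]; first by right.
      by left; exists w'.
    - by exists w' => //; exact: ltnW.
    - by exists w; rewrite // ew.
  apply: run_if; rewrite /= ek e13' eS offk seen => hw.
    case/andP: hw => ow wq.
    apply: (@run_forarc _ _ _ _ (fun l st'' => (reg st'' rANS != 0) <->
       ((reg st rANS != 0) \/ exists2 w, code w < k & hit w) \/
       exists2 y, code y \in l & y \in verts Y) 7) => //.
    + by rewrite J0; split=> [|[//|[]]]; auto.
    + move=> l1 y l2 st'' e ag2 ey J2.
      have e13'' : arr st'' 13 = arr st 13 by case: ag2 => _ -> //; rewrite e13'.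
      have yn : y < n by rewrite enb in e; apply: (@nb_lt D adj k); rewrite e mem_cat mem_head orbT.
      have [y' ey'] := codeP yn; move: ey e; rewrite ey' => ey e; apply: run_flat => //=.
      have K : (exists2 z, code z \in rcons l1 (code y') & z \in verts Y) <->
          (exists2 z, code z \in l1 & z \in verts Y) \/ y' \in verts Y.
        split=> [[z + zY]|[[z zl zY]|yY]].
        - rewrite mem_rcons inE => /predU1P[/code_inj <-|zl]; first by right.
          by left; exists z.
        - by exists z; rewrite // mem_rcons inE zl orbT.
        - by exists y'; rewrite // mem_rcons mem_head.
      rewrite ey e13'' hj; case: ifPn => yY /=.
        by split=> // _; right; apply/K; right.
      by rewrite J2 K (negPf yY); split=> [[h|h]|[h|[h|//]]]; auto.
    + move=> st'' _ J2; rewrite J2 enb step_w.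
      have : (exists2 y, code y \in nb k & y \in verts Y) <-> hit w.
        split=> [[y yk yY]|[y [_ _ a yY]]].
          by exists y; split=> //; rewrite ew mem_nb // in yk.
        by exists y => //; rewrite ew mem_nb.
      by tauto.
    + by rewrite enb.
  apply: run_flat => //=; first by lia.
  rewrite J0 step_w; have : ~ hit w; last by tauto.
  by case=> y [ow wq _ _]; rewrite ow wq in hw.
- move=> st' _ ->; rewrite -hitP; split=> [] [h|h]; auto; right.
    by case: h => w _ hw; exists w.
  by case: h => w hw; exists w; rewrite ?code_lt.
- rewrite -big_distrr /=; under eq_bigr do rewrite -addn1.
  rewrite big_split /= sum_nat_const card_ord muln1 nb_sum //; cost D.
Qed.

End Tests.

(** * The main program *)

(** Smaller distance to the end means later on the path. Keeping only the last out-neighbour on the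
    second path loses nothing: a crossing with an earlier head there is also one with this head. *)
Definition find_last_out :=
  If (TEq (Get 8 (Reg rOU)) (Num 1))
    (ForArc rOU rI rY (If (TAnd (TEq (Get 8 (Reg rY)) (Num 2)) (TLt (Get 9 (Reg rY)) (Get 9 (Reg rD))))
       (Assign rD (Reg rY)) Skip))
    Skip.

Definition find_crossing :=
  For rX (ForArc rX rI rY
    (If (TAnd (TAnd (TEq (Get 8 (Reg rX)) (Num 2)) (TLt (Get 9 (Reg rD)) (Get 9 (Reg rX))))
              (TAnd (TEq (Get 8 (Reg rY)) (Num 1)) (TLt (Get 9 (Reg rY)) (Get 9 (Reg rOU)))))
      (Assign rD' (Reg rX) ;; Assign rC' (Reg rY)) Skip)).

Definition copy a b := For rX (Put b (Reg rX) (Get a (Reg rX))).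

(** The value [n] stands for none. Array 9 holds [n] at [n], more than any distance, so every
    candidate for [d] improves on it and no [d'] lies before it. *)
Definition swap :=
  (Assign rD (Reg 0) ;; Assign rD' (Reg 0)) ;;
  find_last_out ;; find_crossing ;; copy 7 10 ;;
  If (TEq (Reg rD') (Reg 0)) Skip
    (Put 10 (Reg rD) (Reg rOU) ;; Put 10 (Reg rC') (Reg rD')).

(** Rerouting works on a fresh copy of the swapped linkage, so the tests at different vertices are
    independent. *)
Definition try_avoid :=
  copy 10 12 ;; (repl 1 2 rA1 3 ;; repl 2 1 rA2 4) ;; label 12 13 14 ;;
  probe 1 2 ;; probe 2 1.

Definition try_swap := swap ;; label 10 11 14 ;; For rOV try_avoid.

(** Register 0 keeps the number of vertices until the end, hence the separate answer register and
    the final copy. *)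
Definition shunt_prog :=
  (Assign rANS (Num 0) ;;
   setup ;; seek 1 ;;
   If (TEq (Get aSEEN (Reg 0)) (Num 0)) Skip
     (augment 1 ;; seek 2 ;;
      If (TEq (Get aSEEN (Reg 0)) (Num 0)) Skip
        (augment 2 ;; label 7 8 9 ;; Put 9 (Reg 0) (Reg 0) ;; For rOU try_swap))) ;;
  Assign 0 (Reg rANS).

Section Main.
Variables (D : digraph) (adj : D -> seq D) (s1 s2 t1 t2 : D).
Hypotheses (adjP : adjacency_lists adj).
Implicit Types (u v w : D) (P Q R X Y : dipath D) (f : nat -> nat) (st : store).
Local Notation n := #|D|.
Local Notation m := #|arcs D|.
Local Notation nb := (@nb D adj).
Local Notation env := (env adj s1 s2 t1 t2).
Local Notation valid := (valid s1 s2 t1 t2).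
Local Notation arc := (@arc D).

Lemma follows_splice P Q A (c d a b : D) : c \in verts P -> d \in verts Q ->
  verts A = take (ix P c).+1 (verts P) ++ drop (ix Q d) (verts Q) ->
  follows (verts A) a b ->
  [\/ follows (verts P) a b /\ ix P b <= ix P c,
      follows (verts Q) a b /\ ix Q d < ix Q b | a = c /\ b = d].
Proof.
move=> cP dQ eA.
pose e a b := [|| follows (verts P) a b && (ix P b <= ix P c),
   follows (verts Q) a b && (ix Q d < ix Q b) | (a == c) && (b == d)].
suff pe : path e (src A) (steps A).
  move/(follows_path pe)=> /or3P[] /andP[h1 h2].
  - by constructor 1.
  - by constructor 2.
  - by constructor 3; rewrite (eqP h1) (eqP h2).
have dsz : ix Q d < size (verts Q) by rewrite /ix index_mem.
have csz : ix P c < size (verts P) by rewrite /ix index_mem.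
have e2 : drop (ix Q d) (verts Q) = d :: drop (ix Q d).+1 (verts Q).
  by rewrite (drop_nth d dsz) nth_index.
have l1l : last (src P) (take (ix P c) (steps P)) = c.
  rewrite -[LHS]/(last (src P) (take (ix P c).+1 (verts P))).
  by rewrite (take_nth (src P) csz) last_rcons nth_index.
have -> : path e (src A) (steps A) = path e (src P) (take (ix P c) (steps P) ++ drop (ix Q d) (verts Q)).
  by move: eA; rewrite /verts /= => -[-> ->].
rewrite cat_path l1l e2 /= {2}/e !eqxx !orbT /=; apply/andP; split.
  apply/(pathP (src P)) => i; rewrite size_take -[size (steps P)]/(size (verts P)).-1 => il.
  have {}il : i < ix P c by move: il; case: ifP => // h; move: csz; lia.
  have f : follows (verts P) (nth (src P) (verts P) i) (nth (src P) (verts P) i.+1).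
    by apply: follows_nth (verts_uniq P) _; apply: leq_ltn_trans csz.
  have -> : nth (src P) (src P :: take (ix P c) (steps P)) i = nth (src P) (verts P) i.
    by rewrite -[_ :: _]/(take (ix P c).+1 (verts P)) nth_take // ltnW.
  rewrite nth_take // -[nth _ (steps P) i]/(nth (src P) (verts P) i.+1).
  have iS : ix P (nth (src P) (verts P) i.+1) = i.+1.
    by apply: index_uniq (verts_uniq P); exact: leq_ltn_trans il csz.
  by rewrite /e f iS il.
apply/(pathP d) => i; rewrite size_drop => il.
have sz : (ix Q d + i).+1 < size (verts Q) by rewrite -addSn -ltn_subRL.
have f := follows_nth d (verts_uniq Q) sz.
have iS : ix Q (nth d (verts Q) (ix Q d + i).+1) = (ix Q d + i).+1.
  exact: index_uniq sz (verts_uniq Q).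
have : e (nth d (verts Q) (ix Q d + i)) (nth d (verts Q) (ix Q d + i).+1).
  by rewrite /e f iS ltnS leq_addr !orbT.
by rewrite -e2 !nth_drop.
Qed.

Lemma prv_swapped P Q A B (c d d' c' : D) f f' : disj P Q ->
  crossing P Q c d d' c' -> swapped P Q c d d' c' A B -> prv f P -> prv f Q ->
  (forall w, f' (code w) = if w == c' then code d' else if w == d then code c else f (code w)) ->
  prv f' A /\ prv f' B.
Proof.
move=> dPQ [[cP c'P dQ d'Q] _ _ lc ld] [eA eB] pP pQ hf.
have dc : d == c' = false by apply/negbTE/eqP=> e; rewrite e in dQ; exact: disjF dPQ c'P dQ.
split=> a b fab.
- case: (follows_splice cP dQ eA fab) => [[fo le]|[fo lt]|[-> ->]].
  + have [_ bP] := follows_mem fo; rewrite hf ifN ?ifN; first exact: pP.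
      by apply/eqP=> e; rewrite e in bP; exact: disjF dPQ bP dQ.
    by apply: contraTneq le => ->; rewrite -ltnNge.
  + have [_ bQ] := follows_mem fo; rewrite hf ifN ?ifN; first exact: pQ.
      by apply: contraTneq lt => ->; rewrite ltnn.
    by apply/eqP=> e; rewrite e in bQ; exact: disjF dPQ c'P bQ.
  + by rewrite hf dc eqxx.
- case: (follows_splice d'Q c'P eB fab) => [[fo le]|[fo lt]|[-> ->]].
  + have [_ bQ] := follows_mem fo; rewrite hf ifN ?ifN; first exact: pQ.
      by apply: contraTneq le => ->; rewrite -ltnNge.
    by apply/eqP=> e; rewrite e in bQ; exact: disjF dPQ c'P bQ.
  + have [_ bP] := follows_mem fo; rewrite hf ifN ?ifN; first exact: pP.
      by apply/eqP=> e; rewrite e in bP; exact: disjF dPQ bP dQ.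
    by apply: contraTneq lt => ->; rewrite ltnn.
  + by rewrite hf eqxx.
Qed.

Lemma run_copy a b st : env st -> a != b ->
  run (copy a b) st (20 * n.+1) (fun st' => forall w, arr st' b (code w) = arr st a (code w)).
Proof.
move=> [[g0 _] _ _ _ _] ab.
apply: (@run_for _ _ (fun i st' => forall x, x < i -> arr st' b x = arr st a x) (fun => 5) n) => //=.
- move=> i st' _ [_ ha] ei h; apply: run_flat => //= x; rewrite ltnS leq_eqVlt.
  rewrite /upd eqxx ei ha ?inE //; case: eqVneq => [->|] //= _; exact: h.
- by move=> st' _ h w; apply: h; exact: code_lt.
- by rewrite sum_nat_const card_ord; cost D.
Qed.

Definition positions f P := forall v, v \in verts P -> f (code v) = ix P (tgt P) - ix P v.

Lemma positions_lt f P u v : positions f P -> u \in verts P -> v \in verts P ->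
  (f (code u) < f (code v)) = (ix P v < ix P u).
Proof. by move=> h uP vP; rewrite !h // ltn_sub2lE // ix_le_tgt. Qed.

Lemma positions_bound f P v : positions f P -> v \in verts P -> f (code v) < n.
Proof.
move=> h vP; rewrite h //; apply: leq_trans (ix_leq_n (tgt_mem P)).
by rewrite ltnS leq_subr.
Qed.

Lemma labels1 f P Q w : labels f P Q -> (f (code w) == 1) = (w \in verts P).
Proof. by move->; case: (w \in verts P) => //; case: (w \in verts Q). Qed.
Lemma labels2 f P Q w : disj P Q -> labels f P Q -> (f (code w) == 2) = (w \in verts Q).
Proof.
move=> d ->; case: (boolP (w \in verts P)) => [wP|_]; first by rewrite (disjointFr d wP).
by case: (w \in verts Q).
Qed.
Lemma labels0 f P Q w : labels f P Q -> (f (code w) == 0) = off P Q w.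
Proof. by move->; rewrite /off; case: (w \in verts P) => //; case: (w \in verts Q). Qed.

Section Base.
Variables (P Q : dipath D).
Hypothesis V : valid P Q.

Let dPQ : disj P Q. Proof. by case: V. Qed.

Definition base st := [/\ labels (arr st 8) P Q, positions (arr st 9) P, positions (arr st 9) Q,
  prv (arr st 7) P /\ prv (arr st 7) Q & arr st 9 n = n].

Lemma run_find_last_out u st : env st -> base st ->
  reg st rOU = code u -> reg st rD = n ->
  run find_last_out st (40 * (m + n.+2)) (fun st' =>
    (reg st' rD = n \/ exists2 d, reg st' rD = code d & [/\ u \in verts P, d \in verts Q & arc u d]) /\
    (u \in verts P -> forall e, e \in verts Q -> arc u e -> arr st 9 (reg st' rD) <= arr st 9 (code e))).
Proof.
move=> E [L pP pQ _ e9] eu eD; have [[_ g] _ _ _ _] := E.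
have enb : nbrs st (reg st rOU) = nb (code u) by rewrite eu g // ltnW // code_lt.
have snb : size (nb (code u)) <= m.
  rewrite -(nb_sum adjP) (bigD1 (enum_rank u)) //=; exact: leq_addr.
apply: (@run_weaken _ _ (tcost (TEq (Get 8 (Reg rOU)) (Num 1)) + (30 * m + 12)).+1 _ _ _ _ _ (fun st' h => h)); last by rewrite /=; cost D.
apply: run_if => /=; rewrite eu (labels1 _ L) => uP.
  apply: (@run_forarc _ _ _ _ (fun l st' =>
    (reg st' rD = n \/ exists2 d, reg st' rD = code d & [/\ u \in verts P, d \in verts Q & arc u d]) /\
    (forall e, e \in verts Q -> code e \in l -> arr st 9 (reg st' rD) <= arr st 9 (code e))) 14) => //.
  - by split; [left|].
  - move=> l1 y l2 st' el [_ ha] ey [J1 J2]; rewrite enb in el.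
    have ynb : y \in nb (code u) by rewrite el mem_cat mem_head orbT.
    have [w ew] := codeP (nb_lt ynb).
    have a : arc u w by rewrite -(mem_nb adjP) -ew.
    apply: run_flat => //=; rewrite !ha // ey ew (labels2 _ dPQ L).
    case: ifPn => [/andP[wQ lt]|].
      split; first by right; exists w; rewrite //= /upd /=.
      move=> e eQ; rewrite mem_rcons inE /= {1}/upd /= => /predU1P[<-//|/(J2 _ eQ)].
      exact/leq_trans/ltnW.
    rewrite negb_and -leqNgt => no; split=> // e eQ; rewrite mem_rcons inE => /predU1P[/code_inj ee|]; last exact: J2.
    by move: no; rewrite -ee eQ.
  - move=> st' _ [J1 J2]; split=> // _ e eQ a; apply: J2 => //.
    by rewrite enb (mem_nb adjP).
  - by rewrite enb leq_add2r leq_mul.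
apply: run_skip; last by cost D.
by split; [left | rewrite (negPf uP)].
Qed.

Lemma run_find_crossing u st : env st -> base st ->
  (forall e, e \in verts Q -> arr st 9 (reg st rD) < arr st 9 (code e) -> reg st rD != n) ->
  reg st rOU = code u -> reg st rD' = n ->
  let hit (d' c' : D) := [/\ d' \in verts Q, c' \in verts P, arc d' c',
     arr st 9 (reg st rD) < arr st 9 (code d') & arr st 9 (code c') < arr st 9 (code u)] in
  run find_crossing st (80 * (m + n.+2)) (fun st' =>
    (reg st' rD' = n /\ forall d' c', ~ hit d' c') \/
    (exists d' c', [/\ reg st' rD' = code d', reg st' rC' = code c' & hit d' c'])).
Proof.
move=> E [L pP pQ _ _] hD eu eD' hit; have [[g0 g] _ _ _ _] := E.
pose found st' := exists d' c', [/\ reg st' rD' = code d', reg st' rC' = code c' & hit d' c'].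
apply: (@run_for _ _ (fun k st' => found st' \/
   reg st' rD' = n /\ forall d' c', code d' < k -> ~ hit d' c') (fun k => 50 * (size (nb k)).+1) n) => //.
- by right.
- move=> k st' kn [hr ha] ek J0; have [w ew] := codeP kn.
  have enb : nbrs st' (reg st' rX) = nb k.
    by rewrite ek -g ?(ltnW kn) // /nbrs !ha.
  apply: (@run_forarc _ _ _ _ (fun l st'' => found st'' \/
     reg st'' rD' = n /\ (forall d' c', code d' < k -> ~ hit d' c') /\
       (forall c', code c' \in l -> ~ hit w c')) 30) => //.
  + by case: J0 => [h|[h1 h2]]; [left|right].
  + move=> l1 y l2 st'' el [hr2 ha2] ey J; rewrite enb in el.
    have ynb : y \in nb k by rewrite el mem_cat mem_head orbT.
    have [c ec] := codeP (nb_lt ynb).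
    have a : arc w c by rewrite -(mem_nb adjP) -ec -ew.
    have r1 : reg st'' rX = code w by rewrite hr2 // ek.
    have r2 : reg st'' rD = reg st rD by rewrite hr2 // hr.
    have r3 : reg st'' rOU = code u by rewrite hr2 // hr.
    apply: run_flat => //=; rewrite !ha2 // !ha // r1 r2 r3 ey ec (labels2 _ dPQ L) (labels1 _ L).
    case: ifPn => [/andP[/andP[wQ lt1] /andP[cP lt2]]|no] /=.
      by left; exists w, c; split=> //; rewrite /= /upd /= ?r1 ?ey ?ec.
    case: J => [h|[h1 [h2 h3]]]; first by left.
    right; split=> //; split=> // c'; rewrite mem_rcons inE => /predU1P[/code_inj ->|]; last exact: h3.
    by case=> h4 h5 h6 h7 h8; rewrite h4 h5 h7 h8 in no.
  + move=> st'' _; rewrite enb => -[h|[h1 [h2 h3]]]; [by left|right; split=> // d' c'].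
    rewrite ltnS leq_eqVlt => /predU1P[e|]; last exact: h2.
    have -> : d' = w by apply: code_inj; rewrite e ew.
    move=> h; apply: (h3 c') => //; rewrite ew (mem_nb adjP); by case: h.
  + by rewrite enb; lia.
- move=> st' _ [h|[h1 h2]]; [by right|left; split=> // d' c'].
  exact: h2 (code_lt d').
- rewrite -big_distrr /=; under eq_bigr do rewrite -addn1.
  by rewrite big_split /= sum_nat_const card_ord muln1 (nb_sum adjP); cost D.
Qed.

(** Paths are named by their targets, which the swap exchanges; so [Q1] takes the place of [A] and
    [P1] that of [B]. *)
Lemma run_swap u st : env st -> base st -> reg st rOU = code u ->
  run swap st (200 * (m + n.+2)) (fun st' => exists P1 Q1,
    [/\ valid P1 Q1, prv (arr st' 10) P1, prv (arr st' 10) Q1 &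
     [/\ P1 = P, Q1 = Q & forall d d' c', ~ crossing P Q u d d' c'] \/
     exists d d' c', crossing P Q u d d' c' /\ swapped P Q u d d' c' Q1 P1]).
Proof.
move=> E B eu; have [[g0 _] _ _ _ _] := E; have [L pP pQ [vP vQ] n9] := B.
pose sta := set_reg (set_reg st rD n) rD' n.
apply: (@run_comp_agree _ _ _ 9 (180 * (m + n.+2)) _ (fun st' => st' = sta)); last by cost D.
  by apply: run_flat => //=; rewrite /upd /= g0.
move=> _ -> aga.
have Ea : env sta by apply: env_agree aga _ _ E.
have Ba : base sta by [].
apply: (run_comp_agree (run_find_last_out Ea Ba (u := u) eu erefl) (T2 := 130 * (m + n.+2))); last by cost D.
move=> stb [b1 b2] agb.
have Eb : env stb by apply: env_agree agb _ _ Ea.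
have e9 : arr stb 9 = arr sta 9 by case: agb => _ ->.
have e8 : arr stb 8 = arr st 8 by case: agb => _ ->.
have e7 : arr stb 7 = arr st 7 by case: agb => _ ->.
have Bb : base stb by rewrite /base e9 e8 e7.
have eub : reg stb rOU = code u by case: agb => ->.
have eD'b : reg stb rD' = n by case: agb => ->.
have posn e : e \in verts Q -> arr stb 9 n < arr stb 9 (code e) -> False.
  rewrite e9 n9 => eQ; rewrite ltnNge => /negP; apply.
  exact: ltnW (positions_bound pQ eQ).
have hD e : e \in verts Q -> arr stb 9 (reg stb rD) < arr stb 9 (code e) -> reg stb rD != n.
  by move=> eQ; apply: contraTneq => ->; apply/negP=> /(posn _ eQ).
apply: (run_comp_agree (run_find_crossing Eb Bb hD eub eD'b) (T2 := 40 * (m + n.+2))); last by cost D.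
move=> stc C agc.
have Ec : env stc by apply: env_agree agc _ _ Eb.
apply: (run_comp_agree (run_copy Ec (a := 7) (b := 10) isT) (T2 := 15)); last by cost D.
move=> std d1 agd; have Ed : env std by apply: env_agree agd _ _ Ec.
have [[gd0 _] _ _ _ _] := Ed.
have e7c : arr stc 7 = arr st 7 by case: agc => _ ->; rewrite // e7.
have eD'd : reg std rD' = reg stc rD' by case: agd => ->.
have eC'd : reg std rC' = reg stc rC' by case: agd => ->.
have eDd : reg std rD = reg stb rD by case: agd => -> // _; case: agc => ->.
have eud : reg std rOU = code u by case: agd => -> // _; case: agc => ->.
apply: run_flat => //=; rewrite eD'd gd0.
case: C => [[-> noc]|[d' [c' [ed' ec' [d'Q c'P adc lt1 lt2]]]]].
  rewrite eqxx; exists P, Q; split=> //.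
  - by move=> a b f; rewrite d1 e7c; exact: vP f.
  - by move=> a b f; rewrite d1 e7c; exact: vQ f.
  (* A crossing with any head [d] would also have passed the test with the last out-neighbour, whose
     distance is no larger. *)
  left; split=> // d d' c' [[uP c'P dQ d'Q] aud adc lc ld]; apply: (noc d' c'); split=> //.
    apply: leq_ltn_trans (_ : _ <= arr sta 9 (code d)) _; first by rewrite e9; exact: b2.
    by rewrite e9 (positions_lt pQ).
  by rewrite e9 (positions_lt pP).
rewrite ed' ltn_eqF ?code_lt //=.
have [eDn|[d ed [uP dQ aud]]] := b1; first by case: (posn d'); rewrite // -{1}eDn.
have k : crossing P Q u d d' c'.
  split=> //; first by rewrite -(positions_lt pP) // -e9.
  by rewrite -(positions_lt pQ) // -e9 -ed.
have [A [B' [sw dAB sA sB [tA tB]]]] := swapped_exists dPQ k.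
have [_ tP tQ eS] := V.
exists B', A.
have [|vA vB] := prv_swapped (f' := fun x => if x == code c' then code d' else
   if x == code d then code u else arr std 10 x) dPQ k sw vP vQ.
  by move=> w; rewrite !code_eq d1 e7c.
set g := upd (upd _ _ _) 10 _ 10.
have h x : g x = if x == code c' then code d' else if x == code d then code u else arr std 10 x.
  by rewrite /g /upd /= eDd ed eud eC'd ec'.
split.
- by split; rewrite ?tA ?tB ?sA ?sB // ?[_ B' A]disjC // -eS setUC.
- by move=> a b f; rewrite -(vB a b f); exact: h.
- by move=> a b f; rewrite -(vA a b f); exact: h.
by right; exists d, d', c'.
Qed.

End Base.

End Main.

(** * Correctness and running time of the whole program *)

Section Total.
Variables (D : digraph) (adj : D -> seq D) (s1 s2 t1 t2 : D).
Hypotheses (adjP : adjacency_lists adj).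
Implicit Types (u v w : D) (P Q R X Y : dipath D) (f : nat -> nat) (st : store).
Local Notation n := #|D|.
Local Notation m := #|arcs D|.
Local Notation nb := (@nb D adj).
Local Notation env := (env adj s1 s2 t1 t2).
Local Notation valid := (valid s1 s2 t1 t2).
Local Notation base P Q := (@base D P Q).
Local Notation arc := (@arc D).
Local Notation answer := (contains_shunt [set s1; s2] [set t1; t2]).

Lemma shunt_answer P Q R : valid P Q -> is_shunt P Q R \/ is_shunt Q P R -> answer.
Proof.
case=> _ tP tQ eS [sh|sh]; [exists P, Q, R|exists Q, P, R]; rewrite tP tQ -eS; split=> //.
  by rewrite setUC.
by rewrite setUC.
Qed.

(* The outcome of trying to reroute a path of the linkage [P], [Q] around [v]. *)
Definition rerouted P Q v P' Q' :=
  [/\ valid P' Q', src P' = src P, src Q' = src Q,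
      v \in verts P -> Q' = Q /\ ((P' = P /\ unavoidable P Q v) \/ v \notin verts P') &
      v \in verts Q -> P' = P /\ ((Q' = Q /\ unavoidable Q P v) \/ v \notin verts Q')].

Lemma run_reroute P Q v st : env st -> valid P Q -> labels (arr st 11) P Q ->
  reg st rA1 = code (src P) -> reg st rA2 = code (src Q) -> reg st rOV = code v ->
  prv (arr st 12) P -> prv (arr st 12) Q ->
  run (repl 1 2 rA1 3 ;; repl 2 1 rA2 4) st (700 * (m + n.+2)) (fun st' => exists P' Q',
    [/\ rerouted P Q v P' Q', prv (arr st' 12) P' & prv (arr st' 12) Q']).
Proof.
move=> E V L a1 a2 ev vP vQ; have [dPQ tP tQ eS] := V; have [_ _ _ r3 r4] := E.
have dQP : disj Q P by rewrite disjC.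
have l1 w := labels1 w L; have l2 w := labels2 w dPQ L.
have [inP|nP] := boolP (v \in verts P).
  have nQ : v \notin verts Q by apply/negP=> h; exact: disjF dPQ inP h.
  have e3 : reg st 3 = code (tgt P) by rewrite tP.
  apply: (run_comp_agree (run_repl adjP (a := rA1) (t := 3) isT isT E dPQ l1 l2 a1 e3 ev vP vQ inP) (T2 := 20)); last by cost D.
  move=> st1 [P' [[sP' tP' d' vP' vQ'] alt]] [hr ha].
  apply: run_weaken (repl_skip _ _ _ _) (leqnn _) _.
    by rewrite hr // ha // ev l2.
  move=> _ ->; exists P', Q; split=> //; split=> //.
  - by split; rewrite // ?tP' // sP'.
  - by rewrite (negPf nQ).
have nL1 : arr st 11 (reg st rOV) != 1 by rewrite ev l1.
have [inQ|nQ] := boolP (v \in verts Q).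
  have e4 : reg st 4 = code (tgt Q) by rewrite tQ.
  apply: (run_comp (repl_skip 2 rA1 3 nL1) (T2 := 300 * (m + n.+2))); last by cost D.
  move=> _ ->.
  apply: run_weaken (run_repl adjP (a := rA2) (t := 4) isT isT E dQP l2 l1 a2 e4 ev vQ vP inQ) (leqnn _) _.
  move=> st1 [Q' [[sQ' tQ' d' vQ' vP'] alt]].
  exists P, Q'; split=> //; split=> //; last by rewrite (negPf nP).
  by split; rewrite // ?tQ' // ?sQ' // disjC.
have nL2 : arr st 11 (reg st rOV) != 2 by rewrite ev l2.
apply: (run_comp (repl_skip 2 rA1 3 nL1) (T2 := 20)); last by cost D.
move=> _ ->; apply: run_weaken (repl_skip 1 rA2 4 nL2) (leqnn _) _ => _ ->.
by exists P, Q; split=> //; split=> //; [rewrite (negPf nP)|rewrite (negPf nQ)].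
Qed.

Lemma run_try_avoid P Q v st : env st -> valid P Q -> labels (arr st 11) P Q ->
  reg st rA1 = code (src P) -> reg st rA2 = code (src Q) -> reg st rOV = code v ->
  prv (arr st 10) P -> prv (arr st 10) Q ->
  run try_avoid st (2000 * (m + n.+2)) (fun st' =>
    [/\ reg st' rA1 = code (src P), reg st' rA2 = code (src Q) &
     exists P' Q', rerouted P Q v P' Q' /\
      ((reg st' rANS != 0) <-> (reg st rANS != 0) \/
         exists R, is_shunt P' Q' R \/ is_shunt Q' P' R)]).
Proof.
move=> E V L a1 a2 ev vP vQ; rewrite /try_avoid.
apply: (run_comp_agree (run_copy E (a := 10) (b := 12) isT) (T2 := 1950 * (m + n.+2))); last by cost D.
move=> sta ca aga.
have Ea : env sta by apply: env_agree aga _ _ E.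
have La : labels (arr sta 11) P Q by case: aga => _ ->.
have a1a : reg sta rA1 = code (src P) by case: aga => ->.
have a2a : reg sta rA2 = code (src Q) by case: aga => ->.
have eva : reg sta rOV = code v by case: aga => ->.
have vPa : prv (arr sta 12) P by move=> a b f; rewrite ca; exact: vP f.
have vQa : prv (arr sta 12) Q by move=> a b f; rewrite ca; exact: vQ f.
apply: (run_comp_agree (run_reroute Ea V La a1a a2a eva vPa vQa) (T2 := 1200 * (m + n.+2))); last by cost D.
move=> stb [P' [Q' [RR vP' vQ']]] agb.
have Eb : env stb by apply: env_agree agb _ _ Ea.
have [V' sP' sQ' _ _] := RR; have [d' _ _ _] := V'.
apply: (run_comp_agree (@run_label D adj s1 s2 t1 t2 12 13 14 P' Q' stb isT isT isT isT isT Eb V' vP' vQ') (T2 := 1050 * (m + n.+2))); last by cost D.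
move=> stc [Lc a1c a2c _] agc.
have Ec : env stc by apply: env_agree agc _ _ Eb.
have l1 w := labels1 w Lc; have l2 w := labels2 w d' Lc; have l0 w := labels0 w Lc.
apply: (run_comp_agree (run_probe adjP Ec d' l1 l2 l0) (T2 := 520 * (m + n.+2))); last by cost D.
move=> std ANSd agd.
have Ed : env std by apply: env_agree agd _ _ Ec.
have e13 : arr std 13 = arr stc 13 by case: agd => _ ->.
have dQP' : disj Q' P' by rewrite disjC.
apply: run_weaken (run_agree (run_probe adjP Ed dQP' (i := 2) (j := 1) _ _ _)) _ _.
- by move=> w; rewrite e13.
- by move=> w; rewrite e13.
- by move=> w; rewrite e13 l0 offC.
- by cost D.
move=> ste [ANSe [hre _]]; split.
- by rewrite hre //; case: agd => -> //; rewrite a1c sP'.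
- by rewrite hre //; case: agd => -> //; rewrite a2c sQ'.
exists P', Q'; split=> //; rewrite ANSe ANSd.
have -> : reg stc rANS = reg st rANS.
  by case: agc => -> // _; case: agb => -> // _; case: aga => ->.
split=> [[[h|[R h]]|[R h]]|[h|[R [h|h]]]].
- by left.
- by right; exists R; left.
- by right; exists R; right.
- by left; left.
- by left; right; exists R.
- by right; exists R.
Qed.

Lemma tight_of_rerouted P Q : valid P Q ->
  (forall v, exists P' Q', rerouted P Q v P' Q' /\ shuntless P' Q') -> tight P Q.
Proof.
move=> V H; have [dPQ tP tQ eS] := V; have dQP : disj Q P by rewrite disjC.
have sl : shuntless P Q.
  (* The target of [P] cannot be bypassed, so the pair tested there is [P], [Q] itself. *)
  have [P' [Q' [[[_ tP' _ _] _ _ hP _] sl]]] := H (tgt P).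
  have [eQ [[eP _]|]] := hP (tgt_mem P); first by rewrite eQ eP in sl.
  by rewrite tP -tP' tgt_mem.
apply: tight_of_checked => // v vm; have [P' [Q' [[V' sP' sQ' hP hQ] sl']]] := H v;
  have [d' tP' tQ' _] := V'.
- have [eQ [[_ u]|nv]] := hP vm; [by left|right; exists P'].
  by split; rewrite ?tP ?tP' // -eQ.
- have [eP [[_ u]|nv]] := hQ vm; [by left|right; exists Q'].
  split; rewrite ?tQ ?tQ' // -eP; first by rewrite disjC.
  exact: shuntlessC.
Qed.

(** The outcomes are asymmetric: a nonzero register already witnesses a shunt of some linkage, while
    zero means that the test failed at every [v], which gives tightness. *)
Lemma run_sweep P Q st : env st -> valid P Q -> labels (arr st 11) P Q ->
  reg st rA1 = code (src P) -> reg st rA2 = code (src Q) ->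
  prv (arr st 10) P -> prv (arr st 10) Q -> (reg st rANS != 0 -> answer) ->
  run (For rOV try_avoid) st (2100 * (n.+1 * (m + n.+2))) (fun st' =>
    (reg st' rANS != 0 -> answer) /\ (reg st' rANS == 0 -> tight P Q /\ reg st rANS == 0)).
Proof.
move=> E V L a1 a2 vP vQ A0; have [[g0 _] _ _ _ _] := E.
apply: (@run_for _ _ (fun k st' => [/\ reg st' rA1 = code (src P),
   reg st' rA2 = code (src Q), reg st' rANS != 0 -> answer &
   reg st' rANS == 0 -> reg st rANS == 0 /\ forall v, code v < k ->
      exists P' Q', rerouted P Q v P' Q' /\ shuntless P' Q']) (fun => 2000 * (m + n.+2)) n) => //.
- move=> k st' kn ag ek [b1 b2 A1 A2]; have [v kv] := codeP kn; rewrite kv in ek.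
  have E' : env st' by apply: env_agree ag _ _ E.
  have L' : labels (arr st' 11) P Q by case: ag => _ ->.
  have vP' : prv (arr st' 10) P by case: ag => _ ->.
  have vQ' : prv (arr st' 10) Q by case: ag => _ ->.
  apply: run_weaken (run_try_avoid E' V L' b1 b2 ek vP' vQ') (leqnn _) _.
  move=> st2 [c1 c2 [P' [Q' [RR ANS]]]]; split=> //.
    case/ANS=> [/A1//|[R h]]; case: RR => V' _ _ _ _; exact: shunt_answer V' h.
  move=> z; have z' : reg st' rANS == 0.
    by apply/negPn/negP=> nz; have : reg st2 rANS != 0 by [apply/ANS; left]; rewrite z.
  have [z0 hv] := A2 z'; split=> // w; rewrite ltnS leq_eqVlt kv => /predU1P[/code_inj->|]; last first.
    by rewrite -kv; exact: hv.
  exists P', Q'; split=> // R; split=> h;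
    (have : reg st2 rANS != 0 by apply/ANS; right; exists R; auto); by rewrite z.
- move=> st' _ [_ _ A1 A2]; split=> // z; have [z0 h] := A2 z; split=> //.
  apply: tight_of_rerouted => // v; exact: h (code_lt v).
- rewrite sum_nat_const card_ord; move: (#|D|) (#|arcs D|) => a b; nia.
Qed.

Lemma run_try_swap P Q u st : env st -> valid P Q -> base P Q st -> reg st rOU = code u ->
  (reg st rANS != 0 -> answer) ->
  run try_swap st (2500 * (n.+1 * (m + n.+2))) (fun st' =>
    (reg st' rANS != 0 -> answer) /\ (reg st' rANS == 0 -> reg st rANS == 0 /\
      exists P' Q', tight P' Q' /\
        ([/\ P' = P, Q' = Q & forall d d' c', ~ crossing P Q u d d' c'] \/
         exists d d' c', crossing P Q u d d' c' /\ swapped P Q u d d' c' Q' P'))).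
Proof.
move=> E V B eu A0; rewrite /try_swap.
apply: (run_comp_agree (run_swap adjP V E B eu) (T2 := 2250 * (n.+1 * (m + n.+2)))); last first.
  by move: (#|D|) (#|arcs D|) => a b; nia.
move=> sta [P' [Q' [V' vP vQ alt]]] aga.
have Ea : env sta by apply: env_agree aga _ _ E.
apply: (run_comp_agree (@run_label D adj s1 s2 t1 t2 10 11 14 P' Q' sta isT isT isT isT isT Ea V' vP vQ) (T2 := 2100 * (n.+1 * (m + n.+2)))); last first.
  by move: (#|D|) (#|arcs D|) => a b; nia.
move=> stb [Lb a1 a2 _] agb.
have Eb : env stb by apply: env_agree agb _ _ Ea.
have e10 : arr stb 10 = arr sta 10 by case: agb => _ ->.
have eA : reg stb rANS = reg st rANS by case: agb => -> // _; case: aga => ->.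
rewrite -eA in A0 *.
apply: run_weaken (run_sweep Eb V' Lb a1 a2 _ _ A0) (leqnn _) _; rewrite ?e10 //.
move=> st' [h1 h2]; split=> // z; have [t z0] := h2 z; split=> //.
by exists P', Q'.
Qed.

Lemma run_swaps P Q st : env st -> valid P Q -> base P Q st -> reg st rANS = 0 ->
  run (For rOU try_swap) st (2600 * (n.+1 * (n.+1 * (m + n.+2)))) (fun st' =>
    (reg st' rANS != 0) <-> answer).
Proof.
move=> E V B A0; have [[g0 _] _ _ _ _] := E; have [dPQ tP tQ eS] := V.
apply: (@run_for _ _ (fun k st' => (reg st' rANS != 0 -> answer) /\
   (reg st' rANS == 0 -> forall u, code u < k ->
      exists P' Q', tight P' Q' /\
        ([/\ P' = P, Q' = Q & forall d d' c', ~ crossing P Q u d d' c'] \/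
         exists d d' c', crossing P Q u d d' c' /\ swapped P Q u d d' c' Q' P')))
   (fun => 2500 * (n.+1 * (m + n.+2))) n) => //.
- by rewrite A0.
- move=> k st' kn ag ek [A1 A2]; have [u ku] := codeP kn; rewrite ku in ek.
  have E' : env st' by apply: env_agree ag _ _ E.
  have B' : base P Q st' by case: ag => _ ha; case: B => *; split; rewrite ha.
  apply: run_weaken (run_try_swap E' V B' ek A1) (leqnn _) _.
  move=> st2 [h1 h2]; split=> // z w; have [z0 h] := h2 z.
  rewrite ltnS leq_eqVlt ku => /predU1P[/code_inj->//|]; rewrite -ku; exact: A2.
- move=> st' _ [h1 h2]; split=> // ans; apply/negP=> z.
  have {}h2 u := h2 z u (code_lt u).
  (* No crossing starts at the target of [P], so for that vertex the base pair itself was swept. *)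
  have tPQ : tight P Q.
    have [P' [Q' [t [[<- <- _] //|[d [d' [c' [[[_ c'P _ _] _ _ lt _] _]]]]]]]] := h2 (tgt P).
    by have := ix_le_tgt c'P; rewrite leqNgt lt.
  have rg : rigid P Q.
    apply: rigid_of_swapped => // c cP [e [e' [f k]]].
    have [P' [Q' [t [[_ _ no]|[d [d' [c' [k' sw]]]]]]]] := h2 c; first by case: (no e e' f).
    by exists d, d', c', Q', P'; split=> //; exact: tightC.
  by apply: (no_shunt tPQ rg _ _ ans); rewrite ?eS ?tP ?tQ.
- rewrite sum_nat_const card_ord; move: (#|D|) (#|arcs D|) => a b; nia.
Qed.

Hypothesis ust : uniq [:: s1; s2; t1; t2].

Lemma run_seek_answer st s U i : env st -> matching s1 s2 t1 t2 (arr st 7) U -> s \in U ->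
  U \subset [set s1; s2] -> reg st i = code s -> i < 5 ->
  run (seek i) st (200 * (m + n.+2)) (fun st' => [/\ env st',
    matching s1 s2 t1 t2 (arr st' 7) U, reg st' rANS = reg st rANS &
    if arr st' aSEEN n == 0 then ~ answer else exists q, searched n nb [:: code s] 7 q st' /\ n \in q]).
Proof.
move=> E M sU US es i5; apply: run_weaken (run_agree (run_seek adjP ust E M es i5)) (leqnn _) _.
move=> st' [[q [SE cl]] ag].
have E' : env st' by apply: env_agree ag _ _ E.
have e7 : arr st' 7 = arr st 7 by case: ag => _ ->.
have M' : matching s1 s2 t1 t2 (arr st' 7) U by rewrite e7.
split=> //; first by case: ag => ->.
have sn : (arr st' aSEEN n == 0) = (n \notin q).
  have [[_ _ _ _ q5] _ _] := SE; have := q5 n (leqnSn n).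
  by rewrite [n == _]ltn_eqF // orbF => <-; rewrite negbK.
rewrite sn; case: ifPn => [nq|/negPn nq]; last by exists q.
move=> [X [Y [R [sh eS eT]]]].
exact: (no_linkage_of_search adjP ust M' sU US (erefl _) SE cl nq (shunt_disjPQ sh) eS eT).
Qed.

Lemma run_if_seen p st T (Q : store -> Prop) : reg st 0 = n ->
  (arr st aSEEN n == 0 -> Q st) -> (arr st aSEEN n != 0 -> run p st T Q) -> 0 < T ->
  run (If (TEq (Get aSEEN (Reg 0)) (Num 0)) Skip p) st (T + 5) Q.
Proof.
move=> g0 h1 h2 lT.
apply: (@run_weaken _ _ (tcost (TEq (Get aSEEN (Reg 0)) (Num 0)) + T).+1 _ _ _ _ _ (fun st' h => h)); last by rewrite /=; lia.
by apply: run_if; rewrite /= g0 => h; [apply: run_skip => //; exact: h1|exact: h2].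
Qed.

(** If one of the two augmenting searches fails, there is no linkage and hence no shunt, and the
    answer stays 0. *)
Lemma run_shunt_prog : decides_within shunt_prog (shunt_input adj s1 s2 t1 t2) answer
  (4000 * (n.+1 * (n.+1 * (m + n.+2)))).
Proof.
set st0 := shunt_input _ _ _ _ _; have E0 : env st0 := env_input adj s1 s2 t1 t2.
(* The decreasing multiples of [B] below are budgets for the rest of the program; the slack absorbs
   the linear costs. *)
pose B := n.+1 * (n.+1 * (m + n.+2)).
have nB : n.+1 <= B by rewrite /B leq_pmulr // muln_gt0 addnS.
have mB : m + n.+2 <= B by rewrite /B mulnA leq_pmull.
rewrite -/B; pose L := m + n.+2; rewrite -/L in mB.
have nL : n.+2 <= L by rewrite /L leq_addl.
suff R : run shunt_prog st0 (4000 * B) (fun st => (reg st 0 != 0) <-> answer) by exact: R.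
apply: (run_comp (T1 := 3900 * B) (T2 := 2) (Q1 := fun st => (reg st rANS != 0) <-> answer)); last by lia.
  apply: (run_comp (T1 := 2) (T2 := 3890 * B) (Q1 := fun st => st = set_reg st0 rANS 0)); last by lia.
    exact: run_flat.
  move=> _ ->; set st1 := set_reg st0 rANS 0.
  have E1 : env st1 by apply: env_agree (agree_set_reg st0 rANS 0) _ _ E0.
  apply: (run_comp_agree (run_setup ust E1) (T2 := 3800 * B)); last by move: nB; clear; lia.
  move=> sta Ma aga.
  have Ea : env sta by apply: env_agree aga _ _ E1.
  have [_ r1 _ _ _] := Ea.
  have Aa : reg sta rANS = 0 by case: aga => ->.
  have i1 : s1 \in [set s1; s2] by rewrite set21.
  apply: (run_comp (run_seek_answer Ea Ma i1 (subxx _) r1 isT) (T2 := 3500 * B)); last first.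
    by move: mB; rewrite /L; clear; lia.
  move=> stb [Eb Mb Ab Hb].
  have [[gb _] _ r2b _ _] := Eb; have [_ r1b _ _ _] := Eb.
  have le5 : 3490 * B + 5 <= 3500 * B by move: nB; clear; lia.
  apply: (run_weaken _ le5 (fun _ h => h)).
  apply: (run_if_seen gb) => [seen|seen|]; last by move: nB; clear; lia.
  - by rewrite seen in Hb; rewrite Ab Aa.
  - rewrite (negPf seen) in Hb; have [q [SE nq]] := Hb.
    apply: (run_comp_agree (run_augment adjP ust Eb Mb i1 (subxx _) r1b isT SE nq) (T2 := 3400 * B)); last first.
      by move: nB; clear; lia.
    move=> stc Mc agc.
    have Ec : env stc by apply: env_agree agc _ _ Eb.
    have [_ _ r2c _ _] := Ec.
    have Ac : reg stc rANS = 0 by case: agc => -> // _; rewrite Ab.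
    have i2 : s2 \in [set s1; s2] :\ s1 by rewrite !inE eqxx orbT eq_sym (s12 ust).
    have sub : [set s1; s2] :\ s1 \subset [set s1; s2] by exact: subD1set.
    apply: (run_comp (run_seek_answer Ec Mc i2 sub r2c isT) (T2 := 3100 * B)); last first.
      by move: mB; rewrite /L; clear; lia.
    move=> std [Ed Md Ad Hd].
    have [[gd _] _ r2d _ _] := Ed.
    have le5' : 3090 * B + 5 <= 3100 * B by move: nB; clear; lia.
    apply: (run_weaken _ le5' (fun _ h => h)).
    apply: (run_if_seen gd) => [seen'|seen'|]; last by move: nB; clear; lia.
    + by rewrite seen' in Hd; rewrite Ad Ac.
    + rewrite (negPf seen') in Hd; have [q' [SE' nq']] := Hd.
      apply: (run_comp_agree (run_augment adjP ust Ed Md i2 sub r2d isT SE' nq') (T2 := 3000 * B)); last first.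
        by move: nB; clear; lia.
      move=> ste Me age.
      have Ee : env ste by apply: env_agree age _ _ Ed.
      have Ae : reg ste rANS = 0 by case: age => -> // _; rewrite Ad.
      have Me0 : matching s1 s2 t1 t2 (arr ste 7) set0.
        suff <- : ([set s1; s2] :\ s1) :\ s2 = set0 by [].
        by apply/setP=> z; rewrite !inE; case: (z == s1); case: (z == s2).
      have [P [Q [V vP vQ]]] := linkage_of_matching ust Me0.
      apply: (run_comp_agree (@run_label D adj s1 s2 t1 t2 7 8 9 P Q ste isT isT isT isT isT Ee V vP vQ) (T2 := 2800 * B)); last first.
        by move: nB; clear; lia.
      move=> stf [Lf _ _ [pP pQ]] agf.
      have Ef : env stf by apply: env_agree agf _ _ Ee.
      have [[gf _] _ _ _ _] := Ef.
      have e7 : arr stf 7 = arr ste 7 by case: agf => _ ->.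
      pose stg := set_arr stf 9 n n.
      apply: (run_comp_agree (T1 := 3) (T2 := 2700 * B) (Q1 := fun st => st = stg)); last by move: nB; clear; lia.
        by apply: run_flat => //=; rewrite gf.
      move=> _ -> agg.
      have Eg : env stg by apply: env_agree agg _ _ Ef.
      have a9 w : arr stg 9 (code w) = arr stf 9 (code w).
        by rewrite /= /upd /= ltn_eqF // code_lt.
      have Bg : base P Q stg.
        split=> //.
        - by move=> w wm; rewrite a9; exact: pP.
        - by move=> w wm; rewrite a9; exact: pQ.
        - by rewrite /= /upd /= e7.
        - by rewrite /= /upd /= eqxx.
      have Ag : reg stg rANS = 0 by case: agf => hr _; rewrite /= hr.
      have le : 2600 * B <= 2700 * B by rewrite leq_mul2r orbT.
      exact: (run_weaken (run_swaps Eg V Bg Ag) le (fun _ h => h)).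
by move=> st h; apply: run_flat.
Qed.

End Total.

Theorem theorem31 :
  exists (p : prog) (c : nat),
    forall (D : digraph) (adj : D -> seq D) (s1 s2 t1 t2 : D),
      adjacency_lists adj ->
      uniq [:: s1; s2; t1; t2] ->
      let n := #|D| in
      let m := #|arcs D| in
      decides_within p (shunt_input adj s1 s2 t1 t2)
        (contains_shunt [set s1; s2] [set t1; t2])
        (c * (n ^ 2 * (n + m))).
Proof.
(* For [n > 0] the bound is at most [48000 * n ^ 2 * (n + m)]; writing the constant as a product
   keeps the unary numerals small. *)
exists shunt_prog, (300 * 300) => D adj s1 s2 t1 t2 adjP ust n m.
have [st [t [ex le h]]] := run_shunt_prog adjP ust.
exists st, t; split=> //; apply: leq_trans le _.
have n0 : 0 < n by apply/card_gt0P; exists s1.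
rewrite -/n -/m expnS expn1; move: n m n0 => a b a0 {ex h}.
have h1 : a.+1 <= 2 * a by lia.
have h2 : b + a.+2 <= 3 * (a + b) by lia.
apply: (@leq_trans (4000 * (2 * a * (2 * a * (3 * (a + b)))))).
  by rewrite leq_mul2l /= leq_mul // leq_mul.
nia.
Qed.
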